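(* Let $\Omega$ be a bounded convex domain in $\mathbb{C}^n$ and let $\phi\in C(\overline{\Omega})$ be such that the Hankel operator $H_{\phi}$ is compact on the Bergman space $A^2(\Omega)$. Then $\phi\circ f$ is holomorphic on $\mathbb{D}$ for any holomorphic $f:\mathbb{D}\to b\Omega$.
   Context: $\mathbb{D}$ is the open unit disc in $\mathbb{C}$, $b\Omega$ is the topological boundary of $\Omega$, and $C(\overline{\Omega})$ is the space of complex-valued continuous functions on the closure $\overline{\Omega}$. A holomorphic $f:\mathbb{D}\to b\Omega$ means a holomorphic map $f:\mathbb{D}\to\mathbb{C}^n$ with $f(\mathbb{D})\subset b\Omega$ (possibly constant). $L^2(\Omega)$ is the space of square integrable functions with respect to Lebesgue measure, and $A^2(\Omega)$ (the Bergman space) is the closed subspace of square integrable holomorphic functions. $P:L^2(\Omega)\to A^2(\Omega)$ is the orthogonal projection (Bergman projection). For $\phi\in L^{\infty}(\Omega)$ the Hankel operator $H_{\phi}:A^2(\Omega)\to L^2(\Omega)$ is defined by $H_{\phi}g=(I-P)(\phi g)$, where $I$ is the identity operator. *)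

(* Defs.v *)
From HB Require Import structures.
From mathcomp Require Import all_boot all_order all_algebra.
From mathcomp Require Import complex lra.
From mathcomp Require Import all_classical all_reals all_analysis.

Set Implicit Arguments.
Unset Strict Implicit.
Unset Printing Implicit Defensive.
Import Order.TTheory GRing.Theory Num.Theory.
Import numFieldNormedType.Exports.

Local Open Scope classical_set_scope.
Local Open Scope complex_scope.
Local Open Scope ring_scope.

(* R[i] as a one-dimensional normed space over itself; the norms of R[i] and of
   'rV[R[i]]_n take their values in R[i]. *)
HB.instance Definition _ (R : rcfType) := NormedModule.copy R[i] R[i]^o.

(* The instance that the library declares for the same fact is hidden by a later
   one, with the same key, for products of subprobabilities. *)
Lemma sigma_finite_prod d1 d2 (T1 : measurableType d1) (T2 : measurableType d2)
    (R : realType) (m1 : {sigma_finite_measure set T1 -> \bar R})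
    (m2 : {sigma_finite_measure set T2 -> \bar R}) :
  sigma_finite [set: T1 * T2] (m1 \x m2)%E.
Proof.
have /sigma_finiteP[F [TF ndF Foo]] := sigma_finiteT m1.
have /sigma_finiteP[G [TG ndG Goo]] := sigma_finiteT m2.
exists (fun k => F k `*` G k).
  rewrite -setXTT TF TG predeqE => -[x y]; split.
    move=> [/= [i _ Fix] [j _ Gjy]]; exists (maxn i j) => //; split.
    - by move: x Fix; exact/subsetPset/ndF/leq_maxl.
    - by move: y Gjy; exact/subsetPset/ndG/leq_maxr.
  by move=> [i _ []/= ? ?]; split; exists i.
move=> k; have [? ?] := Foo k; have [? ?] := Goo k.
split; first exact: measurableX.
by rewrite product_measure1E// lte_mul_pinfty// ge0_fin_numE.
Qed.

Section tuple_measure.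
Context d (T : measurableType d) (R : realType).
Variable mu : {sigma_finite_measure set T -> \bar R}.

Definition cons_pair n (p : T * n.-tuple T) : n.+1.-tuple T :=
  [tuple of p.1 :: p.2].

Lemma measurable_cons_pair n :
  measurable_fun [set: T * n.-tuple T] (@cons_pair n).
Proof. exact: measurable_cons. Qed.

Section cons_measure.
Context n (m : {sigma_finite_measure set (n.-tuple T) -> \bar R}).

Definition cons_measure : set (n.+1.-tuple T) -> \bar R :=
  pushforward (mu \x m)%E (@cons_pair n).

Let mc := @measurable_cons_pair n.

Let cons_measure0 : cons_measure set0 = 0%E.
Proof. by rewrite /cons_measure /pushforward preimage_set0 measure0. Qed.

Let cons_measure_ge0 A : (0 <= cons_measure A)%E.
Proof. exact: measure_ge0. Qed.

Let cons_measure_sigma_additive : semi_sigma_additive cons_measure.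
Proof.
by apply: (@measure_semi_sigma_additive _ _ _ (pushforward (mu \x m)%E (@cons_pair n))).
Qed.

HB.instance Definition _ := isMeasure.Build _ _ _ cons_measure
  cons_measure0 cons_measure_ge0 cons_measure_sigma_additive.

Let cons_measure_sigma_finite : sigma_finite setT cons_measure.
Proof.
have [F TF Foo] := sigma_finite_prod mu m.
pose uncons (t : n.+1.-tuple T) := (thead t, [tuple of behead t]).
have unconsK : cancel (@cons_pair n) uncons.
  by case=> x t; rewrite /uncons theadE; congr pair; exact: val_inj.
have muncons : measurable_fun setT uncons.
  apply: measurable_fun_pair; first exact: measurable_tnth.
  exact: measurable_behead.
exists (fun k => uncons @^-1` F k).
  by rewrite -preimage_bigcup -TF preimage_setT.
move=> k; have [mF Fk] := Foo k; split.
  by rewrite -[X in measurable X]setTI; exact: muncons.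
rewrite /cons_measure /pushforward/= -comp_preimage.
by rewrite (_ : uncons \o _ = id) ?preimage_id//; apply/funext.
Qed.

HB.instance Definition _ := Measure_isSigmaFinite.Build _ _ _ cons_measure
  cons_measure_sigma_finite.
End cons_measure.

(* The n-fold product of mu with itself. *)
Fixpoint tuple_measure n : {sigma_finite_measure set (n.-tuple T) -> \bar R} :=
  match n with
  | 0 => @dirac _ _ [tuple] R
  | n.+1 => cons_measure (tuple_measure n)
  end.

End tuple_measure.

Section complex_space.
Context {R : realType}.
Local Notation C := R[i].
Local Notation TR := (measurableTypeR R).

Definition borelC n := g_sigma_algebraType (@open 'rV[C]_n).

Definition of_reals n (t : n.-tuple (TR * TR)) : borelC n :=
  \row_j ((tnth t j).1 +i* (tnth t j).2).

Let normC_le (z : C) : `|z| <= (`|complex.Re z| + `|complex.Im z|)%:C.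
Proof.
rewrite {1}[z]complexE; apply: (le_trans (ler_normD _ _)).
rewrite normrM (_ : `|'i%C : C| = 1) ?mul1r; last first.
  by rewrite normc_def/= expr0n/= add0r expr1n sqrtr1.
by rewrite !normc_def/= !expr0n/= !addr0 !sqrtr_sqr -rmorphD.
Qed.

Lemma measurable_of_reals n :
  measurable_fun [set: n.-tuple (TR * TR)] (@of_reals n).
Proof.
apply: (@measurability _ _ _ (borelC n) _ _ (@open 'rV[C]_n)) => //.
move=> _ [U oU <-]; rewrite setTI.
pose r (k : nat) : R := k.+1%:R^-1.
pose box (p : n.-tuple (rat * rat) * nat) : set (n.-tuple (TR * TR)) :=
  [set t | forall j, `|(tnth t j).1 - ratr (tnth p.1 j).1| < r p.2 /\
                     `|(tnth t j).2 - ratr (tnth p.1 j).2| < r p.2].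
have mbox p : measurable (box p).
  rewrite (_ : box p = \bigcap_(j in [set: 'I_n]) ((fun t => tnth t j) @^-1`
    (ball (ratr (tnth p.1 j).1 : R) (r p.2) `*`
     ball (ratr (tnth p.1 j).2 : R) (r p.2)))); last first.
    apply/seteqP; split => [t bt j _|t bt j].
      by have [] := bt j; split; rewrite /= -ball_normE/= distrC.
    by have := bt j I; rewrite /= -ball_normE/= => -[]; rewrite /ball_/= !(distrC (ratr _)).
  apply: fin_bigcap_measurable; first exact: finite_finset.
  move=> j _; rewrite -[X in measurable X]setTI; apply: measurable_tnth => //.
  by apply: measurableX; rewrite ball_itv; exact: measurable_itv.
rewrite (_ : _ @^-1` _ =
    \bigcup_(p in [set p | box p `<=` @of_reals n @^-1` U]) box p); last first.
  apply/seteqP; split => [t Ut|t [p /= + pt]]; last exact.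
  have /nbhs_ballP[e /= e0 eU] := open_nbhs_nbhs (conj oU Ut).
  move: e0 eU; rewrite ltcE/= => /andP[/eqP]; case: e => e ie /= -> {ie} e0 eU.
  have [k ke] : exists k, r k < e / 4%:R.
    have e40 : 0 < e / 4%:R by rewrite divr_gt0.
    have [k _ /(_ k (leqnn k)) kP] := near_infty_natSinv_lt (PosNum e40).
    by exists k.
  have rk0 : 0 < r k by rewrite invr_gt0.
  have approx (x : R) : exists q : rat, `|x - ratr q| < r k.
    have /rat_in_itvoo[q] : x - r k < x + r k by lra.
    rewrite in_itv/= => /andP[xq qx]; exists q.
    by rewrite ltr_norml; lra.
  have [f1 f1P] := choice (fun j : 'I_n => approx (tnth t j).1).
  have [f2 f2P] := choice (fun j : 'I_n => approx (tnth t j).2).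
  exists ([tuple (f1 j, f2 j) | j < n], k) => /=; last first.
    by move=> j; rewrite tnth_mktuple.
  move=> u bu; apply: eU; split => [|i j]; first by rewrite ltcE/= eqxx.
  rewrite -ball_normE/= !mxE; apply: le_lt_trans (normC_le _) _.
  have := bu j; rewrite tnth_mktuple /= => -[u1 u2].
  have d1 := ler_distD (ratr (f1 j)) (tnth t j).1 (tnth u j).1.
  have d2 := ler_distD (ratr (f2 j)) (tnth t j).2 (tnth u j).2.
  rewrite ltcR/=; move: (f1P j) (f2P j) u1 u2 d1 d2 ke.
  rewrite (distrC (tnth u j).1) (distrC (tnth u j).2).
  by lra.
rewrite bigcup_mkcond; apply: countable_bigcupT_measurable => [|p].
  exact: countableP.
by case: ifP => // _; exact: mbox.
Qed.

Definition lebesgue2 : set (TR * TR)%type -> \bar R :=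
  (@lebesgue_measure R \x @lebesgue_measure R)%E.
HB.instance Definition _ := Measure.on lebesgue2.
HB.instance Definition _ := Measure_isSigmaFinite.Build _ _ _ lebesgue2
  (sigma_finite_prod (@lebesgue_measure R) (@lebesgue_measure R)).

(* Lebesgue measure on C^n, on Borel sets, through (x_j, y_j)_j |-> (x_j + i y_j)_j. *)
Definition lebesgueC n : set (borelC n) -> \bar R :=
  pushforward (tuple_measure lebesgue2 n) (@of_reals n).
Arguments lebesgueC n _ : clear implicits.

Section lebesgueC_measure.
Variable n : nat.
Let mof := @measurable_of_reals n.

Let lebesgueC0 : lebesgueC n set0 = 0%E.
Proof. by rewrite /lebesgueC /pushforward preimage_set0 measure0. Qed.

Let lebesgueC_ge0 A : (0 <= lebesgueC n A)%E.
Proof. exact: measure_ge0. Qed.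

Let lebesgueC_sigma_additive : semi_sigma_additive (@lebesgueC n).
Proof.
by apply: (@measure_semi_sigma_additive _ _ _
  (pushforward (tuple_measure lebesgue2 n) (@of_reals n))).
Qed.

HB.instance Definition _ := isMeasure.Build _ _ _ (lebesgueC n)
  lebesgueC0 lebesgueC_ge0 lebesgueC_sigma_additive.
End lebesgueC_measure.

End complex_space.
Arguments lebesgueC {R} n _.

Section complex_analysis.
Context {R : realType}.
Local Notation C := R[i].

Definition unit_disc : set C := [set z | `|z| < 1].

(* [differentiable] is Frechet differentiability over the scalars of the
   spaces, hence complex differentiability here. *)
Definition holomorphic_on (U W : normedModType C) (D : set U) (f : U -> W) :=
  forall z, D z -> differentiable f z.

Definition is_domain (U : normedModType C) (D : set U) :=
  [/\ open D, connected D & D !=set0].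

Definition boundary (U : normedModType C) (D : set U) :=
  closure D `\` interior D.

(* The elements of [{i01 R[i]}], over which [convex_set] quantifies, are the real
   numbers between 0 and 1. *)
Lemma convex_setCP (U : lmodType C) (D : set U) :
  convex_set D <-> forall x y (t : R), D x -> D y -> 0 <= t <= 1 ->
                     D (t%:C *: x + (1 - t)%:C *: y).
Proof.
split=> [cD x y t Dx Dy /andP[t0 t1]|cD x y l /set_mem Dx /set_mem Dy].
  have t01 : Itv.spec (@Itv.num_sem C) (Itv.Real `[0%Z, 1%Z]) t%:C.
    by rewrite /= /Itv.num_sem/= in_itv/= realE !lecR t0 t1.
  have /set_mem := cD x y (Itv.mk t01) (mem_set Dx) (mem_set Dy).
  by rewrite /conv/= rmorphB.
apply/mem_set.
have := cD x y (complex.Re l%:num) Dx Dy.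
have l0 : 0 <= l%:num :> C by [].
have l1 : l%:num <= 1 :> C by [].
have lE : (complex.Re l%:num)%:C = l%:num.
  by case: (l%:num) l0 => a b; rewrite lecE/= => /andP[/eqP-> _].
rewrite rmorphB/= lE; apply.
by rewrite -!lecR lE l0 l1.
Qed.

End complex_analysis.

Section bergman_space.
Context {R : realType} {n : nat}.
Local Notation C := R[i].
Local Notation V := 'rV[C]_n.
Local Notation TR := (measurableTypeR R).
Implicit Types (D : set V) (f g h phi : V -> C).

Definition cmeasurable_fun D f :=
  measurable_fun (T := borelC n) D (fun z : borelC n => complex.Re (f z) : TR) /\
  measurable_fun (T := borelC n) D (fun z : borelC n => complex.Im (f z) : TR).

Definition cintegral D f : C :=
  (\int[lebesgueC n]_(z in D) complex.Re (f z)) +i*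
  (\int[lebesgueC n]_(z in D) complex.Im (f z)).

Definition L2norm D f : \bar R :=
  'N[lebesgueC n]_2%:E[(fun z => (ComplexField.Normc.normc ((f \_ D) z))%:E)]%E.

(* Elements of L^2(D) are represented by functions on the whole space, of which
   only the values on D matter, and then only up to a null set. *)
Definition L2 D f := cmeasurable_fun D f /\ (L2norm D f < +oo)%E.

Definition L2inner D f g : C := cintegral D (fun z => f z * (g z)^*%C).

Definition A2 D f := holomorphic_on D f /\ L2 D f.

(* For D open and f in L^2(D) the set below is not empty, and any two of its
   elements agree on D. *)
Definition bergman_proj D f : V -> C :=
  xget (fun=> 0) [set g | A2 D g /\ forall h, A2 D h -> L2inner D (f - g) h = 0].

Definition hankel D phi g : V -> C := phi * g - bergman_proj D (phi * g).

(* Compactness of T : A^2(D) -> L^2(D), by sequences. *)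
Definition compact_operator D (T : (V -> C) -> (V -> C)) :=
  forall g_ : nat -> V -> C,
    (forall k, A2 D (g_ k)) ->
    (exists M : R, forall k, (L2norm D (g_ k) <= M%:E)%E) ->
    exists (s : nat -> nat) (h : V -> C),
      [/\ {homo s : i j / (i < j)%N}, L2 D h &
          L2norm D (T (g_ (s k)) - h) @[k --> \oo] --> 0%E].

End bergman_space.

(* Main.v *)
Require Import Defs.
From HB Require Import structures.
From mathcomp Require Import all_boot all_order all_algebra.
From mathcomp Require Import perm complex ring lra.
From mathcomp Require Import all_classical all_reals all_analysis.
From mathcomp Require Import measurable_realfun.
Set Implicit Arguments.
Unset Strict Implicit.
Unset Printing Implicit Defensive.
Import Order.TTheory GRing.Theory Num.Theory.
Import numFieldNormedType.Exports.
Local Open Scope classical_set_scope.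
Local Open Scope complex_scope.
Local Open Scope ring_scope.

(** Let f map the disc into the boundary of Omega.  For q0 in Omega and t > 0
the map F_t = (1 - t) f + t q0 sends the disc into Omega, and F_t tends to f uniformly as
t tends to 0.  Put w = F_t(0).

Near w the domain is compared with a polydisc.  Among the functionals A with
Re (A (z - w)) <= 1 on Omega take A_1, ..., A_n whose determinant is at least half
the supremum; by Cramer's rule and separation, w + v lies in Omega as soon as
|A_i v| <= 1/(4n) for all i ([polar_frame]).  Let nu be the volume of the cell
0 <= Re A_i v, Im A_i v <= 1.  The function g = nu^(-1/2) prod_i (2 - A_i (z - w))^(-2) is holomorphic on Omega, its norm in
A^2(Omega) is at most a constant that depends on n alone, and |g|^2 >= c / nu on the
polydisc E around w ([test_function]).

As t tends to 0 the polydiscs E_t leave every point of Omega, because they are symmetric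
about centres that tend to f(0), which is not in Omega ([reflection_leaves]).  Compactness
of the Hankel operator then gives holomorphic h_t for which the square integral of
phi g_t - h_t over E_t is arbitrarily small ([hankel_small]); division by g_t shows that
phi is close to the holomorphic function h_t / g_t in quadratic mean over E_t, relative to
the volume of E_t.

The same functionals keep the discs F_t inside the polydiscs: A_i (F_t - w) has real part
at most 1 and vanishes at 0, so by the Borel-Caratheodory inequality it is small on a disc
about 0 that does not depend on t.  Hence F_t + v maps a fixed square into E_t for all v in
a smaller polydisc.  Average over these v the amount by which phi (F_t + v) violates
Cauchy's integral formula on the square: by Tonelli's theorem and translation invariance it
is controlled by the quadratic mean of phi - h_t / g_t ([cauchy_defect]).  Since
phi (F_t + v) is uniformly close to phi o f, the formula holds for phi o f near 0, and so
phi o f is complex differentiable at 0 ([boundary_differentiable]).  The other points of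
the disc follow by an affine change of variable.

The one-variable theory is developed for squares: Goursat's theorem by repeated
subdivision, then Cauchy's formula, a Schwarz estimate and the Borel-Caratheodory
inequality. *)

(** * Real-valued norms on complex normed spaces *)

Section real_norm.
Variable R : realType.
Local Notation C := R[i].

(** The norms of R[i] and of its normed spaces have values in R[i]; their real parts
can be compared with real numbers by linear arithmetic. *)
Definition rnorm (V : normedModType C) (v : V) : R := complex.Re `|v|.
Section gen.
Variable V : normedModType C.
Implicit Types v w : V.
Lemma rnormE v : `|v| = (rnorm v)%:C.
Proof. by rewrite /rnorm RRe_real ?normr_real. Qed.
Lemma rnorm_ge0 v : 0 <= rnorm v.
Proof. by rewrite -ler0c -rnormE. Qed.
Lemma rnormD v w : rnorm (v + w) <= rnorm v + rnorm w.
Proof. by rewrite -lecR rmorphD/= -!rnormE ler_normD. Qed.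
Lemma rnormN v : rnorm (- v) = rnorm v.
Proof. by rewrite /rnorm normrN. Qed.
Lemma rnorm0 : rnorm (0 : V) = 0.
Proof. by rewrite /rnorm normr0. Qed.
Lemma rnormZ (a : C) v : rnorm (a *: v) = rnorm a * rnorm v.
Proof. by apply: complexI; rewrite rmorphM/= -!rnormE normrZ. Qed.
Lemma rnorm_eq0 v : (rnorm v == 0) = (v == 0).
Proof. by rewrite -(inj_eq (@complexI R)) -rnormE normr_eq0. Qed.
Lemma nbhs_rnorm (z : V) (A : set V) :
  nbhs z A <-> exists2 e : R, 0 < e & forall w, rnorm (w - z) < e -> A w.
Proof.
rewrite -nbhs_ballE; split.
  move=> [e /= e0 eA]; exists (complex.Re e).
    by move: e0; rewrite ltcE => /andP[].
  move=> w we; apply: eA; rewrite -ball_normE/= distrC rnormE.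
  move: e0; rewrite ltcE/= => /andP[/eqP ie _].
  by rewrite ltcE/= ie eqxx.
move=> [e e0 eA]; exists e%:C; first by rewrite /= ltcR.
by move=> w; rewrite -ball_normE/= distrC rnormE ltcR; exact: eA.
Qed.
End gen.
Lemma rnormM (a b : C) : rnorm (a * b) = rnorm a * rnorm b.
Proof. exact: (@rnormZ C). Qed.
Lemma rnorm_real (x : R) : rnorm (x%:C) = `|x|.
Proof. by rewrite /rnorm normc_def/= expr0n/= addr0 sqrtr_sqr. Qed.

(** Real epsilons suffice to test complex differentiability in one variable. *)
Lemma differentiable_rnormP (V : normedModType C) (f : C -> V) z :
  differentiable f z <->
  exists a : V, forall e : R, 0 < e -> exists2 d : R, 0 < d &
    forall h : C, rnorm h < d -> rnorm (f (z + h) - f z - h *: a) <= e * rnorm h.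
Proof.
split.
  move=> /(derivable1_diffP f z) => df.
  have {df} : (fun h => h^-1 *: ((f \o shift z) (h *: 1) - f z)) @ 0^' --> 'D_1 f z by [].
  move=> dfl; exists ('D_1 f z) => e e0.
  have nb : nbhs ('D_1 f z) [set w | rnorm (w - 'D_1 f z) < e] by apply/nbhs_rnorm; exists e.
  have /nbhs_rnorm[d d0 dP] := dfl _ nb.
  exists d => // h hd; have [->|h0] := eqVneq h 0.
    by rewrite addr0 scale0r !subrr !rnorm0 mulr0.
  have := dP h; rewrite subr0 => /(_ hd h0) /=.
  rewrite [h *: 1]mulr1 [h + z]addrC => lt.
  rewrite (_ : _ - _ - _ = h *: (h^-1 *: (f (z + h) - f z) - 'D_1 f z)).
    by rewrite rnormZ mulrC ler_wpM2r ?rnorm_ge0// ltW.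
  by rewrite scalerBr scalerA mulfV// scale1r.
move=> [a aP]; apply/(derivable1_diffP f z).
apply/cvg_ex; exists a => A /nbhs_rnorm[e e0 eA].
have e20 : 0 < e / 2 by rewrite divr_gt0.
have [d d0 dP] := aP _ e20.
apply/nbhs_rnorm; exists d => // h; rewrite subr0 => hd h0; apply: eA => /=.
rewrite [h *: 1]mulr1 [h + z]addrC.
have hn0 : 0 < rnorm h by rewrite lt_def rnorm_ge0 rnorm_eq0 h0.
have -> : h^-1 *: (f (z + h) - f z) - a = h^-1 *: (f (z + h) - f z - h *: a).
  by rewrite [RHS]scalerBr scalerA mulVf// scale1r.
rewrite -(ltr_pM2l hn0) -rnormZ scalerA mulfV// scale1r.
apply: le_lt_trans (dP _ hd) _; rewrite mulrC ltr_pM2l//; lra.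
Qed.
End real_norm.

Section complex_norm.
Variable R : realType.
Local Notation C := R[i].

Lemma rnorm_normc (z : C) : rnorm z = ComplexField.Normc.normc z.
Proof. by case: z. Qed.

Lemma normr_Re (z : C) : `|complex.Re z| <= rnorm z.
Proof. by rewrite -lecR -(@rnormE R C) normc_ge_Re. Qed.

Lemma normr_Im (z : C) : `|complex.Im z| <= rnorm z.
Proof.
rewrite rnorm_normc; case: z => a b /=; rewrite -sqrtr_sqr ler_wsqrtr//.
by rewrite lerDr sqr_ge0.
Qed.

Lemma rnorm_le_ReIm (z : C) : rnorm z <= `|complex.Re z| + `|complex.Im z|.
Proof.
have := @rnormD R C (complex.Re z)%:C ('i * (complex.Im z)%:C).
rewrite -complexE => /le_trans; apply.
by rewrite rnormM !rnorm_real [X in X * _](_ : _ = 1) ?mul1r// rnorm_normc /= expr0n/= add0r expr1n sqrtr1.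
Qed.

Lemma rnormi : rnorm ('i : C) = 1.
Proof. by rewrite rnorm_normc /= expr0n/= add0r expr1n sqrtr1. Qed.

Lemma continuous_Re (z : C) : {for z, continuous (fun z : C => complex.Re z : R)}.
Proof.
move=> A /nbhs_ballP[e /= e0 eA]; apply/nbhs_rnorm; exists e => // w wz; apply: eA.
rewrite -ball_normE/= distrC -raddfB; apply: le_lt_trans wz; exact: normr_Re.
Qed.

Lemma continuous_Im (z : C) : {for z, continuous (fun z : C => complex.Im z : R)}.
Proof.
move=> A /nbhs_ballP[e /= e0 eA]; apply/nbhs_rnorm; exists e => // w wz; apply: eA.
rewrite -ball_normE/= distrC -raddfB; apply: le_lt_trans wz; exact: normr_Im.
Qed.

Lemma continuous_rnorm (V : normedModType C) (z : V) :
  {for z, continuous (fun z : V => rnorm z : R)}.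
Proof.
move=> A /nbhs_ballP[e /= e0 eA]; apply/nbhs_rnorm; exists e => // w wz; apply: eA.
rewrite -ball_normE/= distrC; apply: le_lt_trans wz.
have := rnormD (w - z) z; have := rnormD (z - w) w; rewrite !subrK -opprB rnormN => h1 h2.
rewrite ler_norml; lra.
Qed.

(** Both sides agree on half-open intervals, which determine the measure. *)
Lemma lebesgue_measure_shift (c : R) (A : set (measurableTypeR R)) : measurable A ->
  pushforward (@lebesgue_measure R) (fun x : measurableTypeR R => x + c : measurableTypeR R) A
    = lebesgue_measure A.
Proof.
have mc : measurable_fun [set: measurableTypeR R] (fun x : measurableTypeR R => x + c : measurableTypeR R).
  exact: measurable_funD.
move=> mA; apply/esym.
pose mu' := @pushforward _ _ _ _ _ (@lebesgue_measure R)
   (fun x : measurableTypeR R => x + c : measurableTypeR R).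
have := @lebesgue_measure_unique R mu'.
apply => //= _ [[a b]] _ <-.
rewrite /mu' /pushforward/= (_ : _ @^-1` _ = `]a - c, b - c]%classic); last first.
  by apply/seteqP; split => x /=; rewrite !in_itv/= ltrBlDr lerBrDr.
rewrite !lebesgue_measure_itv/= !lte_fin ltrD2r -EFinB.
by rewrite opprB -EFinD addrA subrK.
Qed.
End complex_norm.

(** * Complex-valued integrals over an interval *)

Section interval_integral.
Variable R : realType.
Local Notation C := R[i].
Local Notation leb := (@lebesgue_measure R).

Definition rcont (d : R) (f : R -> R) := forall s, 0 <= s <= d -> {for s, continuous f}.
Definition ccont (d : R) (F : R -> C) := forall s, 0 <= s <= d -> {for s, continuous F}.

Lemma rcont_integrable d f : rcont d f -> leb.-integrable `[0, d] (EFin \o f).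
Proof.
move=> fc; apply: continuous_compact_integrable; first exact: segment_compact.
by apply: continuous_in_subspaceT => s /set_mem /= sd; apply: fc; rewrite in_itv/= in sd.
Qed.

Lemma ccont_Re d F : ccont d F -> rcont d (fun s => complex.Re (F s)).
Proof. by move=> Fc s sd; apply: continuous_comp; [exact: Fc|exact: continuous_Re]. Qed.
Lemma ccont_Im d F : ccont d F -> rcont d (fun s => complex.Im (F s)).
Proof. by move=> Fc s sd; apply: continuous_comp; [exact: Fc|exact: continuous_Im]. Qed.
Lemma ccont_rnorm d F : ccont d F -> rcont d (fun s => rnorm (F s)).
Proof. by move=> Fc s sd; apply: continuous_comp; [exact: Fc|exact: continuous_rnorm]. Qed.

Lemma ccontD d F G : ccont d F -> ccont d G -> ccont d (fun s => F s + G s).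
Proof. by move=> Fc Gc s sd; apply: continuousD; [exact: Fc|exact: Gc]. Qed.
Lemma ccontM d F G : ccont d F -> ccont d G -> ccont d (fun s => F s * G s).
Proof. by move=> Fc Gc s sd; apply: (@continuousM C); [exact: Fc|exact: Gc]. Qed.
Lemma ccont_cst d c : ccont d (fun=> c).
Proof. by move=> s _; exact: cst_continuous. Qed.
Lemma ccontN d F : ccont d F -> ccont d (fun s => - F s).
Proof. by move=> Fc s sd; apply: continuousN; exact: Fc. Qed.
Lemma continuous_real_complex : continuous (fun s : R => s%:C : C).
Proof.
move=> s A /nbhs_rnorm[e e0 eA]; apply/nbhs_ballP; exists e => //= t.
by rewrite -ball_normE/= distrC => st; apply: eA; rewrite -rmorphB rnorm_real.
Qed.

Definition cint (d : R) (F : R -> C) : C :=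
  (\int[leb]_(s in `[0, d]) complex.Re (F s)) +i* (\int[leb]_(s in `[0, d]) complex.Im (F s)).

Lemma eq_cint d F G : (forall s, 0 <= s <= d -> F s = G s) -> cint d F = cint d G.
Proof.
by move=> FG; congr (_ +i* _); apply: eq_Rintegral => s /set_mem/=; rewrite in_itv/= => /FG ->.
Qed.

Lemma cintD d F G : ccont d F -> ccont d G ->
  cint d (fun s => F s + G s) = cint d F + cint d G.
Proof.
move=> Fc Gc; rewrite /cint; apply/eqP; rewrite eq_complex/=.
have mI : measurable (`[0, d]%classic : set (measurableTypeR R)) by exact: measurable_itv.
rewrite -!RintegralD//; try (by apply: rcont_integrable; first [exact: ccont_Re|exact: ccont_Im]).
by apply/andP; split; apply/eqP; apply: eq_Rintegral => s _; rewrite raddfD.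
Qed.

Lemma cintZ d c F : ccont d F -> cint d (fun s => c * F s) = c * cint d F.
Proof.
move=> Fc; rewrite /cint; apply/eqP; rewrite eq_complex; case: c => a b /=.
have mI : measurable (`[0, d]%classic : set (measurableTypeR R)) by exact: measurable_itv.
have iR := rcont_integrable (ccont_Re Fc); have iI := rcont_integrable (ccont_Im Fc).
rewrite -!RintegralZl//.
have h c (f : R -> R) : leb.-integrable `[0, d] (EFin \o f) ->
  leb.-integrable `[0, d] (EFin \o (fun s => c * f s)).
  by move=> fi; have := integrableZl mI c fi; apply: eq_integrable.
rewrite -RintegralB -?RintegralD//; try exact: h.
by apply/andP; split; apply/eqP; apply: eq_Rintegral => s _; case: (F s).
Qed.

Lemma cintN d F : ccont d F -> cint d (fun s => - F s) = - cint d F.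
Proof.
move=> Fc; rewrite -mulN1r -cintZ//; apply: eq_cint => s _; by rewrite mulN1r.
Qed.

(** The factor 2 comes from bounding the real and the imaginary parts separately. *)
Lemma rnorm_cint d F : ccont d F ->
  rnorm (cint d F) <= 2 * \int[leb]_(s in `[0, d]) rnorm (F s).
Proof.
move=> Fc; apply: le_trans (rnorm_le_ReIm _) _ => /=.
have mI : measurable (`[0, d]%classic : set (measurableTypeR R)) by exact: measurable_itv.
have iR := rcont_integrable (ccont_Re Fc); have iI := rcont_integrable (ccont_Im Fc).
have iN := rcont_integrable (ccont_rnorm Fc).
rewrite mulr2n mulrDl mul1r lerD//; apply: le_trans (le_normr_Rintegral mI _) _ => //;
  apply: le_Rintegral => //; try exact: integrable_norm.
  by move=> s _; exact: normr_Re.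
by move=> s _; exact: normr_Im.
Qed.

Lemma rnorm_cint_le d F M : 0 <= d -> ccont d F ->
  (forall s, 0 <= s <= d -> rnorm (F s) <= M) -> rnorm (cint d F) <= 2 * (M * d).
Proof.
move=> d0 Fc FM; apply: le_trans (rnorm_cint Fc) _.
have mI : measurable (`[0, d]%classic : set (measurableTypeR R)) by exact: measurable_itv.
rewrite ler_pM2l// (_ : M * d = \int[leb]_(s in `[0, d]) M); last first.
  rewrite Rintegral_cst//= lebesgue_measure_itv/= lte_fin.
  by case: ltgtP d0 => //= [_|<-] _; rewrite ?oppr0 ?addr0.
apply: le_Rintegral => //.
- exact: rcont_integrable (ccont_rnorm Fc).
- by apply: (@rcont_integrable d (cst M)) => s _; exact: cst_continuous.
Qed.

Lemma Rintegral_shift a b (f : R -> R) : leb.-integrable `[a, a + b] (EFin \o f) ->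
  leb.-integrable `[0, b] (EFin \o (fun s => f (a + s))) ->
  \int[leb]_(s in `[a, a + b]) f s = \int[leb]_(s in `[0, b]) f (a + s).
Proof.
move=> fi fi'.
have mI : measurable (`[a, a + b]%classic : set (measurableTypeR R)) by exact: measurable_itv.
have mc : measurable_fun [set: measurableTypeR R] (fun x : measurableTypeR R => x + a : measurableTypeR R).
  exact: measurable_funD.
rewrite /Rintegral; congr fine.
have e : (fun x : measurableTypeR R => x + a : measurableTypeR R) @^-1` `[a, a + b] = `[0, b]%classic.
  by apply/seteqP; split => x /=; rewrite !in_itv/= lerDr [x + a]addrC lerD2l.
(* The change of variable is applied to a function measurable on the whole line. *)
pose g := (EFin \o f) \_ `[a, a + b].
have mg : measurable_fun [set: measurableTypeR R] g.
  by apply/(measurable_restrictT _ mI); case/integrableP : fi.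
have gE s : `[0, b]%classic s -> g (s + a) = (f (a + s))%:E.
  by rewrite -e => sb; rewrite /g patchE mem_set//= addrC.
transitivity (\int[leb]_(x in `[a, (a + b)%R]) g x)%E.
  by apply: eq_integral => x xI; rewrite /g patchE xI.
transitivity (\int[pushforward leb (fun x : measurableTypeR R => (x + a)%R : measurableTypeR R)]_(x in `[a, (a + b)%R]) g x)%E.
  by apply: eq_measure_integral => A mA _; symmetry; exact: lebesgue_measure_shift.
rewrite (integral_pushforward mc mg) ?e//.
  by apply: eq_integral => x /set_mem xI /=; rewrite gE.
apply: eq_integrable fi'; first exact: measurable_itv.
by move=> x /set_mem xI /=; rewrite gE.
Qed.

Lemma cint_split a b F : 0 <= a -> 0 <= b -> ccont (a + b) F ->
  cint (a + b) F = cint a F + cint b (fun s => F (a + s)).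
Proof.
move=> a0 b0 Fc.
have Fc' : ccont b (fun s => F (a + s)).
  move=> s /andP[s0 sb]; apply: (@continuous_comp _ _ _ (+%R a)).
    by apply: continuousD; [exact: cst_continuous|exact: id].
  by apply: Fc; rewrite addr_ge0//= lerD2l.
have main (f : R -> R) : rcont (a + b) f -> rcont b (fun s => f (a + s)) ->
  \int[leb]_(s in `[0, a + b]) f s =
  \int[leb]_(s in `[0, a]) f s + \int[leb]_(s in `[0, b]) f (a + s).
  move=> fc fc'; have fi := rcont_integrable fc.
  have sub : `[a, a + b] `<=` `[0, a + b].
    by apply: subset_itvr; rewrite bnd_simp.
  rewrite -Rintegral_shift; [|by apply: integrableS fi => //; exact: sub|exact: rcont_integrable].
  have ab : (BRight a <= BRight (a + b))%O by rewrite bnd_simp lerDl.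
  have := @Rintegral_itvB R f (BLeft 0) (BRight (a + b)) a fi _ ab; rewrite bnd_simp => /(_ a0) E.
  have E2 : \int[leb]_(x in `]a, a + b]) f x = \int[leb]_(x in `[a, a + b]) f x.
    apply: Rintegral_itv_obnd_cbnd.
    by apply: integrableS fi => //; apply: subset_itvr; rewrite bnd_simp.
  by rewrite -E2 -E [RHS]addrC subrK.
rewrite /cint; apply/eqP; rewrite eq_complex/=.
by rewrite !main; try (by [apply/andP; split; apply/eqP]); first [exact: ccont_Re|exact: ccont_Im].
Qed.
End interval_integral.

(** * Induction on subsquares *)

Section subdivision.
Variable R : realType.
Local Notation C := R[i].

Definition square (p : C) (d : R) : set C :=
  [set z | 0 <= complex.Re z - complex.Re p <= d /\ 0 <= complex.Im z - complex.Im p <= d].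

(** The left ends increase and are bounded by every right end; their supremum lies in
all the intervals. *)
Lemma nested_intervals (x d : nat -> R) :
  (forall n, 0 <= d n) -> (forall n, x n <= x n.+1) ->
  (forall n, x n.+1 + d n.+1 <= x n + d n) ->
  exists c, forall n, x n <= c <= x n + d n.
Proof.
move=> d0 xx xd.
have mx m n : x n <= x (n + m)%N.
  by elim: m => [|m IH]; rewrite ?addn0// addnS (le_trans IH).
have md m n : x (n + m)%N + d (n + m)%N <= x n + d n.
  by elim: m => [|m IH]; rewrite ?addn0// addnS (le_trans _ IH).
have ub n m : x m <= x n + d n.
  have [mn|/ltnW nm] := leqP m n.
    by rewrite -(subnKC mn) (le_trans (mx (n - m)%N m))// lerDl.
  by rewrite -(subnKC nm); apply: le_trans (md (m - n)%N n); rewrite lerDl.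
exists (sup (range x)) => n.
have hs : has_sup (range x).
  by split; [exists (x 0%N), 0%N|exists (x 0%N + d 0%N) => _ [m _ <-]; exact: ub].
apply/andP; split; first by apply: ub_le_sup; [case: hs|exists n].
by apply: ge_sup; [case: hs|move=> _ [m _ <-]; exact: ub].
Qed.

(** A property that holds for all small squares around every point, and that passes from
the four quarters of a square to the square, holds for the whole square: otherwise one
could choose bad quarters forever, and these shrink to a point.  It takes
the place of compactness of the square. *)
Lemma square_ind (P : C -> R -> Prop) (p0 : C) (d0 : R) : 0 < d0 ->
  (forall z, square p0 d0 z -> exists2 e : R, 0 < e & forall p d, 0 < d < e ->
     square p d `<=` square p0 d0 -> square p d z -> P p d) ->
  (forall p d, 0 < d -> square p (d + d) `<=` square p0 d0 ->
     P p d -> P (p + d%:C) d -> P (p + 'i * d%:C) d -> P (p + d%:C + 'i * d%:C) d ->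
     P p (d + d)) ->
  P p0 d0.
Proof.
move=> d00 loc step; apply: contrapT => NP.
pose dd n := d0 / 2 ^+ n.
have dd0 n : 0 < dd n by rewrite divr_gt0// exprn_gt0.
have ddS n : dd n = dd n.+1 + dd n.+1.
  by rewrite /dd exprS; field; rewrite lt0r_neq0// exprn_gt0.
(* Starting from a square without P, at each step one of the quarters is bad; b encodes which
   one. *)
pose bad n (p : C) := ~ P p (dd n) /\ square p (dd n) `<=` square p0 d0.
pose q (p : C) (d : R) (b : bool * bool) : C :=
  (complex.Re p + d *+ b.1) +i* (complex.Im p + d *+ b.2).
have next n p : bad n p -> exists b, bad n.+1 (q p (dd n.+1) b).
  move=> [NPp sub]; apply: contrapT => /forallNP nb; apply: NPp.
  have sub_b b : square (q p (dd n.+1) b) (dd n.+1) `<=` square p0 d0.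
    apply: subset_trans sub => z; rewrite /square/= [dd n]ddS; have := dd0 n.+1.
    case: b => -[] [] /=; rewrite ?mulr1n ?mulr0n => ? [/andP[? ?] /andP[? ?]];
      split; apply/andP; split; lra.
  have PP b : P (q p (dd n.+1) b) (dd n.+1).
    by apply: contrapT => h; apply: (nb b); split.
  have e (b : bool * bool) : q p (dd n.+1) b = p + ((dd n.+1)%:C) *+ b.1 + 'i * (dd n.+1)%:C *+ b.2.
    apply/eqP; rewrite eq_complex /q; case: b => -[] [] /=; rewrite ?mulr1n ?mulr0n ?addr0 /=;
    by case: (p) => ? ?/=; simpc; rewrite ?eqxx.
  rewrite [dd n]ddS; apply: step => //; first by rewrite -ddS.
  - by have := PP (false, false); rewrite e/= !mulr0n !addr0.
  - by have := PP (true, false); rewrite e/= mulr0n !addr0.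
  - by have := PP (false, true); rewrite e/= mulr0n !addr0.
  - by have := PP (true, true); rewrite e/=.
have /choice[g gP] : forall x : nat * C, exists b, bad x.1 x.2 -> bad x.1.+1 (q x.2 (dd x.1.+1) b).
  move=> [n p] /=; have [h|h] := pselect (bad n p); last by exists (true, true).
  by have [b bP] := next _ _ h; exists b.
pose s := fix s n := if n is n.+1 then q (s n) (dd n.+1) (g (n, s n)) else p0.
have sbad n : bad n (s n).
  elim: n => [|n IH]; last exact: (gP (n, s n) IH).
  by split=> //; rewrite /dd expr0 divr1.
have [x xP] : exists c, forall n, complex.Re (s n) <= c <= complex.Re (s n) + dd n.
  apply: nested_intervals => n; first exact: ltW; rewrite ?[dd n]ddS; have := dd0 n.+1;
  by rewrite /=; case: (g _).1; rewrite ?mulr1n ?mulr0n; lra.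
have [y yP] : exists c, forall n, complex.Im (s n) <= c <= complex.Im (s n) + dd n.
  apply: nested_intervals => n; first exact: ltW; rewrite ?[dd n]ddS; have := dd0 n.+1;
  by rewrite /=; case: (g _).2; rewrite ?mulr1n ?mulr0n; lra.
have zs n : square (s n) (dd n) (x +i* y).
  have /andP[? ?] := xP n; have /andP[? ?] := yP n.
  by split; apply/andP; split => /=; lra.
have [e e0 eP] := loc _ ((sbad 0%N).2 _ (zs 0%N)).
have [n ne] : exists n, dd n < e.
  have := @archi_boundP R (d0 / e) (ltW (divr_gt0 d00 e0)).
  set n := Num.bound _ => nP; exists n.
  rewrite /dd ltr_pdivrMr ?exprn_gt0// mulrC -ltr_pdivrMr//.
  by apply: lt_trans nP _; rewrite -natrX ltr_nat ltn_expl.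
by have [NPn sub] := sbad n; apply: NPn; apply: eP => //; rewrite dd0.
Qed.
End subdivision.

(** * Contour integrals over squares *)

Section contours.
Variable R : realType.
Local Notation C := R[i].

Definition cont_on (D : set C) (F : C -> C) := forall z, D z -> {for z, continuous F}.

(** The segment starts at p, has direction e and is parametrized by [0, d]. *)
Definition segment_integral (F : C -> C) (p e : C) (d : R) : C := cint d (fun s => F (p + e * s%:C)).

(** The four sides of the square with lower left corner p and side d are run through
simultaneously, so that the contour integral is a single integral over [0, d]. *)
Definition side_sum (F : C -> C) (p : C) (d s : R) : C :=
  F (p + s%:C) - F (p + 'i * d%:C + s%:C) + 'i * F (p + d%:C + 'i * s%:C) - 'i * F (p + 'i * s%:C).
Definition contour (F : C -> C) (p : C) (d : R) : C := cint d (side_sum F p d).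

Lemma ccont_line (F : C -> C) p e d :
  (forall s, 0 <= s <= d -> {for p + e * s%:C, continuous F}) ->
  ccont d (fun s => F (p + e * s%:C)).
Proof.
move=> Fc s sd; apply: (@continuous_comp _ _ _ (fun s : R => p + e * s%:C)); last exact: Fc.
apply: continuousD; first exact: cst_continuous.
by apply: (@continuousM C); [exact: cst_continuous|exact: continuous_real_complex].
Qed.

Definition edge (p : C) (d : R) : set C := [set z | exists2 s : R, 0 <= s <= d &
  [\/ z = p + s%:C, z = p + 'i * d%:C + s%:C, z = p + d%:C + 'i * s%:C | z = p + 'i * s%:C]].

Lemma square_edges (p : C) (d s : R) : 0 <= s <= d ->
  [/\ square p d (p + s%:C), square p d (p + 'i * d%:C + s%:C),
      square p d (p + d%:C + 'i * s%:C) & square p d (p + 'i * s%:C)].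
Proof.
move=> /andP[s0 sd]; split; case: p => a b; split; apply/andP; split; rewrite /= ?mul0r ?mul1r; lra.
Qed.

Lemma edge_square p d : edge p d `<=` square p d.
Proof. by move=> z [s sd]; have [? ? ? ?] := square_edges p sd; case=> ->. Qed.

Lemma edgeP (p : C) (d s : R) : 0 <= s <= d ->
  [/\ edge p d (p + s%:C), edge p d (p + 'i * d%:C + s%:C),
      edge p d (p + d%:C + 'i * s%:C) & edge p d (p + 'i * s%:C)].
Proof.
by move=> sd; split; exists s => //; [constructor 1|constructor 2|constructor 3|constructor 4].
Qed.

Section edges.
Variables (F : C -> C) (p : C) (d : R).
Hypothesis Fc : cont_on (edge p d) F.

Lemma ccont_edges : [/\ ccont d (fun s : R => F (p + 1 * s%:C)),
  ccont d (fun s : R => F (p + 'i * d%:C + 1 * s%:C)),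
  ccont d (fun s : R => F (p + d%:C + 'i * s%:C)) & ccont d (fun s : R => F (p + 'i * s%:C))].
Proof.
by split; apply: ccont_line => s sd; apply: Fc; have [] := edgeP p sd; rewrite ?mul1r.
Qed.

Lemma ccont_side_sum : ccont d (side_sum F p d).
Proof.
have e z : (fun s : R => F (z + 1 * s%:C)) = fun s => F (z + s%:C).
  by apply/funext => s; rewrite mul1r.
have [] := ccont_edges; rewrite !e => c1 c2 c3 c4.
have c3' := ccontM (@ccont_cst R d 'i) c3.
have c4' := ccontN (ccontM (@ccont_cst R d 'i) c4).
exact: (ccontD (ccontD (ccontD c1 (ccontN c2)) c3') c4').
Qed.

Lemma contour_segments : contour F p d =
  segment_integral F p 1 d - segment_integral F (p + 'i * d%:C) 1 d + 'i * segment_integral F (p + d%:C) 'i d - 'i * segment_integral F p 'i d.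
Proof.
have [c1 c2 c3 c4] := ccont_edges.
have c3' := ccontM (@ccont_cst R d 'i) c3; have c4' := ccontM (@ccont_cst R d 'i) c4.
rewrite /segment_integral -(cintN c2) -(cintZ 'i c3) -(cintZ 'i c4) -(cintN c4').
rewrite -(cintD c1 (ccontN c2)) -(cintD (ccontD c1 (ccontN c2)) c3').
rewrite -(cintD (ccontD (ccontD c1 (ccontN c2)) c3') (ccontN c4')).
by apply: eq_cint => s _; rewrite /side_sum !mul1r.
Qed.

(** Affine functions cancel pointwise in [side_sum], since opposite sides are run through
in opposite directions; so an affine function may be subtracted before estimating. *)
Lemma contour_bound a b z0 M : 0 <= d ->
  (forall z, edge p d z -> rnorm (F z - (a + b * (z - z0))) <= M) ->
  rnorm (contour F p d) <= 2 * (M *+ 4 * d).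
Proof.
move=> d0 FM; apply: rnorm_cint_le => //; first exact: ccont_side_sum.
move=> s sd; have [h1 h2 h3 h4] := edgeP p sd.
pose G z := F z - (a + b * (z - z0)).
have -> : side_sum F p d s = G (p + s%:C) - G (p + 'i * d%:C + s%:C) + 'i * G (p + d%:C + 'i * s%:C) - 'i * G (p + 'i * s%:C).
  by rewrite /side_sum /G; ring.
have -> : M *+ 4 = M + M + M + M by rewrite -mulr_natl; ring.
do 3! (apply: le_trans (rnormD _ _) _; apply: lerD;
  last by rewrite ?rnormN ?rnormM ?rnormi ?mul1r; exact: FM).
exact: FM.
Qed.
End edges.

Lemma segment_split F p e d : 0 <= d ->
  (forall s, 0 <= s <= d + d -> {for p + e * s%:C, continuous F}) ->
  segment_integral F p e (d + d) = segment_integral F p e d + segment_integral F (p + e * d%:C) e d.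
Proof.
move=> d0 Fc; rewrite /segment_integral cint_split//; last exact: ccont_line.
by congr (_ + _); apply: eq_cint => s _; rewrite rmorphD/= mulrDr addrA.
Qed.

(** The sides interior to a square cancel in the sum over its quarters. *)
Lemma four_squares (K : comNzRingType) (S T : K -> K) (p u v i : K) :
  S p + S (p + u) - (S (p + v + v) + S (p + v + v + u)) + i * (T (p + u + u) + T (p + u + u + v))
    - i * (T p + T (p + v)) =
  (S p - S (p + v) + i * T (p + u) - i * T p) +
  (S (p + u) - S (p + u + v) + i * T (p + u + u) - i * T (p + u)) +
  (S (p + v) - S (p + v + v) + i * T (p + v + u) - i * T (p + v)) +
  (S (p + u + v) - S (p + u + v + v) + i * T (p + u + v + u) - i * T (p + u + v)).
Proof.
have -> : p + v + v + u = p + u + v + v by ring.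
have -> : p + u + u + v = p + u + v + u by ring.
have -> : p + v + u = p + u + v by ring.
ring.
Qed.

Lemma contour_subdiv F p d : 0 <= d -> cont_on (square p (d + d)) F ->
  contour F p (d + d) = contour F p d + contour F (p + d%:C) d + contour F (p + 'i * d%:C) d
     + contour F (p + d%:C + 'i * d%:C) d.
Proof.
move=> d0 Fc.
have sub (x y : R) : 0 <= x <= d -> 0 <= y <= d -> cont_on (square (p + x%:C + 'i * y%:C) d) F.
  move=> /andP[? ?] /andP[? ?] z [/andP[+ +] /andP[+ +]]; case: p Fc => a b Fc.
  rewrite /= ?mul0r ?mul1r ?oppr0 ?addr0 ?add0r => *; apply: Fc; split; apply/andP; split => /=; lra.
have sube (x y : R) : 0 <= x <= d -> 0 <= y <= d -> cont_on (edge (p + x%:C + 'i * y%:C) d) F.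
  by move=> xd yd z /edge_square; exact: sub.
have d01 : 0 <= d <= d by rewrite d0/=.
have d00 : 0 <= (0 : R) <= d by rewrite lexx.
have e0 : cont_on (edge p (d + d)) F by move=> z /edge_square; exact: Fc.
have e00 : cont_on (edge p d) F by have := sube _ _ d00 d00; rewrite mulr0 !addr0.
have e10 : cont_on (edge (p + d%:C) d) F by have := sube _ _ d01 d00; rewrite mulr0 addr0.
have e01 : cont_on (edge (p + 'i * d%:C) d) F by have := sube _ _ d00 d01; rewrite addr0.
have e11 : cont_on (edge (p + d%:C + 'i * d%:C) d) F := sube _ _ d01 d01.
have sc s : 0 <= s <= d + d -> [/\ {for p + s%:C, continuous F},
   {for p + 'i * (d + d)%:C + s%:C, continuous F}, {for p + (d + d)%:C + 'i * s%:C, continuous F}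
   & {for p + 'i * s%:C, continuous F}].
  by move=> sd; have [h1 h2 h3 h4] := square_edges p sd; split; apply: Fc.
have E1 : segment_integral F p 1 (d + d) = segment_integral F p 1 d + segment_integral F (p + d%:C) 1 d.
  rewrite (segment_split d0); first by rewrite mul1r.
  by move=> s /sc[h _ _ _]; rewrite mul1r; exact: h.
have E2 : segment_integral F (p + 'i * (d + d)%:C) 1 (d + d) =
    segment_integral F (p + 'i * d%:C + 'i * d%:C) 1 d + segment_integral F (p + 'i * d%:C + 'i * d%:C + d%:C) 1 d.
  rewrite (segment_split d0); last by move=> s /sc[_ h _ _]; rewrite mul1r; exact: h.
  by rewrite rmorphD/= mulrDr mul1r addrA.
have E3 : segment_integral F (p + (d + d)%:C) 'i (d + d) =
    segment_integral F (p + d%:C + d%:C) 'i d + segment_integral F (p + d%:C + d%:C + 'i * d%:C) 'i d.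
  rewrite (segment_split d0); last by move=> s /sc[_ _ h _]; exact: h.
  by rewrite rmorphD/= addrA.
have E4 : segment_integral F p 'i (d + d) = segment_integral F p 'i d + segment_integral F (p + 'i * d%:C) 'i d.
  by rewrite (segment_split d0)// => s /sc[_ _ _ h]; exact: h.
apply: (etrans (contour_segments e0)); rewrite E1 E2 E3 E4.
apply: (etrans (@four_squares C (fun z => segment_integral F z 1 d) (fun z => segment_integral F z 'i d) p d%:C ('i * d%:C) 'i)).
apply/esym; congr (_ + _ + _ + _); [exact: (contour_segments e00)|exact: (contour_segments e10)|exact: (contour_segments e01)|exact: (contour_segments e11)].
Qed.
End contours.

Section goursat_theorem.
Variable R : realType.
Local Notation C := R[i].

Lemma eq_contour (F G : C -> C) p d : (forall z, edge p d z -> F z = G z) -> contour F p d = contour G p d.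
Proof.
by move=> FG; apply: eq_cint => s sd; have [h1 h2 h3 h4] := edgeP p sd; rewrite /side_sum !FG.
Qed.

Lemma contourD (F G : C -> C) p d : cont_on (edge p d) F -> cont_on (edge p d) G ->
  contour (fun z => F z + G z) p d = contour F p d + contour G p d.
Proof.
move=> Fc Gc; rewrite /contour -cintD; try exact: ccont_side_sum.
by apply: eq_cint => s _; rewrite /side_sum; ring.
Qed.

Lemma contourZ a (F : C -> C) p d : cont_on (edge p d) F ->
  contour (fun z => a * F z) p d = a * contour F p d.
Proof.
move=> Fc; rewrite /contour -cintZ; last exact: ccont_side_sum.
by apply: eq_cint => s _; rewrite /side_sum; ring.
Qed.

(** The sign of x times the square root of |x|: one of the two square roots vanishes. *)
Definition signed_sqrt (x : R) : R := Num.sqrt x - Num.sqrt (- x).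

Lemma signed_sqrt_le x y : x <= y -> signed_sqrt x <= signed_sqrt y.
Proof. by move=> xy; rewrite /signed_sqrt lerB// ler_wsqrtr// lerN2. Qed.

(** Across 0 the increment of the signed square root over a length d is at least
the square root of d. *)
Lemma signed_sqrt_jump x d : x <= 0 <= x + d -> Num.sqrt d <= signed_sqrt (x + d) - signed_sqrt x.
Proof.
move=> /andP[x0 xd].
have -> : signed_sqrt (x + d) = Num.sqrt (x + d).
  by rewrite /signed_sqrt [X in _ - X]ler0_sqrtr ?subr0// oppr_le0.
have -> : signed_sqrt x = - Num.sqrt (- x) by rewrite /signed_sqrt ler0_sqrtr// sub0r.
have a0 : 0 <= - x by rewrite oppr_ge0.
rewrite opprK -[leRHS]ger0_norm ?addr_ge0 ?sqrtr_ge0// -sqrtr_sqr ler_wsqrtr//.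
rewrite sqrrD !sqr_sqrtr//.
have : 0 <= Num.sqrt (x + d) * Num.sqrt (- x) by rewrite mulr_ge0 ?sqrtr_ge0.
lra.
Qed.

Lemma square_diam (p : C) (d : R) (z w : C) : square p d z -> square p d w -> rnorm (w - z) <= 2 * d.
Proof.
move=> [/andP[? ?] /andP[? ?]] [/andP[? ?] /andP[? ?]].
apply: le_trans (rnorm_le_ReIm _) _; rewrite !raddfB/= mulr2n mulrDl mul1r.
by apply: lerD; rewrite ler_norml; apply/andP; split; lra.
Qed.

(** An exceptional point x0 where F is merely continuous is allowed, because the proof of
Cauchy's formula applies the theorem to a difference quotient.  By [square_ind] it suffices
to bound the contour integral over small squares by e W, for an additive function W of
squares.  Away from x0 the area is such a function.  Around x0 only the bound e d by the
side length d is available, and W must be at least d there: this is achieved by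
the product of the increments of the signed square root in the two coordinates. *)
Lemma goursat (F : C -> C) p0 d0 x0 : 0 < d0 -> cont_on (square p0 d0) F ->
  (forall z, square p0 d0 z -> z != x0 -> differentiable F z) -> contour F p0 d0 = 0.
Proof.
move=> d00 Fc Fd.
(* The additive weight that dominates d on the squares containing x0. *)
pose rho (p : C) (d : R) :=
  (signed_sqrt (complex.Re p - complex.Re x0 + d) - signed_sqrt (complex.Re p - complex.Re x0)) *
  (signed_sqrt (complex.Im p - complex.Im x0 + d) - signed_sqrt (complex.Im p - complex.Im x0)).
have rho_ge0 p d : 0 <= d -> 0 <= rho p d.
  by move=> dge0; rewrite mulr_ge0// subr_ge0 signed_sqrt_le// lerDl.
have rhoD p d : rho p (d + d) = rho p d + rho (p + d%:C) d + rho (p + 'i * d%:C) d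
    + rho (p + d%:C + 'i * d%:C) d.
  rewrite /rho; case: p => a b /=; rewrite !mul0r !mul1r ?oppr0 ?subr0 ?addr0 ?add0r.
  rewrite ![_ + d - _]addrAC -![_ + d + d]addrA; ring.
pose W p d := d ^+ 2 + rho p d.
suff main e : 0 < e -> rnorm (contour F p0 d0) <= e * W p0 d0.
  apply/eqP; rewrite -rnorm_eq0; apply/eqP/le_anti; rewrite rnorm_ge0 andbT.
  have W0 : 0 < W p0 d0 by rewrite ltr_pwDl ?rho_ge0 ?exprn_gt0// ltW.
  apply/ler_addgt0Pr => e e0; rewrite add0r.
  by apply: le_trans (main (e / W p0 d0) (divr_gt0 e0 W0)) _; rewrite divfK// lt0r_neq0.
move=> e0; apply: (@square_ind R (fun p d => rnorm (contour F p d) <= e * W p d)) => //; last first.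
  move=> p d d1 sub h1 h2 h3 h4; rewrite (contour_subdiv (ltW d1)); last by move=> z /sub; exact: Fc.
  have -> : e * W p (d + d) = e * W p d + e * W (p + d%:C) d + e * W (p + 'i * d%:C) d
     + e * W (p + d%:C + 'i * d%:C) d by rewrite /W rhoD; ring.
  do 3! (apply: le_trans (rnormD _ _) _; apply: lerD; last by assumption); exact: h1.
move=> z zS; have [zx|zx] := eqVneq z x0.
  have e8 : 0 < e / 8 by rewrite divr_gt0.
  have /(Fc _ zS)/nbhs_rnorm[r r0 rP] : nbhs (F z) [set w | rnorm (w - F z) < e / 8].
    by apply/nbhs_rnorm; exists (e / 8).
  exists (r / 2); rewrite ?divr_gt0// => p d /andP[d1 dr] sub zp.
  have Fce : cont_on (edge p d) F by move=> w /edge_square/sub; exact: Fc.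
  apply: (@le_trans _ _ (2 * ((e / 8) *+ 4 * d))).
    apply: (@contour_bound R F p d Fce (F z) 0 0) (ltW d1) _ => w /edge_square wS.
    rewrite mul0r addr0 ltW//; apply: rP.
    by apply: le_lt_trans (square_diam zp wS) _; lra.
  have -> : 2 * ((e / 8) *+ 4 * d) = e * d by rewrite -mulr_natl; field.
  rewrite ler_pM2l// /W; suff: d <= rho p d by have := sqr_ge0 d; lra.
  rewrite -[leLHS](sqr_sqrtr (ltW d1)) expr2 /rho -zx.
  by move: zp => [? ?]; apply: ler_pM; rewrite ?sqrtr_ge0//; apply: signed_sqrt_jump; lra.
have /differentiable_rnormP[a aP] := Fd _ zS zx.
have e16 : 0 < e / 16 by rewrite divr_gt0.
have [r r0 rP] := aP _ e16.
exists (r / 2); rewrite ?divr_gt0// => p d /andP[d1 dr] sub zp.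
have Fce : cont_on (edge p d) F by move=> w /edge_square/sub; exact: Fc.
apply: (@le_trans _ _ (2 * ((e / 16 * (2 * d)) *+ 4 * d))).
  apply: (@contour_bound R F p d Fce (F z) a z) (ltW d1) _ => w /edge_square wS.
  have wz := square_diam zp wS.
  have := rP (w - z); rewrite [z + _]addrC subrK opprD addrA => /(_ _) h.
  rewrite [a * _]mulrC; apply: le_trans (h _) _; first lra.
  by rewrite ler_wpM2l// ltW.
rewrite (_ : 2 * _ = e * d ^+ 2); last by rewrite -mulr_natl; field.
by rewrite ler_pM2l// /W lerDl rho_ge0// ltW.
Qed.
End goursat_theorem.

(** * The Cauchy integral over a square *)

Section cauchy_theorem.
Variable R : realType.
Local Notation C := R[i].

Lemma near_differentiable (V : normedModType C) (f g : C -> V) z (e : R) : 0 < e ->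
  (forall w, rnorm (w - z) < e -> f w = g w) -> differentiable f z -> differentiable g z.
Proof.
move=> e0 fg /differentiable_rnormP[a aP]; apply/differentiable_rnormP; exists a => r r0.
have [d d0 dP] := aP r r0; exists (Num.min d e); first by rewrite lt_min d0 e0.
move=> h; rewrite lt_min => /andP[hd he].
rewrite -!fg ?subrr ?rnorm0//; first exact: dP.
by rewrite addrC addKr.
Qed.

Lemma differentiable_div (V : normedModType C) (f g : V -> C) z :
  differentiable f z -> differentiable g z -> g z != 0 ->
  differentiable (fun w => f w / g w) z.
Proof. by move=> df dg gz; apply: differentiableM => //; exact: differentiableV. Qed.

Lemma differentiable_subr (w z : C) : differentiable (fun z : C => z - w) z.
Proof. by apply: differentiableB; [exact: ex_diff|exact: differentiable_cst]. Qed.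

Lemma cont_div (f g : C -> C) z : {for z, continuous f} -> {for z, continuous g} ->
  g z != 0 -> {for z, continuous (fun w => f w / g w)}.
Proof. by move=> fc gc gz; apply: (@continuousM C _ f); [exact: fc|exact: (@continuousV C _ g)]. Qed.

(** This is 2 pi i when x0 is inside the square. *)
Definition kernel_contour (p : C) (d : R) (x0 : C) := contour (fun z => 1 / (z - x0)) p d.

(** Goursat's theorem for the difference quotient of F at x0, extended by the derivative. *)
Lemma cauchy_square (F : C -> C) p d x0 : 0 < d ->
  (forall z, square p d z -> differentiable F z) -> square p d x0 -> ~ edge p d x0 ->
  contour (fun z => F z / (z - x0)) p d = F x0 * kernel_contour p d x0.
Proof.
move=> d0 Fd x0S x0E.
have Fc z : square p d z -> {for z, continuous F}.
  by move=> zS; apply: differentiable_continuous; exact: Fd.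
have /differentiable_rnormP[a aP] := Fd _ x0S.
(* Continuous at x0, differentiable elsewhere. *)
pose G z := if z == x0 then a else (F z - F x0) / (z - x0).
have Gd z : square p d z -> z != x0 -> differentiable G z.
  move=> zS zx.
  have zx0 : 0 < rnorm (z - x0) by rewrite lt_def rnorm_ge0 rnorm_eq0 subr_eq0 zx.
  apply: (near_differentiable (f := fun z => (F z - F x0) / (z - x0)) zx0).
    move=> w wz; rewrite /G; case: eqVneq => // wx; move: wz; rewrite wx -opprB rnormN.
    by rewrite ltxx.
  apply: differentiable_div; last by rewrite subr_eq0.
    by apply: differentiableB; [exact: Fd|exact: differentiable_cst].
  exact: differentiable_subr.
have G0 : contour G p d = 0.
  apply: (goursat d0 _ Gd) => z zS; have [->|zx] := eqVneq z x0; last first.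
    by apply: differentiable_continuous; exact: Gd.
  move=> A /nbhs_rnorm[e e0 eA]; apply/nbhs_rnorm.
  have e20 : 0 < e / 2 by rewrite divr_gt0.
  have [r r0 rP] := aP _ e20; exists r => // w wr; apply: eA.
  rewrite /G eqxx; case: eqVneq => [_|wx]; first by rewrite subrr rnorm0.
  have n0 : 0 < rnorm (w - x0) by rewrite lt_def rnorm_ge0 rnorm_eq0 subr_eq0 wx.
  have wx0 : w - x0 != 0 by rewrite subr_eq0.
  rewrite -(ltr_pM2r n0) -rnormM mulrBl divfK//.
  have := rP _ wr; rewrite [x0 + _]addrC subrK [_ *: a]mulrC => /le_lt_trans; apply.
  by rewrite ltr_pM2r// ltr_pdivrMr// ltr_pMr// ltr1n.
have eE z : edge p d z -> z - x0 != 0.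
  by move=> zE; rewrite subr_eq0; apply: contra_notN x0E => /eqP <-.
have c0 z : {for z, continuous (fun z : C => z - x0)}.
  by apply: differentiable_continuous; exact: differentiable_subr.
have c1 : cont_on (edge p d) (fun z => F z / (z - x0)).
  move=> z zE; apply: cont_div; [apply: Fc; exact: edge_square|exact: c0|exact: eE].
have c2 : cont_on (edge p d) (fun z => 1 / (z - x0)).
  move=> z zE; apply: cont_div; [exact: cst_continuous|exact: c0|exact: eE].
have c3 : cont_on (edge p d) (fun z => - F x0 * (1 / (z - x0))).
  move=> z zE; apply: (@continuousM C); first exact: cst_continuous.
  exact: c2.
apply/eqP; rewrite -subr_eq0; apply/eqP; rewrite -{}G0 -mulNr /kernel_contour -(contourZ _ c2) -(contourD c1 c3).
apply: eq_contour => z zE; rewrite /G ifF; last first.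
  by apply/eqP => zx; apply: x0E; rewrite -zx.
by rewrite mul1r mulNr -mulrBl.
Qed.
End cauchy_theorem.

Section cauchy_integrals.
Variable R : realType.
Local Notation C := R[i].

(** The lower left corner of the square centred at 0 of side 2 r. *)
Definition corner (r : R) : C := (- r) +i* (- r).

Lemma square_sub_disc r z : square (corner r) (r + r) z -> rnorm z <= 2 * r.
Proof.
move=> [/andP[/= ? ?] /andP[/= ? ?]]; apply: le_trans (rnorm_le_ReIm _) _.
rewrite mulr2n mulrDl mul1r; apply: lerD; rewrite ler_norml; apply/andP; split; lra.
Qed.

Lemma edge_corner r z : 0 < r -> edge (corner r) (r + r) z -> r <= rnorm z.
Proof.
move=> r0 [s sd zs].
have [zr|zr] : r <= `|complex.Re z| \/ r <= `|complex.Im z|.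
  case: zs => -> /=; rewrite !(mul0r, mul1r, mulr0, subr0, addr0, add0r);
    [right|right|left|left]; rewrite ler_normr; apply/orP; first [right; lra|left; lra].
  by apply: le_trans zr (normr_Re _).
by apply: le_trans zr (normr_Im _).
Qed.

Lemma disc_sub_square r z : rnorm z <= r -> square (corner r) (r + r) z.
Proof.
move=> zr; have := le_trans (normr_Re z) zr; have := le_trans (normr_Im z) zr.
by rewrite !ler_norml => /andP[? ?] /andP[? ?]; split; apply/andP; split => /=; lra.
Qed.

Lemma edge_far r z w : 0 < r -> rnorm w <= r / 2 -> edge (corner r) (r + r) z -> r / 2 <= rnorm (z - w).
Proof.
move=> r0 wr /(edge_corner r0) zr; have := rnormD (z - w) w; rewrite subrK; lra.
Qed.

Definition cauchy_integral (F : C -> C) (r : R) (w : C) := contour (fun z => F z / (z - w)) (corner r) (r + r).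

Section cauchy_integral.
Variables (F : C -> C) (r M : R).
Hypotheses (r0 : 0 < r) (Fc : cont_on (edge (corner r) (r + r)) F).
Hypothesis FM : forall z, edge (corner r) (r + r) z -> rnorm (F z) <= M.

Let far w z : rnorm w <= r / 2 -> edge (corner r) (r + r) z -> z - w != 0.
Proof.
move=> wr /(edge_far r0 wr) h; rewrite -rnorm_eq0 gt_eqF//; apply: lt_le_trans h; exact: divr_gt0.
Qed.

Let kc w : rnorm w <= r / 2 -> cont_on (edge (corner r) (r + r)) (fun z => F z / (z - w)).
Proof.
move=> wr z zE; apply: cont_div; [exact: Fc| |exact: far].
by apply: differentiable_continuous; exact: differentiable_subr.
Qed.

Let rr : 0 <= r + r. Proof. have := r0; lra. Qed.

Lemma contour_edge_bound (G : C -> C) N : cont_on (edge (corner r) (r + r)) G ->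
  (forall z, edge (corner r) (r + r) z -> rnorm (G z) <= N) ->
  rnorm (contour G (corner r) (r + r)) <= 16 * N * r.
Proof.
move=> Gc GN; have := @contour_bound R G (corner r) (r + r) Gc 0 0 0 N rr.
have -> : 2 * (N *+ 4 * (r + r)) = 16 * N * r by rewrite -mulr_natl; ring.
by apply => z zE; rewrite mul0r addr0 subr0; exact: GN.
Qed.

(** The difference of the two kernels is w / ((z - w) z), and |z| >= r, |z - w| >= r / 2
on the edges. *)
Lemma cauchy_integral_lip w : rnorm w <= r / 2 -> rnorm (cauchy_integral F r w - cauchy_integral F r 0) <= 32 * M / r * rnorm w.
Proof.
have r0' := r0.
move=> wr; have w0 : rnorm (0 : C) <= r / 2 by rewrite rnorm0; lra.
have c1 := kc wr; have c2 := kc w0.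
have c3 : cont_on (edge (corner r) (r + r)) (fun z => -1 * (F z / (z - 0))).
  by move=> z zE; apply: (@continuousM C); [exact: cst_continuous|exact: c2].
have -> : cauchy_integral F r w - cauchy_integral F r 0 = contour (fun z => F z / (z - w) + -1 * (F z / (z - 0))) (corner r) (r + r).
  by rewrite (contourD c1 c3) (contourZ _ c2) mulN1r.
have -> : 32 * M / r * rnorm w = 16 * (2 * M / r ^+ 2 * rnorm w) * r by field; rewrite gt_eqF.
apply: contour_edge_bound => z zE; first by apply: continuousD; [exact: c1|exact: c3].
have z1 := far wr zE; have z2 := far w0 zE; rewrite subr0 in z2.
have -> : F z / (z - w) + -1 * (F z / (z - 0)) = F z * w / ((z - w) * z).
  by rewrite subr0; field; rewrite z1 z2.
have n1 := edge_far r0 wr zE; have n2 := edge_corner r0 zE.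
have -> : rnorm (F z * w / ((z - w) * z)) = rnorm (F z) * rnorm w / (rnorm (z - w) * rnorm z).
  have d0 : 0 < rnorm (z - w) * rnorm z by rewrite mulr_gt0//; lra.
  apply: (mulIf (lt0r_neq0 d0)); rewrite divfK ?gt_eqF// -!rnormM divfK//.
  by rewrite mulf_neq0.
have d0 : 0 < rnorm (z - w) * rnorm z by rewrite mulr_gt0//; lra.
rewrite ler_pdivrMr//.
have -> : 2 * M / r ^+ 2 * rnorm w * (rnorm (z - w) * rnorm z) =
    M * rnorm w * ((rnorm (z - w) / (r / 2)) * (rnorm z / r)).
  by field; rewrite gt_eqF.
have M0 : 0 <= M := le_trans (rnorm_ge0 _) (FM zE).
apply: (@le_trans _ _ (M * rnorm w)); first by rewrite ler_wpM2r ?rnorm_ge0// FM.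
rewrite ler_peMr ?mulr_ge0 ?rnorm_ge0// -[1]mulr1 ler_pM// ler_pdivlMr ?mul1r//; lra.
Qed.

Lemma cauchy_integral_bound w : rnorm w <= r / 2 -> rnorm (cauchy_integral F r w) <= 32 * M.
Proof.
have r0' := r0.
move=> wr; have -> : 32 * M = 16 * (2 * M / r) * r by field; rewrite gt_eqF.
apply: contour_edge_bound => z zE; first exact: kc.
have z1 := far wr zE; have n1 := edge_far r0 wr zE.
have d0 : 0 < rnorm (z - w) by lra.
have -> : rnorm (F z / (z - w)) = rnorm (F z) / rnorm (z - w).
  by apply: (mulIf (lt0r_neq0 d0)); rewrite divfK ?gt_eqF// -!rnormM divfK.
rewrite ler_pdivrMr//.
have -> : 2 * M / r * rnorm (z - w) = M * (rnorm (z - w) / (r / 2)).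
  by field; rewrite gt_eqF.
have M0 : 0 <= M := le_trans (rnorm_ge0 _) (FM zE).
apply: le_trans (FM zE) _; rewrite ler_peMr// ler_pdivlMr ?mul1r//; lra.
Qed.

(** The derivative is the contour integral of F(z) / z^2; the remainder
of the kernel is w^2 / ((z - w) z^2). *)
Lemma cauchy_integral_differentiable : differentiable (cauchy_integral F r) 0.
Proof.
have r0' := r0.
have w0 : rnorm (0 : C) <= r / 2 by rewrite rnorm0; lra.
have c2 := kc w0.
have c4 : cont_on (edge (corner r) (r + r)) (fun z => F z / (z - 0) / (z - 0)).
  move=> z zE; apply: cont_div; [exact: c2| |exact: far].
  by apply: differentiable_continuous; exact: differentiable_subr.
apply/differentiable_rnormP; exists (contour (fun z => F z / (z - 0) / (z - 0)) (corner r) (r + r)) => e e0.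
pose K := 32 * `|M| / r ^+ 2 + 1.
have K0 : 0 < K.
  rewrite /K; apply: ltr_wpDl => //; apply: divr_ge0; [exact: mulr_ge0|exact: exprn_even_ge0].
exists (Num.min (r / 2) (e / K)); first by rewrite lt_min; apply/andP; split; exact: divr_gt0.
move=> w; rewrite lt_min => /andP[/ltW wr we]; rewrite add0r.
have c1 := kc wr.
have c3 : cont_on (edge (corner r) (r + r)) (fun z => -1 * (F z / (z - 0))).
  by move=> z zE; apply: (@continuousM C); [exact: cst_continuous|exact: c2].
have c5 : cont_on (edge (corner r) (r + r)) (fun z => - w * (F z / (z - 0) / (z - 0))).
  by move=> z zE; apply: (@continuousM C); [exact: cst_continuous|exact: c4].
have c6 : cont_on (edge (corner r) (r + r)) (fun z => F z / (z - w) + -1 * (F z / (z - 0))).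
  by move=> z zE; apply: continuousD; [exact: c1|exact: c3].
set S := (X in rnorm X); have -> : S = contour (fun z => F z / (z - w) + -1 * (F z / (z - 0)) + - w * (F z / (z - 0) / (z - 0))) (corner r) (r + r).
  by rewrite (contourD c6 c5) (contourD c1 c3) (contourZ _ c2) (contourZ _ c4) mulN1r mulNr.
apply: (@le_trans _ _ (16 * (2 * M / r ^+ 3 * rnorm w ^+ 2) * r)); last first.
  have -> : 16 * (2 * M / r ^+ 3 * rnorm w ^+ 2) * r = (32 * M / r ^+ 2) * rnorm w * rnorm w.
    by field; rewrite gt_eqF.
  rewrite ler_wpM2r ?rnorm_ge0//; move: we; rewrite ltr_pdivlMr// => /ltW; apply: le_trans.
  rewrite mulrC ler_wpM2l ?rnorm_ge0//.
  apply: (@le_trans _ _ (32 * `|M| / r ^+ 2)); last by rewrite lerDl.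
  by rewrite ler_wpM2r ?invr_ge0 ?sqr_ge0// ler_wpM2l// ler_norm.
apply: contour_edge_bound => z zE; first by apply: continuousD; [exact: c6|exact: c5].
have z1 := far wr zE; have z2 := far w0 zE; rewrite subr0 in z2.
have -> : F z / (z - w) + -1 * (F z / (z - 0)) + - w * (F z / (z - 0) / (z - 0)) =
   F z * w ^+ 2 / ((z - w) * z ^+ 2).
  by rewrite subr0; field; rewrite z1 z2.
have n1 := edge_far r0 wr zE; have n2 := edge_corner r0 zE.
have d0 : 0 < rnorm (z - w) * rnorm z ^+ 2 by rewrite mulr_gt0 ?exprn_gt0//; lra.
have -> : rnorm (F z * w ^+ 2 / ((z - w) * z ^+ 2)) = rnorm (F z) * rnorm w ^+ 2 / (rnorm (z - w) * rnorm z ^+ 2).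
  apply: (mulIf (lt0r_neq0 d0)); rewrite divfK ?gt_eqF// !expr2 -!rnormM divfK//.
  by rewrite !mulf_neq0.
rewrite ler_pdivrMr//.
have -> : 2 * M / r ^+ 3 * rnorm w ^+ 2 * (rnorm (z - w) * rnorm z ^+ 2) =
    M * rnorm w ^+ 2 * ((rnorm (z - w) / (r / 2)) * (rnorm z / r) ^+ 2).
  by field; rewrite gt_eqF.
have M0 : 0 <= M := le_trans (rnorm_ge0 _) (FM zE).
apply: (@le_trans _ _ (M * rnorm w ^+ 2)); first by rewrite ler_wpM2r ?exprn_ge0 ?rnorm_ge0// FM.
rewrite ler_peMr ?mulr_ge0 ?exprn_ge0 ?rnorm_ge0// -[1]mulr1 ler_pM//.
  by rewrite ler_pdivlMr ?mul1r//; lra.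
by rewrite exprn_ege1// ler_pdivlMr ?mul1r.
Qed.
End cauchy_integral.
End cauchy_integrals.

(** * Schwarz and Borel-Caratheodory estimates *)

Section disc_estimates.
Variable R : realType.
Local Notation C := R[i].
Local Notation leb := (@lebesgue_measure R).

Lemma cauchy_formula (F : C -> C) r w : 0 < r -> (forall z, rnorm z <= 2 * r -> differentiable F z) ->
  rnorm w <= r / 2 -> cauchy_integral F r w = F w * cauchy_integral (fun=> 1) r w.
Proof.
move=> r0 Fd wr; apply: cauchy_square; first by rewrite addr_gt0.
- by move=> z /square_sub_disc; exact: Fd.
- by apply: disc_sub_square; apply: le_trans wr _; rewrite ler_pdivrMr// ler_pMr// ler1n.
- move=> /(edge_far r0 wr); rewrite subrr rnorm0 leNgt => /negP; apply; exact: divr_gt0.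
Qed.

(** The exact value is 2 pi i.  The imaginary part of the integrand is at least 2 / r
on an interval of length 2 r. *)
Lemma cauchy_integral1_ge4 (r : R) : 0 < r -> 4 <= rnorm (cauchy_integral (fun=> 1) r 0).
Proof.
move=> r0.
have c1 : cont_on (edge (corner r) (r + r)) (fun z : C => 1 / (z - 0)).
  move=> z /(edge_corner r0) zr; apply: cont_div; first exact: cst_continuous.
    by apply: differentiable_continuous; exact: differentiable_subr.
  by rewrite subr0 -rnorm_eq0 gt_eqF//; exact: lt_le_trans r0 zr.
apply: le_trans (normr_Im _); apply: le_trans (ler_norm _); rewrite /cauchy_integral /contour /cint /=.
have mI : measurable (`[0, r + r]%classic : set (measurableTypeR R)) by exact: measurable_itv.
have -> : 4 = \int[leb]_(s in `[0, r + r]) (2 / r).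
  rewrite Rintegral_cst//= lebesgue_measure_itv/= lte_fin addr_gt0// -EFinB subr0/=.
  by field; rewrite gt_eqF.
apply: le_Rintegral => //.
- by apply: (@rcont_integrable R (r + r) (fun=> 2 / r)) => s _; exact: cst_continuous.
- exact: (rcont_integrable (ccont_Im (ccont_side_sum c1))).
move=> s /=; rewrite in_itv/= => /andP[s0 s2].
rewrite /side_sum /corner /= !(mul0r, mul1r, mulr0, subr0, addr0, add0r, oppr0, sub0r, opprK).
pose q := (s - r) ^+ 2 + r ^+ 2.
have q0 : 0 < q by rewrite ltr_wpDl ?exprn_gt0 ?sqr_ge0.
have -> : (- r + s) ^+ 2 + (- r) ^+ 2 = q by rewrite /q; ring.
have -> : (- r + s) ^+ 2 + (- r + (r + r)) ^+ 2 = q by rewrite /q; ring.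
have -> : (- r + (r + r)) ^+ 2 + (- r + s) ^+ 2 = q by rewrite /q; ring.
have -> : (- r) ^+ 2 + (- r + s) ^+ 2 = q by rewrite /q; ring.
have : 2 / r <= 4 * (r / q).
  rewrite ler_pdivrMr// mulrAC mulrA; rewrite ler_pdivlMr//.
  have : (s - r) ^+ 2 <= r ^+ 2 by rewrite -subr_ge0 subr_sqr mulr_ge0//; lra.
  rewrite /q; lra.
move=> /le_trans; apply; lra.
Qed.

(** A Schwarz lemma with unspecified constants: G(w) times the integral of the kernel is a
Cauchy integral, which is Lipschitz at 0. *)
Lemma schwarz_lip : exists c d : R, [/\ 0 < c, 0 < d &
  forall G : C -> C, (forall z, rnorm z < 1 -> differentiable G z) ->
    (forall z, rnorm z < 1 -> rnorm (G z) <= 1) -> G 0 = 0 ->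
    forall w, rnorm w <= d -> rnorm (G w) <= c * rnorm w].
Proof.
pose r : R := 4^-1; have r0 : 0 < r by rewrite invr_gt0.
pose K := 32 * 1 / r; have K0 : 0 < K by rewrite !divr_gt0// mulr_gt0.
pose d := Num.min (r / 2) K^-1.
have d0 : 0 < d by rewrite lt_min divr_gt0//= invr_gt0.
exists K, d; split=> // G Gd G1 G0 w wd.
have wr : rnorm w <= r / 2 by apply: le_trans wd _; rewrite ge_min lexx.
have wK : K * rnorm w <= 1.
  by rewrite -ler_pdivlMl// mulr1; apply: le_trans wd _; rewrite ge_min lexx orbT.
have r2 (z : C) : rnorm z <= 2 * r -> rnorm z < 1.
  by move=> /le_lt_trans; apply; rewrite /r; lra.
have e2 z : edge (corner r) (r + r) z -> rnorm z < 1.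
  by move=> /edge_square/square_sub_disc; exact: r2.
have Gc : cont_on (edge (corner r) (r + r)) G.
  by move=> z /e2 zE; apply: differentiable_continuous; exact: Gd.
have h0 : rnorm (0 : C) <= r / 2 by rewrite rnorm0 divr_ge0// ltW.
have := cauchy_integral_lip r0 Gc (fun z zE => G1 z (e2 z zE)) wr.
have c1 : cont_on (edge (corner r) (r + r)) (fun=> 1 : C) by move=> z _; exact: cst_continuous.
have M1 (z : C) : edge (corner r) (r + r) z -> rnorm (1 : C) <= 1.
  by rewrite (rnorm_real 1) normr1.
have oneK := cauchy_integral_lip r0 c1 M1 wr.
rewrite (cauchy_formula r0 _ wr); last by move=> z /r2; exact: Gd.
rewrite (cauchy_formula r0 _ h0); last by move=> z /r2; exact: Gd.
rewrite G0 mul0r subr0 rnormM -/K => h.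
have k2 : 1 <= rnorm (cauchy_integral (fun=> 1) r w).
  have A := cauchy_integral1_ge4 r0.
  have := rnormD (cauchy_integral (fun=> 1) r 0 - cauchy_integral (fun=> 1) r w) (cauchy_integral (fun=> 1) r w).
  rewrite subrK -opprB rnormN => B; move: A B oneK; rewrite -/K; lra.
by apply: le_trans h; rewrite ler_peMr ?rnorm_ge0.
Qed.

(** The map F / (2 - F) sends the half-plane Re <= 1 into the unit disc and fixes 0, so
that [schwarz_lip] applies to it; the radius d is the same for all F. *)
Lemma borel_caratheodory (e : R) : 0 < e -> exists2 d : R, 0 < d &
  forall F : C -> C, (forall z, rnorm z < 1 -> differentiable F z) ->
    (forall z, rnorm z < 1 -> complex.Re (F z) <= 1) -> F 0 = 0 ->
    forall w, rnorm w <= d -> rnorm (F w) <= e.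
Proof.
move=> e0; have [c [d [c0 d0 cd]]] := schwarz_lip.
pose d' := Num.min (Num.min d 2^-1) (Num.min ((2 * c)^-1) (e / (4 * c))).
have c20 : 0 < (2 * c)^-1 by rewrite invr_gt0 mulr_gt0.
have c40 : 0 < e / (4 * c) by rewrite divr_gt0// mulr_gt0.
have d'0 : 0 < d' by rewrite !lt_min d0 c20 c40 invr_gt0 ltr0n.
exists d' => // F Fd F1 F0 w; rewrite /d' !le_min => /andP[/andP[wd w2] /andP[wc we]].
have w1 : rnorm w < 1 by apply: le_lt_trans w2 _; rewrite invf_lt1// ltr1n.
have n2 z : rnorm z < 1 -> 2 - F z != 0.
  move=> /F1; apply: contraTneq => /eqP; rewrite subr_eq0 => /eqP <-.
  by rewrite -ltNge (_ : complex.Re 2 = 2%:R :> R)// ltr1n.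
pose G z := F z / (2 - F z).
have GF z : rnorm z < 1 -> G z * (2 - F z) = F z by move=> z1; rewrite /G divfK ?n2.
have Gd z : rnorm z < 1 -> differentiable G z.
  move=> z1; apply: differentiable_div; [exact: Fd| |exact: n2].
  by apply: differentiableB; [exact: differentiable_cst|exact: Fd].
have G1 z : rnorm z < 1 -> rnorm (G z) <= 1.
  move=> z1; have p0 : 0 < rnorm (2 - F z) by rewrite lt_def rnorm_ge0 rnorm_eq0 n2.
  rewrite -(ler_pM2r p0) -rnormM GF// mul1r !rnorm_normc.
  have := F1 z z1; case: (F z) => a b /= a1; rewrite ler_wsqrtr//; lra.
have G0 : G 0 = 0 by rewrite /G F0 mul0r.
have Gw := cd G Gd G1 G0 w wd.
have Gh : rnorm (G w) <= 2^-1.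
  apply: le_trans Gw _; move: wc; rewrite -(ler_pM2l c0) => /le_trans; apply.
  by rewrite invfM mulrCA mulfV ?gt_eqF// mulr1.
have : rnorm (F w) <= 2^-1 * rnorm (F w) + 2 * rnorm (G w).
  rewrite -{1}(GF w w1) mulrBr; apply: le_trans (rnormD _ _) _; rewrite rnormN !(rnormM (G w)).
  have -> : rnorm (2 : C) = 2 by have := rnorm_real (2 : R); rewrite ger0_norm// rmorph_nat.
  rewrite addrC [2 * _]mulrC lerD2r.
  by rewrite ler_wpM2r ?rnorm_ge0.
have : c * rnorm w <= e / 4.
  by move: we; rewrite -(ler_pM2l c0) => /le_trans; apply; rewrite mulrC invfM mulrA divfK ?gt_eqF.
move: Gw; lra.
Qed.

(** The Cauchy integral of any continuous function is differentiable at 0, and the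
integral of the kernel does not vanish near 0. *)
Lemma cauchy_differentiable (F : C -> C) r d M : 0 < r -> 0 < d ->
  cont_on (edge (corner r) (r + r)) F ->
  (forall z, edge (corner r) (r + r) z -> rnorm (F z) <= M) ->
  (forall w, rnorm w < d -> cauchy_integral F r w = F w * cauchy_integral (fun=> 1) r w) -> differentiable F 0.
Proof.
move=> r0 d0 Fc FM Fw.
have c1 : cont_on (edge (corner r) (r + r)) (fun=> 1 : C) by move=> z _; exact: cst_continuous.
have M1 (z : C) : edge (corner r) (r + r) z -> rnorm (1 : C) <= 1.
  by rewrite (rnorm_real 1) normr1.
have kd := cauchy_integral_differentiable r0 c1 M1.
have k0 : cauchy_integral (fun=> 1 : C) r 0 != 0.
  by rewrite -rnorm_eq0 gt_eqF//; apply: lt_le_trans (cauchy_integral1_ge4 r0).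
have kc := differentiable_continuous kd.
have /kc/nbhs_rnorm[e e0 eP] : nbhs (cauchy_integral (fun=> 1 : C) r 0) [set w | rnorm (w - cauchy_integral (fun=> 1 : C) r 0) < 4].
  by apply/nbhs_rnorm; exists 4.
have de : 0 < Num.min d e by rewrite lt_min d0.
apply: (near_differentiable (f := fun w => cauchy_integral F r w / cauchy_integral (fun=> 1) r w) de).
  move=> w; rewrite subr0 lt_min => /andP[wd we]; rewrite Fw// mulfK//.
  have := eP w; rewrite subr0 => /(_ we) /=; apply: contraTneq => ->.
  by rewrite sub0r rnormN -leNgt cauchy_integral1_ge4.
exact: (differentiable_div (cauchy_integral_differentiable r0 Fc FM) kd k0).
Qed.
End disc_estimates.

(** * Translation invariance of Lebesgue measure on C^n *)

Section product_lebesgue.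
Local Open Scope ereal_scope.

(** Measure-preserving maps of the factors give a measure-preserving map of the
product, by integration of the measures of the sections. *)
Lemma product_measure_map d1 d2 (T1 : measurableType d1) (T2 : measurableType d2) (R : realType)
   (m1 : {sigma_finite_measure set T1 -> \bar R}) (m2 : {sigma_finite_measure set T2 -> \bar R})
   (s1 : T1 -> T1) (s2 : T2 -> T2) : measurable_fun setT s1 -> measurable_fun setT s2 ->
   (forall A, measurable A -> m1 (s1 @^-1` A) = m1 A) ->
   (forall A, measurable A -> m2 (s2 @^-1` A) = m2 A) ->
   forall A, measurable A -> (m1 \x m2) ((fun p => (s1 p.1, s2 p.2)) @^-1` A) = (m1 \x m2) A.
Proof.
move=> ms1 ms2 h1 h2 A mA.
have mx : measurable_fun setT (m2 \o xsection A) by exact: measurable_fun_xsection.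
rewrite /product_measure1.
transitivity (\int[pushforward m1 s1]_x (m2 \o xsection A) x).
  rewrite (ge0_integral_pushforward ms1)//= preimage_setT.
  apply: eq_integral => x _ /=; rewrite -[RHS]h2; last exact: measurable_xsection.
  by congr (m2 _); apply/seteqP; split => y; rewrite /xsection/=; move=> /set_mem h; apply/mem_set.
by apply: eq_measure_integral => B mB _; exact: h1.
Qed.

Section tuple.
Context d (T : measurableType d) (R : realType).
Variable mu : {sigma_finite_measure set T -> \bar R}.

(** Coordinatewise application of measure-preserving maps, by induction on the number
of coordinates. *)
Lemma tuple_measure_map n (s : 'I_n -> T -> T) :
  (forall j, measurable_fun setT (s j)) ->
  (forall j A, measurable A -> mu (s j @^-1` A) = mu A) ->
  forall A : set (n.-tuple T), measurable A ->
    tuple_measure mu n ((fun t : n.-tuple T => [tuple s j (tnth t j) | j < n]) @^-1` A) =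
    tuple_measure mu n A.
Proof.
elim: n s => [|n IH] s ms hs A mA.
  congr (tuple_measure _ _ _); apply/seteqP; split => t /=;
  by rewrite (_ : [tuple _ | _ < _] = t)//; apply: eq_from_tnth => -[].
pose s' (j : 'I_n) := s (lift ord0 j).
have ms' j : measurable_fun setT (s' j) by exact: ms.
have mS : measurable_fun setT (fun t : n.-tuple T => [tuple s' j (tnth t j) | j < n]).
  apply/measurable_fun_tnthP => j.
  rewrite (_ : _ \o _ = s' j \o (@tnth n T)^~ j); last first.
    by apply/funext => t /=; rewrite tnth_mktuple.
  by apply: measurableT_comp => //; exact: measurable_tnth.
have mA' : measurable (@cons_pair _ T n @^-1` A).
  by rewrite -[X in measurable X]setTI; exact: measurable_cons_pair.
rewrite /= /cons_measure /pushforward -[RHS](@product_measure_map _ _ _ _ _ _ _ (s ord0)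
  (fun t : n.-tuple T => [tuple s' j (tnth t j) | j < n]))//.
- congr ((_ \x _) _); apply/seteqP; split => -[x t] /=; congr (A _);
  rewrite /cons_pair; apply: eq_from_tnth => j; rewrite tnth_mktuple;
  case: (unliftP ord0 j) => [k ->|->]; by rewrite !(tnthS, tnth0) ?tnth_mktuple ?tnthS//=.
- exact: hs.
- by move=> B mB; apply: IH => // j C mC; exact: hs.
Qed.

Lemma tuple_measure_box n (B : set T) : measurable B ->
  measurable [set t : n.-tuple T | forall j, B (tnth t j)] /\
  tuple_measure mu n [set t | forall j, B (tnth t j)] = mu B ^+ n.
Proof.
move=> mB.
have mbox k : measurable [set t : k.-tuple T | forall j, B (tnth t j)].
  rewrite (_ : mkset _ = \bigcap_(j in [set: 'I_k]) ((@tnth k T)^~ j @^-1` B)); last first.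
    by apply/seteqP; split => [t h j _|t h j]; [exact: h|exact: (h j)].
  apply: fin_bigcap_measurable; first exact: finite_finset.
  by move=> j _; rewrite -[X in measurable X]setTI; apply: measurable_tnth.
split; first exact: mbox.
elim: n => [|n IH].
  by rewrite /= diracE mem_set//= => -[].
rewrite expeS -IH /= /cons_measure /pushforward -product_measure1E//; last exact: mbox.
congr ((_ \x _) _); apply/seteqP; split => -[x t] /=.
  move=> h; split => /= [|j]; first by have := h ord0; rewrite tnth0.
  by have := h (lift ord0 j); rewrite tnthS; congr (B (tnth _ _)); exact: val_inj.
move=> [/= Bx Bt] j; case: (unliftP ord0 j) => [k ->|->]; last by rewrite tnth0.
by rewrite tnthS; have := Bt k; congr (B (tnth _ _)); exact: val_inj.
Qed.
End tuple.

Section lebesgueC.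
Variables (R : realType) (n : nat).
Local Notation C := R[i].
Local Notation TR := (measurableTypeR R).
Local Notation mu := (@lebesgueC R n).

Lemma measurable_shiftC (v : 'rV[C]_n) :
  measurable_fun setT (fun z : borelC n => (z + v)%R : borelC n).
Proof.
apply: (@measurability _ _ _ (borelC n) _ _ (@open 'rV[C]_n)) => //.
move=> _ [U oU <-]; rewrite setTI; apply: sub_sigma_algebra.
apply: (@open_comp _ _ (fun z : 'rV[C]_n => (z + v)%R)) => // z _.
by apply: (@continuousD C 'rV[C]_n); [exact: id|exact: cst_continuous].
Qed.

Lemma lebesgue2_shift (a : TR * TR) (A : set (TR * TR)) : measurable A ->
  lebesgue2 ((fun p : TR * TR => ((p.1 + a.1)%R : TR, (p.2 + a.2)%R : TR)) @^-1` A) = lebesgue2 A.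
Proof.
move=> mA; rewrite /lebesgue2.
have mD (c : R) : measurable_fun setT (fun x : TR => (x + c)%R : TR) by exact: measurable_funD.
exact: (product_measure_map (mD a.1) (mD a.2) (@lebesgue_measure_shift R a.1) (@lebesgue_measure_shift R a.2)).
Qed.

Lemma lebesgueC_shift (v : 'rV[C]_n) (A : set (borelC n)) : measurable A ->
  mu ((fun z : borelC n => (z + v)%R : borelC n) @^-1` A) = mu A.
Proof.
move=> mA; rewrite /lebesgueC /pushforward.
pose a j : TR * TR := (complex.Re (v ord0 j), complex.Im (v ord0 j)).
have mO : measurable (@of_reals R n @^-1` A).
  by rewrite -[X in measurable X]setTI; exact: measurable_of_reals.
have mD (c : R) : measurable_fun setT (fun x : TR => (x + c)%R : TR) by exact: measurable_funD.
rewrite -(@tuple_measure_map _ _ _ lebesgue2 n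
  (fun j (p : TR * TR) => ((p.1 + (a j).1)%R : TR, (p.2 + (a j).2)%R : TR)) _ _ _ mO).
- congr (tuple_measure _ _ _); apply/seteqP; split => t /=; congr (A _);
  apply/rowP => j; rewrite !mxE tnth_mktuple /a /=; by case: (v ord0 j).
- move=> j; apply: measurable_fun_pair.
    exact: (measurableT_comp (mD (a j).1) measurable_fst).
  exact: (measurableT_comp (mD (a j).2) measurable_snd).
- by move=> j B mB; exact: lebesgue2_shift.
Qed.

Lemma integral_lebesgueC_shift (v : 'rV[C]_n) (A : set (borelC n)) (f : borelC n -> \bar R) :
  measurable A -> measurable_fun A f -> (forall z, A z -> 0 <= f z) ->
  \int[mu]_(z in (fun z : borelC n => (z + v)%R : borelC n) @^-1` A) f (z + v)%R = \int[mu]_(z in A) f z.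
Proof.
move=> mA mf f0.
rewrite -[LHS](ge0_integral_pushforward (measurable_shiftC v) mu mA mf); last first.
  by move=> y /set_mem; exact: f0.
apply: eq_measure_integral; first exact: measurable_shiftC.
by move=> mf' B mB _; exact: lebesgueC_shift.
Qed.

Definition cboxC (M : R) : set 'rV[C]_n :=
  [set z | forall j, (`|complex.Re (z ord0 j)| <= M)%R /\ (`|complex.Im (z ord0 j)| <= M)%R].

Lemma measurable_open (U : set 'rV[C]_n) : open U -> measurable (U : set (borelC n)).
Proof. by move=> oU; exact: sub_sigma_algebra. Qed.

Lemma measurable_closed (U : set 'rV[C]_n) : closed U -> measurable (U : set (borelC n)).
Proof.
move=> cU; rewrite -[U]setCK; apply: measurableC; apply: measurable_open.
exact: closed_openC.
Qed.

Lemma continuous_coordC (j : 'I_n) : continuous (fun z : 'rV[C]_n => z ord0 j).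
Proof. exact: coord_continuous. Qed.

Lemma measurable_cboxC M : measurable (cboxC M : set (borelC n)).
Proof.
have -> : cboxC M = \bigcap_(j in [set: 'I_n])
    ([set z : 'rV[C]_n | (`|complex.Re (z ord0 j)| <= M)%R] `&` [set z | (`|complex.Im (z ord0 j)| <= M)%R]).
  by apply/seteqP; split => [z h j _|z h j]; [exact: h|have [] := h j I].
apply: fin_bigcap_measurable; first exact: finite_finset.
move=> j _; apply: measurableI; apply: measurable_closed.
  apply: (@closed_comp _ _ (fun z : 'rV[C]_n => `|complex.Re (z ord0 j)|%R : R) [set x : R | (x <= M)%R]); last exact: closed_le.
  move=> z _; apply: (@continuous_comp 'rV[C]_n R R (fun z => complex.Re (z ord0 j)) (fun x : R => `|x|%R)); last exact: norm_continuous.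
  by apply: (@continuous_comp _ _ _ (fun z : 'rV[C]_n => z ord0 j)); [exact: continuous_coordC|exact: continuous_Re].
apply: (@closed_comp _ _ (fun z : 'rV[C]_n => `|complex.Im (z ord0 j)|%R : R) [set x : R | (x <= M)%R]); last exact: closed_le.
move=> z _; apply: (@continuous_comp 'rV[C]_n R R (fun z => complex.Im (z ord0 j)) (fun x : R => `|x|%R)); last exact: norm_continuous.
by apply: (@continuous_comp _ _ _ (fun z : 'rV[C]_n => z ord0 j)); [exact: continuous_coordC|exact: continuous_Im].
Qed.

Lemma lebesgueC_cboxC M : (0 < M)%R -> 0 < mu (cboxC M) /\ mu (cboxC M) < +oo.
Proof.
move=> M0; pose B : set (TR * TR) := `[(- M)%R, M]%classic `*` `[(- M)%R, M]%classic.
have mI : measurable (`[(- M)%R, M]%classic : set TR) by exact: measurable_itv.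
have mB : measurable B by exact: measurableX.
have -> : mu (cboxC M) = lebesgue2 B ^+ n.
  rewrite -(tuple_measure_box _ n mB).2 /lebesgueC /pushforward.
  congr (tuple_measure _ _ _); apply/seteqP; split => t /= h j; have := h j.
    by rewrite !mxE/= !ler_norml /B/= !in_itv/=.
  by rewrite !mxE/= !ler_norml /B/= !in_itv/=.
have -> : lebesgue2 B = (4 * M ^+ 2)%:E.
  rewrite /lebesgue2 product_measure1E//= !lebesgue_measure_itv/= lte_fin gtrN// -EFinB -EFinM.
  by congr EFin; ring.
rewrite -EFin_expe ltry lte_fin; split=> //.
by rewrite exprn_gt0// mulr_gt0// exprn_gt0.
Qed.

(** Needed for Tonelli's theorem on products with Lebesgue measure on C^n. *)
Lemma lebesgueC_sigma_finite : sigma_finite setT mu.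
Proof.
exists (fun k => cboxC k.+1%:R).
  apply/esym/seteqP; split => // z _.
  pose M := (\sum_j (`|complex.Re (z ord0 j)| + `|complex.Im (z ord0 j)|))%R.
  have M0 : (0 <= M)%R by apply: sumr_ge0 => j _; rewrite addr_ge0.
  exists (Num.bound M) => // j.
  have : (`|complex.Re (z ord0 j)| + `|complex.Im (z ord0 j)| <= M)%R.
    by rewrite /M (bigD1 j)//= lerDl sumr_ge0// => k _; rewrite addr_ge0.
  have := archi_boundP M0; have : ((Num.bound M)%:R <= (Num.bound M).+1%:R :> R)%R by rewrite ler_nat.
  have := normr_ge0 (complex.Re (z ord0 j)); have := normr_ge0 (complex.Im (z ord0 j)).
  by move=> ? ? ? ? ?; split; lra.
by move=> k; split; [exact: measurable_cboxC|have [] := @lebesgueC_cboxC k.+1%:R (ltr0Sn _ _)].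
Qed.

HB.instance Definition _ := Measure_isSigmaFinite.Build _ _ _ (@lebesgueC R n) lebesgueC_sigma_finite.
End lebesgueC.
End product_lebesgue.

(** * Polar functionals of a convex set *)

Section functionals.
Variables (R : realType) (n : nat).
Local Notation C := R[i].
Local Notation V := 'rV[C]_n.

Lemma rnorm_lt_coord (v : V) (r : R) : 0 < r ->
  (rnorm v < r) <-> (forall j, rnorm (v ord0 j) < r).
Proof.
move=> r0; have h : (rnorm v < r) <-> ball (0 : V) r%:C v.
  by rewrite -ball_normE/= sub0r normrN rnormE ltcR.
split=> [/h[_ vr] j|vr].
  by have := vr ord0 j; rewrite -ball_normE/= mxE sub0r normrN rnormE ltcR.
apply/h; split; first by rewrite ltcR.
by move=> i j; rewrite ord1 -ball_normE/= mxE sub0r normrN rnormE ltcR.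
Qed.

Lemma rnorm_coord (v : V) j : rnorm (v ord0 j) <= rnorm v.
Proof.
apply/ler_addgt0Pr => e e0.
have /rnorm_lt_coord : 0 < rnorm v + e by rewrite ltr_wpDl ?rnorm_ge0.
by move=> /(_ v)[+ _]; rewrite ltrDl => /(_ e0 j)/ltW.
Qed.

(** The real part of the standard Hermitian product. *)
Definition rdot (x y : V) : R :=
  \sum_j (complex.Re (x ord0 j) * complex.Re (y ord0 j) + complex.Im (x ord0 j) * complex.Im (y ord0 j)).

Lemma rdotDl x x' y : rdot (x + x') y = rdot x y + rdot x' y.
Proof. by rewrite /rdot -big_split/=; apply: eq_bigr => j _; rewrite !mxE !raddfD/=; ring. Qed.

Lemma rdotC x y : rdot x y = rdot y x.
Proof. by apply: eq_bigr => j _; ring. Qed.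

Lemma rdotNl x y : rdot (- x) y = - rdot x y.
Proof. by rewrite /rdot -sumrN; apply: eq_bigr => j _; rewrite !mxE !raddfN/=; ring. Qed.

Lemma rdotZl (s : R) x y : rdot (s%:C *: x) y = s * rdot x y.
Proof.
rewrite /rdot mulr_sumr; apply: eq_bigr => j _; rewrite !mxE; case: (x ord0 j) => a b /=; ring.
Qed.

Lemma rdot_coord (x : V) j : rnorm (x ord0 j) ^+ 2 <= rdot x x.
Proof.
rewrite /rdot (bigD1 j)//= -!expr2 rnorm_normc.
have -> : ComplexField.Normc.normc (x ord0 j) ^+ 2 =
   complex.Re (x ord0 j) ^+ 2 + complex.Im (x ord0 j) ^+ 2.
  by case: (x ord0 j) => a b /=; rewrite sqr_sqrtr// addr_ge0 ?sqr_ge0.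
by rewrite lerDl sumr_ge0// => k _; rewrite addr_ge0// -expr2 sqr_ge0.
Qed.

Lemma rdot_rnorm (x : V) M : rnorm x <= M -> rdot x x <= n%:R * (2 * M ^+ 2).
Proof.
move=> xM; rewrite mulrC mulr_natr -[n in leRHS]card_ord -sumr_const.
apply: ler_sum => j _; rewrite mulr2n mulrDl mul1r -!expr2.
have xj := le_trans (rnorm_coord x j) xM; have M0 := le_trans (rnorm_ge0 _) xM.
have sqle (a : R) : `|a| <= M -> a ^+ 2 <= M ^+ 2.
  by move=> aM; rewrite -(real_normK (num_real a)) lerXn2r ?nnegrE.
by apply: lerD; apply: sqle; apply: le_trans xj; [exact: normr_Re|exact: normr_Im].
Qed.

(** The bilinear pairing: a linear functional on C^n is given by its row of
coefficients. *)
Definition pairing (a v : V) : C := \sum_j a ord0 j * v ord0 j.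

Lemma pairingDr a v w : pairing a (v + w) = pairing a v + pairing a w.
Proof. by rewrite /pairing -big_split/=; apply: eq_bigr => j _; rewrite mxE mulrDr. Qed.
Lemma pairingZr a c v : pairing a (c *: v) = c * pairing a v.
Proof. by rewrite /pairing mulr_sumr; apply: eq_bigr => j _; rewrite mxE mulrCA. Qed.
Lemma pairingZl a c v : pairing (c *: a) v = c * pairing a v.
Proof. by rewrite /pairing mulr_sumr; apply: eq_bigr => j _; rewrite mxE mulrA. Qed.
Lemma pairingDl a b v : pairing (a + b) v = pairing a v + pairing b v.
Proof. by rewrite /pairing -big_split/=; apply: eq_bigr => j _; rewrite mxE mulrDl. Qed.

Lemma rnorm_pairing (a v : V) : rnorm (pairing a v) <= n%:R * (rnorm a * rnorm v).
Proof.
rewrite mulrC mulr_natr -[X in _ *+ X]card_ord -sumr_const.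
rewrite /pairing; elim/big_ind2: _ => [|x y z t xy zt|j _]; first by rewrite rnorm0.
- by apply: le_trans (rnormD _ _) _; exact: lerD.
- by rewrite rnormM ler_pM ?rnorm_ge0 ?rnorm_coord.
Qed.

Definition conjv (y : V) : V := \row_j (y ord0 j)^*%C.

Lemma pairing_conjv x y : complex.Re (pairing (conjv y) x) = rdot x y.
Proof.
rewrite /pairing raddf_sum/=; apply: eq_bigr => j _; rewrite mxE.
by case: (x ord0 j) => a b; case: (y ord0 j) => c d /=; ring.
Qed.
End functionals.

Section polar_sets.
Variables (R : realType) (n : nat).
Local Notation C := R[i].
Local Notation V := 'rV[C]_n.
Variables (Omega : set V) (M : R).
Hypotheses (oO : open Omega) (cO : convex_set Omega) (bO : forall z, Omega z -> rnorm z <= M).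

Lemma rdot_subZ (y q : V) (s : R) : rdot (y - s%:C *: q) (y - s%:C *: q) =
  rdot y y - s * rdot q y - s * rdot q y + s * (s * rdot q q).
Proof.
rewrite rdotDl rdotNl rdotZl (rdotC y (_ - _)) (rdotC q (_ - _)) !rdotDl !rdotNl !rdotZl.
by rewrite (rdotC y q); ring.
Qed.

Lemma open_rnorm z : Omega z -> exists2 r : R, 0 < r & forall w, rnorm (w - z) < r -> Omega w.
Proof. by move=> Oz; apply/nbhs_rnorm; exact: open_nbhs_nbhs. Qed.

(** A small ball around w, joined to points of Omega near x, fills a neighbourhood of the
point in question. *)
Lemma convex_cone (x w : V) (t : R) : closure Omega x -> Omega w -> 0 < t <= 1 ->
  Omega ((1 - t)%:C *: x + t%:C *: w).
Proof.
move=> cx Ow /andP[t0 t1]; have [r r0 rP] := open_rnorm Ow.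
have tr0 : 0 < t * r by exact: mulr_gt0.
have [y [Oy xy]] : exists y, Omega y /\ rnorm (x - y) < t * r.
  have /cx[y [Oy /= yx]] : nbhs x [set y | rnorm (x - y) < t * r].
    by apply/nbhs_rnorm; exists (t * r) => // y; rewrite -opprB rnormN.
  by exists y.
(* The point is also the combination of y and of w', which is close to w. *)
pose w' := w + (t^-1 * (1 - t))%:C *: (x - y).
have ti0 : 0 <= t^-1 by rewrite invr_ge0 ltW.
have Ow' : Omega w'.
  apply: rP; rewrite /w' addrC addKr rnormZ rnorm_real ger0_norm; last first.
    by apply: mulr_ge0 => //; rewrite subr_ge0.
  apply: (@le_lt_trans _ _ (t^-1 * rnorm (x - y))).
    by rewrite ler_wpM2r ?rnorm_ge0// ler_piMr// gerBl ltW.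
  by rewrite ltr_pdivrMl.
have := (convex_setCP Omega).1 cO y w' (1 - t) Oy Ow'.
rewrite subr_ge0 t1 gerBl (ltW t0) => /(_ isT).
have -> : 1 - (1 - t) = t by ring.
congr Omega; rewrite /w' scalerDr scalerA -rmorphM/= mulrA mulfV ?gt_eqF// mul1r.
by rewrite scalerBr addrCA subrKC addrC.
Qed.

Variable w : V.
Hypothesis Ow : Omega w.

Definition polar (a : V) := forall z, Omega z -> complex.Re (pairing a (z - w)) <= 1.

(** Test a on small multiples of the coordinate vectors, rotated so that the value is
positive. *)
Lemma polar_bounded : exists2 B : R, 0 < B & forall a, polar a -> forall j, rnorm (a ord0 j) <= B.
Proof.
have [r r0 rP] := open_rnorm Ow; exists (2 / r); first by rewrite divr_gt0.
move=> a pa j; set x := a ord0 j; have [->|x0] := eqVneq x 0; first by rewrite rnorm0 divr_ge0// ltW.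
have nx : 0 < rnorm x by rewrite lt_def rnorm_ge0 rnorm_eq0 x0.
pose c : C := (r / 2 / rnorm x)%:C * x^*%C.
have nc : rnorm c = r / 2.
  rewrite rnormM rnorm_real ger0_norm ?divr_ge0// ?ltW//.
  by rewrite (_ : rnorm x^*%C = rnorm x) ?divfK ?gt_eqF// /rnorm normcJ.
have := pa (w + c *: delta_mx ord0 j).
rewrite [w + _]addrC addrK; have -> : pairing a (c *: delta_mx ord0 j) = c * x.
  rewrite pairingZr /pairing (bigD1 j)//= mxE !eqxx mulr1 big1 ?addr0// => k kj.
  by rewrite mxE (negbTE kj) andbF mulr0.
have -> : complex.Re (c * x) = r / 2 * rnorm x.
  have -> : c * x = (r / 2 * rnorm x)%:C.
    rewrite /c -mulrA [_^* * x]mulrC -sqr_normc (rnormE x) -rmorphXn -rmorphM/=; congr (_%:C).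
    by field; rewrite gt_eqF.
  by [].
have h : Omega (c *: delta_mx ord0 j + w).
  apply: rP; rewrite addrK; apply/rnorm_lt_coord => // k; rewrite !mxE rnormM nc eqxx/=.
  by case: eqP => _; rewrite ?rnorm0 ?mulr0// (rnorm_real 1) normr1 mulr1; lra.
by move=> /(_ h); rewrite -ler_pdivlMl ?divr_gt0// invf_div mulr1.
Qed.

Lemma small_polar : exists2 e : R, 0 < e & forall a : V, rnorm a <= e -> polar a.
Proof.
have M0 : 0 <= M := le_trans (rnorm_ge0 _) (bO Ow).
pose D := n%:R * (M + M) + 1; have D0 : 0 < D by rewrite ltr_wpDl// mulr_ge0// addr_ge0.
exists D^-1; rewrite ?invr_gt0// => a ae z Oz.
apply: le_trans (ler_norm _) _; apply: le_trans (normr_Re _) _; apply: le_trans (rnorm_pairing _ _) _.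
have zw : rnorm (z - w) <= M + M.
  by apply: le_trans (rnormD _ _) _; rewrite rnormN lerD// bO.
apply: (@le_trans _ _ (n%:R * (D^-1 * (M + M)))).
  by rewrite ler_wpM2l// ler_pM ?rnorm_ge0.
by rewrite mulrCA -ler_pdivlMl ?invr_gt0// invrK mulr1 /D lerDl.
Qed.

(** The Hahn-Banach separation, normalized at w.  The nearest point of the closure is
replaced by an almost nearest point x of Omega; minimality along segments from x gives the
separating functional with an error d / 4, where d is the infimum of the squared
distances, and this error is absorbed by |y|^2 >= d. *)
Lemma polar_separation v : ~ closure Omega (w + v) ->
  exists2 a, polar a & 1 < complex.Re (pairing a v).
Proof.
move=> ncl; set p := w + v.
have [r r0 rP] : exists2 r : R, 0 < r & forall x, Omega x -> r <= rdot (p - x) (p - x).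
  apply: contrapT => H; apply: ncl => A /nbhs_rnorm[e e0 eA].
  have e20 : 0 < e ^+ 2 by rewrite exprn_gt0.
  have [x [Ox xe]] : exists x, Omega x /\ rdot (p - x) (p - x) < e ^+ 2.
    apply: contrapT => /forallNP Nx; apply: H; exists (e ^+ 2) => // x Ox.
    by rewrite leNgt; apply/negP => xe; apply: (Nx x).
  exists x; split => //; apply: eA; rewrite -opprB rnormN.
  apply/rnorm_lt_coord => // j.
  rewrite -ltr_sqr ?nnegrE ?rnorm_ge0 ?(ltW e0)//; exact: le_lt_trans (rdot_coord _ _) xe.
pose S := [set rdot (p - x) (p - x) | x in Omega].
have S0 : S !=set0 by exists (rdot (p - w) (p - w)), w.
have Slb : has_inf S by split => //; exists r => _ [x Ox <-]; exact: rP.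
(* The squared distance from p to Omega. *)
pose d := inf S.
have d0 : 0 < d by apply: lt_le_trans r0 _; apply: lb_le_inf => // _ [x Ox <-]; exact: rP.
have dP x : Omega x -> d <= rdot (p - x) (p - x).
  by move=> Ox; apply: ge_inf; [case: Slb|exists x].
pose D := n%:R * (2 * (M + M) ^+ 2) + 1.
have D0 : 0 < D by rewrite ltr_wpDl// mulr_ge0// mulr_ge0// sqr_ge0.
have DP x z : Omega x -> Omega z -> rdot (z - x) (z - x) <= D.
  move=> Ox Oz; apply: (@le_trans _ _ (n%:R * (2 * (M + M) ^+ 2))); last by rewrite lerDl.
  by apply: rdot_rnorm; apply: le_trans (rnormD _ _) _; rewrite rnormN lerD// bO.
(* A step along a segment from x, short enough for the quadratic term to be negligible. *)
pose s := Num.min 1 (d / (4 * D)).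
have s0 : 0 < s by rewrite lt_min ltr01 divr_gt0// mulr_gt0.
have s1 : s <= 1 by rewrite ge_min lexx.
have sD : s * D <= d / 4.
  rewrite -ler_pdivlMr// ge_min; apply/orP; right.
  by rewrite invfM mulrA.
have [_ [x Ox <-]] := inf_adherent (divr_gt0 (mulr_gt0 s0 d0) (ltr0Sn R 3)) Slb.
rewrite -/d => xd.
pose y := p - x.
have yz z : Omega z -> rdot (z - x) y <= d / 4.
  move=> Oz; have Os : Omega (s%:C *: z + (1 - s)%:C *: x).
    by apply: (convex_setCP Omega).1 => //; rewrite s1 ltW.
  have := dP _ Os.
  have -> : p - (s%:C *: z + (1 - s)%:C *: x) = y - s%:C *: (z - x).
    rewrite /y rmorphB/= scalerBl scale1r scalerBr -[RHS]addrA -opprD.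
    by congr (_ - _); rewrite addrCA.
  have h2 := DP _ _ Ox Oz; move: h2; set q := z - x; move=> h2.
  have -> : rdot (y - s%:C *: q) (y - s%:C *: q) = rdot y y - s * rdot q y - s * rdot q y + s * (s * rdot q q).
    exact: rdot_subZ.
  move: xd; rewrite -/y => xd h.
  have h3 : s * (s * rdot q q) <= s * (d / 4).
    rewrite ler_wpM2l ?(ltW s0)//; apply: le_trans sD; by rewrite ler_wpM2l// ltW.
  have h4 : s * (rdot q y) * 2 <= s * (d / 4) * 2 by lra.
  by rewrite -(ler_pM2l s0); move: h4; rewrite ler_pM2r.
(* The supremum of <z - w, y> over Omega is at most b; b > 0 because Omega is a neighbourhood
   of w. *)
pose b := rdot (x - w) y + d / 4.
have Ny : d <= rdot y y by exact: dP.
have b0 : 0 < b.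
  have [t t0 tP] := open_rnorm Ow.
  pose q := (t / 2 / (rnorm y + 1))%:C.
  have ny : 0 < rnorm y + 1 by rewrite ltr_wpDl ?rnorm_ge0.
  have q0 : 0 < t / 2 / (rnorm y + 1) by rewrite !divr_gt0.
  have Oq : Omega (w + q *: y).
    apply: tP; rewrite addrC addKr rnormZ rnorm_real gtr0_norm//.
    rewrite mulrAC ltr_pdivrMr//; apply: (@le_lt_trans _ _ (t / 2 * (rnorm y + 1))).
      by rewrite ler_pM2l ?divr_gt0// lerDl.
    by rewrite ltr_pM2r//; lra.
  have := yz _ Oq; rewrite (_ : w + q *: y - x = q *: y + - (x - w)); last first.
    by rewrite opprB [w + _]addrC addrA.
  rewrite rdotDl rdotZl rdotNl => h.
  have : 0 < t / 2 / (rnorm y + 1) * rdot y y by rewrite mulr_gt0//; lra.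
  rewrite /b; lra.
have key z : complex.Re (pairing ((b^-1)%:C *: conjv y) z) = b^-1 * rdot z y.
  rewrite pairingZl -pairing_conjv; case: (pairing _ _) => ? ? /=; ring.
exists ((b^-1)%:C *: conjv y) => [z Oz|]; rewrite key.
  rewrite -ler_pdivlMl ?invr_gt0// invrK mulr1 /b.
  have E : rdot (z - w) y = rdot (z - x) y + rdot (x - w) y by rewrite -rdotDl subrKA.
  have := yz _ Oz; rewrite E; lra.
rewrite -ltr_pdivrMl ?invr_gt0// invrK mulr1 /b.
have -> : rdot v y = rdot y y + rdot (x - w) y.
  by rewrite -rdotDl; congr rdot; rewrite /y /p addrA subrK addrC addKr.
lra.
Qed.
End polar_sets.

Section determinants.
Variables (R : realType) (n : nat).
Local Notation C := R[i].
Local Notation V := 'rV[C]_n.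

Lemma rnorm_sum (I : Type) (s : seq I) (P : pred I) (F : I -> C) :
  rnorm (\sum_(i <- s | P i) F i) <= \sum_(i <- s | P i) rnorm (F i).
Proof.
elim/big_ind2: _ => [|x y z t xy zt|j _]; [by rewrite rnorm0| |exact: lexx].
by apply: le_trans (rnormD _ _) _; exact: lerD.
Qed.

Lemma rnorm_prod (I : Type) (s : seq I) (P : pred I) (F : I -> C) :
  rnorm (\prod_(i <- s | P i) F i) = \prod_(i <- s | P i) rnorm (F i).
Proof.
elim/big_ind2: _ => [|x y z t <- <-|//]; [by rewrite (rnorm_real 1) normr1|exact: rnormM].
Qed.

Lemma rnorm_det (A : 'M[C]_n) (B : R) : (forall i j, rnorm (A i j) <= B) ->
  rnorm (\det A) <= (n`!)%:R * B ^+ n.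
Proof.
move=> AB; apply: le_trans (rnorm_sum _ _ _) _.
have -> : (n`!)%:R * B ^+ n = \sum_(s : 'S_n) B ^+ n.
  by rewrite sumr_const card_Sn mulr_natl.
apply: ler_sum => s _; rewrite rnormM rnorm_prod.
have -> : rnorm ((-1) ^+ s : C) = 1.
  by case: (odd_perm s); rewrite ?expr0 ?expr1 ?rnormN (rnorm_real 1) normr1.
rewrite mul1r -[n in leRHS]card_ord -prodr_const; apply: ler_prod => i _.
by rewrite rnorm_ge0 AB.
Qed.

Definition set_row (A : 'M[C]_n) (j : 'I_n) (a : V) : 'M[C]_n :=
  \matrix_(i, k) if i == j then a ord0 k else A i k.

(** Cramer's rule for the coordinates of a in the basis formed by the rows of A. *)
Lemma cramer_coord (A : 'M[C]_n) (a : V) : \det A != 0 ->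
  a = \sum_j (\det (set_row A j a) / \det A) *: row j A.
Proof.
move=> dA; have uA : A \in unitmx by rewrite unitmxE unitfE.
have E j : \det (set_row A j a) = (a *m \adj A) ord0 j.
  rewrite (expand_det_row _ j) mxE; apply: eq_bigr => k _.
  rewrite !mxE eqxx; congr (_ * (_ * \det _)).
  by apply/matrixP => i l; rewrite !mxE eq_sym (negbTE (neq_lift _ _)).
have -> : \sum_j (\det (set_row A j a) / \det A) *: row j A = a *m invmx A *m A.
  rewrite [RHS]mulmx_sum_row; apply: eq_bigr => j _; congr (_ *: _).
  by rewrite E /invmx uA -scalemxAr [RHS]mxE mulrC.
by rewrite mulmxKV.
Qed.

(** An Auerbach basis in the polar set.  If the determinant of A is at least half the
supremum, then by Cramer's rule every polar functional is a combination of the rows of A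
with coefficients bounded by 2.  A vector v whose forms are bounded by 1 / (4 n) therefore
satisfies |a (2 v)| <= 1 for every polar a; by separation w + 2 v is in the closure
of Omega, and w + v is in Omega. *)
Lemma polar_frame (Omega : set V) (M : R) (w : V) : open Omega -> convex_set Omega ->
  (forall z, Omega z -> rnorm z <= M) -> Omega w -> (0 < n)%N ->
  exists A : 'M[C]_n, [/\ \det A != 0, forall i, polar Omega w (row i A) &
    forall v, (forall i, rnorm (pairing (row i A) v) <= (4 * n%:R)^-1) -> Omega (w + v)].
Proof.
move=> oO cO bO Ow n0.
have [B B0 BP] := polar_bounded oO Ow.
have [e e0 eP] := small_polar bO Ow.
pose S := [set rnorm (\det A) | A in [set A : 'M[C]_n | forall i, polar Omega w (row i A)]].
have SB A : (forall i, polar Omega w (row i A)) -> rnorm (\det A) <= (n`!)%:R * B ^+ n.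
  move=> pA; apply: rnorm_det => i j.
  by have := BP _ (pA i) j; rewrite mxE.
(* Small multiples of the coordinate functionals are polar, so the supremum is positive. *)
pose A0 : 'M[C]_n := (e / 2)%:C%:M.
have pA0 i : polar Omega w (row i A0).
  apply: eP; apply/ltW/rnorm_lt_coord => // j; rewrite !mxE.
  case: (i == j); last by rewrite mulr0n rnorm0.
  by rewrite mulr1n rnorm_real gtr0_norm ?divr_gt0//; lra.
have hS : has_sup S.
  split; first by exists (rnorm (\det A0)), A0.
  by exists ((n`!)%:R * B ^+ n) => _ [A pA <-]; exact: SB.
have supP A : (forall i, polar Omega w (row i A)) -> rnorm (\det A) <= sup S.
  by move=> pA; apply: ub_le_sup; [case: hS|exists A].
have s0 : 0 < sup S.
  apply: lt_le_trans (supP _ pA0); rewrite det_scalar -rmorphXn rnorm_real gtr0_norm ?exprn_gt0// divr_gt0//.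
have [_ [A pA <-] sA] := sup_adherent (divr_gt0 s0 (ltr0Sn R 1)) hS.
have dA0 : 0 < rnorm (\det A) by lra.
have dA : \det A != 0 by rewrite -rnorm_eq0 gt_eqF.
exists A; split=> // v vA.
apply: contrapT => NO.
(* w + v is the midpoint of w and w + 2 v. *)
have ncl : ~ closure Omega (w + 2%:C *: v).
  move=> cl; apply: NO; have t2 : 0 < (2^-1 : R) <= 1 by rewrite invr_gt0 ltr0n/= invf_le1// ler1n.
  have := convex_cone oO cO cl Ow t2; congr Omega.
  have -> : (1 - 2^-1 : R) = 2^-1 by field.
  rewrite scalerDr scalerA -rmorphM/= mulVf// scale1r addrAC -scalerDl -rmorphD/=.
  have -> : (2^-1 + 2^-1 : R) = 1 by field.
  by rewrite scale1r.
have [a pa] := polar_separation oO cO bO Ow ncl; apply/negP; rewrite -leNgt.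
apply: le_trans (ler_norm _) _; apply: le_trans (normr_Re _) _.
have lfs (F : 'I_n -> V) u : pairing (\sum_j F j) u = \sum_j pairing (F j) u.
  elim/big_ind2: _ => [|x y z t <- <-|//]; last exact: pairingDl.
  by rewrite /pairing big1// => j _; rewrite mxE mul0r.
rewrite (cramer_coord a dA) lfs; apply: le_trans (rnorm_sum _ _ _) _.
rewrite [leRHS](_ : _ = \sum_(j < n) (n%:R)^-1); last first.
  by rewrite sumr_const card_ord -[RHS]mulr_natr mulVf// pnatr_eq0 -lt0n.
apply: ler_sum => j _; rewrite pairingZl pairingZr rnormM [rnorm (2%:C * _)]rnormM rnorm_real ger0_norm//.
have c2 : rnorm (\det (set_row A j a) / \det A) <= 2.
  rewrite -(ler_pM2r dA0) -rnormM divfK//.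
  have : rnorm (\det (set_row A j a)) <= sup S.
    apply: supP => i; have [->|ij] := eqVneq i j.
      by rewrite (_ : row j _ = a)//; apply/rowP => k; rewrite !mxE eqxx.
    rewrite (_ : row i _ = row i A)//; apply/rowP => k; rewrite !mxE.
    by rewrite (negbTE ij).
  lra.
have -> : (n%:R^-1 : R) = 2 * (2 * (4 * n%:R)^-1).
  by field; rewrite pnatr_eq0 -lt0n.
apply: ler_pM; [exact: rnorm_ge0|by rewrite mulr_ge0 ?rnorm_ge0|exact: c2|by rewrite ler_pM2l].
Qed.
End determinants.

(** * Coverings by parallel cells *)

Section cells.
Variables (R : realType) (n : nat).
Local Notation C := R[i].
Local Notation V := 'rV[C]_n.
Local Notation mu := (@lebesgueC R n).

(** The function is bounded on S by a weighted sum of indicators. *)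
Lemma cover_integral d (T : measurableType d) (m : {measure set T -> \bar R}) (I : finType)
   (S : set T) (E : I -> set T) (f : T -> R) (c : I -> R) :
  measurable S -> (forall i, measurable (E i)) -> measurable_fun S f ->
  (forall x, S x -> 0 <= f x) -> (forall i, 0 <= c i) ->
  (forall x, S x -> exists2 i, E i x & f x <= c i) ->
  (\int[m]_(x in S) (f x)%:E <= \sum_i (c i)%:E * m (E i))%E.
Proof.
move=> mS mE mf f0 c0 H.
apply: (@le_trans _ _ (\int[m]_(x in S) \sum_i ((c i)%:E * (\1_(E i) x)%:E))%E).
  apply: ge0_le_integral => //.
  - exact/measurable_EFinP.
  - apply: emeasurable_sum => i; apply: measurable_funeM.
    by apply/measurable_EFinP; apply: measurable_funTS; exact: measurable_indic.
  - move=> x Sx; have [i Ei fi] := H x Sx.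
    rewrite (bigD1 i)//= indicE mem_set// mule1.
    apply: (@le_trans _ _ (c i)%:E); first by rewrite lee_fin.
    by rewrite leeDl// sume_ge0// => j _; rewrite mule_ge0 ?lee_fin.
rewrite ge0_integral_sum//; last 2 first.
- move=> i; apply: measurable_funeM.
  by apply/measurable_EFinP; apply: measurable_funTS; exact: measurable_indic.
- by move=> i x _; rewrite mule_ge0 ?lee_fin.
apply: lee_sum => i _; rewrite ge0_integralZl_EFin//; last first.
  by apply/measurable_EFinP; apply: measurable_funTS; exact: measurable_indic.
rewrite lee_wpmul2l ?lee_fin// integral_indic//; apply: le_measure; rewrite ?inE//.
exact: measurableI.
Qed.

Lemma pairing_differentiable (a : V) z : differentiable (fun v : V => pairing a v : C) z.
Proof.
have -> : (fun v : V => pairing a v) = \sum_(j < n) (fun v : V => a ord0 j *: (v ord0 j : C)).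
  by apply/funext => v; rewrite fct_sumE.
apply: differentiable_sum => j.
exact: (differentiableZ (a ord0 j) (differentiable_coord z ord0 j)).
Qed.

Lemma pairing_continuous (a : V) : continuous (fun v : V => pairing a v : C).
Proof. by move=> z; apply: differentiable_continuous; exact: pairing_differentiable. Qed.

(** The left end of a unit interval: [a, a + 1] for (a, true) and [- a - 1, - a] for
(a, false).  The sign is kept apart so that |x| + 1 is comparable with a + 1. *)
Definition unit_left {N} (j : 'I_N * bool) : R := if j.2 then j.1%:R else - j.1%:R - 1.

Lemma unit_left_cover (N : nat) (x : R) : `|x| < N%:R -> exists j : 'I_N * bool, unit_left j <= x <= unit_left j + 1.
Proof.
move=> xN; pose k := Num.trunc `|x|.
have /andP[k1 k2] : k%:R <= `|x| < k.+1%:R by apply: truncn_itv.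
have kN : (k < N)%N by rewrite -(ltr_nat R); exact: le_lt_trans xN.
exists (Ordinal kN, 0 <= x); rewrite /unit_left/=; move: k1 k2; rewrite -natr1.
case: (lerP 0 x) => x0 /=; first by rewrite (ger0_norm x0) => -> /ltW ->.
rewrite (ltr0_norm x0) => ? ?; apply/andP; split; lra.
Qed.

Section rows.
Variables (A : 'M[C]_n).
Hypothesis dA : \det A != 0.
Definition row_form (v : V) (i : 'I_n) : C := pairing (row i A) v.

Lemma row_form_surj (t : 'I_n -> C) : exists v, forall i, row_form v i = t i.
Proof.
have uA : A^T \in unitmx by rewrite unitmx_tr unitmxE unitfE.
exists ((\row_i t i) *m invmx A^T) => i.
transitivity (((\row_i t i) *m invmx A^T *m A^T) ord0 i).
  by rewrite [RHS]mxE; apply: eq_bigr => j _; rewrite !mxE mulrC.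
by rewrite mulmxKV// mxE.
Qed.

(** A parallelepiped in the coordinates given by the rows of A. *)
Definition cell (c : 'I_n -> C) (r : R) : set V := [set v | forall i,
  0 <= complex.Re (row_form v i - c i) <= r /\ 0 <= complex.Im (row_form v i - c i) <= r].

Definition cell0 (r : R) := cell (fun=> 0) r.

Lemma closed_forall (P : 'I_n -> set V) : (forall i, closed (P i)) -> closed [set v | forall i, P i v].
Proof.
move=> cP; rewrite (_ : mkset _ = \bigcap_(i in setT) P i); first by apply: closed_bigI => i _; exact: cP.
by apply/seteqP; split => v h i //; apply: h.
Qed.

Lemma closed_real_le (f : V -> R) r : continuous f -> closed [set v | f v <= r].
Proof.
by move=> fc; apply: (@closed_comp _ _ f [set x | x <= r]) => [v _|]; [exact: fc|exact: closed_le].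
Qed.
Lemma closed_real_ge (f : V -> R) r : continuous f -> closed [set v | r <= f v].
Proof.
by move=> fc; apply: (@closed_comp _ _ f [set x | r <= x]) => [v _|]; [exact: fc|exact: closed_ge].
Qed.

Lemma row_form_continuous i : continuous (fun v => row_form v i).
Proof. exact: pairing_continuous. Qed.

Lemma closed_cell c r : closed (cell c r).
Proof.
have cB i : continuous (fun v : V => row_form v i - c i).
  by move=> v; apply: (@continuousB C C^o); [exact: row_form_continuous|exact: cst_continuous].
have cR i : continuous (fun v : V => complex.Re (row_form v i - c i) : R).
  by move=> v; apply: (@continuous_comp _ _ _ (fun v => row_form v i - c i)); [exact: cB|exact: continuous_Re].
have cI i : continuous (fun v : V => complex.Im (row_form v i - c i) : R).
  by move=> v; apply: (@continuous_comp _ _ _ (fun v => row_form v i - c i)); [exact: cB|exact: continuous_Im].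
pose P i := ([set v | 0 <= complex.Re (row_form v i - c i)] `&` [set v | complex.Re (row_form v i - c i) <= r])
  `&` ([set v | 0 <= complex.Im (row_form v i - c i)] `&` [set v | complex.Im (row_form v i - c i) <= r]).
rewrite (_ : cell c r = [set v | forall i, P i v]).
  apply: closed_forall => i; apply: closedI; apply: closedI;
  [exact: closed_real_ge|exact: closed_real_le|exact: closed_real_ge|exact: closed_real_le].
apply/seteqP; split => v h i; have := h i; first by move=> [/andP[? ?] /andP[? ?]].
by move=> [[/= -> ->] [/= -> ->]].
Qed.

Lemma measurable_cell c r : measurable (cell c r : set (borelC n)).
Proof. by apply: measurable_closed; exact: closed_cell. Qed.

Lemma row_formD v w i : row_form (v + w) i = row_form v i + row_form w i.
Proof. exact: pairingDr. Qed.

(** All cells of the same size are translates of one another. *)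
Lemma cell_shift c r w : mu [set z | cell c r (z + w)] = mu (cell0 r).
Proof.
have [v vP] := row_form_surj (fun i => c i - row_form w i).
rewrite -(lebesgueC_shift (- v) (measurable_cell (fun=> 0) r)).
congr (mu _); apply/seteqP; split => z h i; have := h i; rewrite !row_formD;
  have -> : row_form (- v) i = row_form w i - c i.
- by have := vP i; rewrite -[- v]scaleN1r /row_form pairingZr mulN1r => ->; rewrite opprB.
- by rewrite subr0 addrA.
- by have := vP i; rewrite -[- v]scaleN1r /row_form pairingZr mulN1r => ->; rewrite opprB.
- by rewrite subr0 addrA.
Qed.

(** Upper bounds of product form on the cells of a grid give an integral bound by an n-th
power, by distributivity. *)
Lemma cover_cells (N : nat) (r : R) (w : V) (S : set V) (f : V -> R) (c : ('I_N * bool) * ('I_N * bool) -> R) :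
  0 < r -> measurable (S : set (borelC n)) -> measurable_fun (S : set (borelC n)) (f : borelC n -> measurableTypeR R) ->
  (forall z, S z -> 0 <= f z) -> (forall j, 0 <= c j) ->
  (forall z i, S z -> `|complex.Re (row_form (z + w) i)| < N%:R * r /\ `|complex.Im (row_form (z + w) i)| < N%:R * r) ->
  (forall z, S z -> forall m : 'I_n -> ('I_N * bool) * ('I_N * bool),
     cell (fun i => (r * unit_left (m i).1) +i* (r * unit_left (m i).2)) r (z + w) -> f z <= \prod_i c (m i)) ->
  (\int[mu]_(z in S) (f z)%:E <= ((\sum_j c j) ^+ n)%:E * mu (cell0 r))%E.
Proof.
move=> r0 mS mf f0 c0 SN H.
pose E (m : {ffun 'I_n -> ('I_N * bool) * ('I_N * bool)}) : set (borelC n) :=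
  [set z : borelC n | cell (fun i => (r * unit_left (m i).1) +i* (r * unit_left (m i).2)) r (z + w)].
have mE m : measurable (E m).
  have := measurable_shiftC w measurableT (measurable_cell (fun i => (r * unit_left (m i).1) +i* (r * unit_left (m i).2)) r).
  by rewrite setTI.
apply: le_trans (@cover_integral _ _ mu _ S E f (fun m => \prod_i c (m i)) mS mE mf f0 _ _) _.
- by move=> m; apply: prodr_ge0.
- move=> z Sz.
  have : forall i, exists j : ('I_N * bool) * ('I_N * bool),
     r * unit_left j.1 <= complex.Re (row_form (z + w) i) <= r * unit_left j.1 + r /\
     r * unit_left j.2 <= complex.Im (row_form (z + w) i) <= r * unit_left j.2 + r.
    move=> i; have [h1 h2] := SN z i Sz.
    have h x : `|x| < N%:R * r -> exists j : 'I_N * bool, r * unit_left j <= x <= r * unit_left j + r.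
      rewrite -ltr_pdivrMr// -(gtr0_norm r0) -normfV -normrM (gtr0_norm r0) => /unit_left_cover[j /andP[j1 j2]].
      exists j; move: j1 j2; rewrite ler_pdivlMr// ler_pdivrMr// => j1 j2.
      by rewrite mulrC j1/=; move: j2; rewrite mulrDl mul1r.
    by have [j1 ?] := h _ h1; have [j2 ?] := h _ h2; exists (j1, j2).
  move=> /choice[g gP]; exists [ffun i => g i].
    move=> i; have [/andP[? ?] /andP[? ?]] := gP i; rewrite !ffunE !raddfB/=.
    by split; apply/andP; split; lra.
  apply: H => // i; have [/andP[? ?] /andP[? ?]] := gP i; rewrite !ffunE !raddfB/=.
  by split; apply/andP; split; lra.
rewrite (eq_bigr (fun m : {ffun 'I_n -> ('I_N * bool) * ('I_N * bool)} =>
  (\prod_i c (m i))%:E * mu (cell0 r))%E); last by move=> m _; congr (_ * _)%E; exact: cell_shift.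
rewrite -ge0_sume_distrl; last by move=> m _; rewrite lee_fin prodr_ge0.
rewrite sumEFin -(bigA_distr_bigA (fun _ j => c j)). by rewrite prodr_const card_ord.
Qed.
End rows.
End cells.

(** * Polydiscs and test functions *)

Section test_functions.
Variables (R : realType) (n : nat).
Local Notation C := R[i].
Local Notation V := 'rV[C]_n.
Local Notation mu := (@lebesgueC R n).

(** The partial sums are at most 2 - 1 / N, by telescoping. *)
Lemma sum_inv_sqr (N : nat) : \sum_(a < N) (a.+1%:R ^+ 2)^-1 <= 2 :> R.
Proof.
case: N => [|N]; first by rewrite big_ord0.
suff : \sum_(a < N.+1) (a.+1%:R ^+ 2)^-1 <= 2 - N.+1%:R^-1 :> R.
  by move=> /le_trans; apply; rewrite gerBl invr_ge0.
elim: N => [|N IH]; first by rewrite big_ord_recl big_ord0 expr1n invr1; lra.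
rewrite big_ord_recr/=; apply: le_trans (lerD IH (lexx _)) _.
set x : R := N.+1%:R; have x0 : 0 < x by rewrite ltr0n.
have -> : N.+2%:R = x + 1 by rewrite -natr1.
rewrite -subr_ge0 (_ : _ - _ = (x * (x + 1) ^+ 2)^-1).
  by rewrite invr_ge0 mulr_ge0 ?sqr_ge0// ltW.
by field; rewrite !gt_eqF//; lra.
Qed.

Lemma open_cont_measurable (D : set V) (f : V -> R) : open D ->
  (forall z, D z -> {for z, continuous f}) ->
  measurable_fun (D : set (borelC n)) (f : borelC n -> measurableTypeR R).
Proof.
move=> oD fc; apply: (measurability _ (RGenOInfty.measurableE R)) => //.
move=> /= _ [_ [a ->] <-]; apply: measurable_open; rewrite openE => z [Dz /= fz].
apply: filterI; first exact: open_nbhs_nbhs.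
by apply: (fc z Dz); apply: open_nbhs_nbhs; split => //; exact: interval_open.
Qed.

Section rows.
Variables (A : 'M[C]_n).
Hypothesis dA : \det A != 0.

Lemma sum_one_card (N : nat) :
  \sum_(j : ('I_N * bool) * ('I_N * bool)) (1 : R) = ((N * 2) * (N * 2))%:R.
Proof. by rewrite sumr_const !card_prod !card_bool !card_ord. Qed.

(** The number of cells depends on the size ratio and on n, not on A: volumes of sets
described by the rows of A are compared without a determinant. *)
Lemma cover_measure (N : nat) (r : R) (S : set V) : 0 < r -> measurable (S : set (borelC n)) ->
  (forall z i, S z -> rnorm (row_form A z i) < N%:R * r) ->
  (mu S <= ((((N * 2) * (N * 2))%:R ^+ n)%:E * mu (cell0 A r)))%E.
Proof.
move=> r0 mS SN.
have := @cover_cells R n A dA N r 0 S (fun=> 1) (fun=> 1) r0 mS.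
rewrite sum_one_card integral_cst// mul1e; apply => //.
- by move=> z i Sz; rewrite addr0; split; apply: le_lt_trans (SN z i Sz); [exact: normr_Re|exact: normr_Im].
- by move=> z _ m _; rewrite big1.
Qed.

Lemma row_form_bound v i : rnorm (row_form A v i) <= n%:R * (rnorm (row i A) * rnorm v).
Proof. exact: rnorm_pairing. Qed.

Lemma row_form_bounded (M : R) : exists N : nat, forall v i, rnorm v <= M -> rnorm (row_form A v i) < N%:R.
Proof.
pose K := \sum_i n%:R * (rnorm (row i A) * `|M|).
have K0 : 0 <= K by apply: sumr_ge0 => i _; rewrite !mulr_ge0// rnorm_ge0.
exists (Num.bound K) => v i vM; apply: le_lt_trans (archi_boundP K0).
apply: le_trans (row_form_bound _ _) _; rewrite /K (bigD1 i)//=.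
apply: (@le_trans _ _ (n%:R * (rnorm (row i A) * `|M|))).
  rewrite !ler_wpM2l ?rnorm_ge0//; exact: le_trans vM (ler_norm _).
by rewrite lerDl sumr_ge0// => j _; rewrite !mulr_ge0// rnorm_ge0.
Qed.

Lemma row_form_inj_bounded : exists2 K : R, 0 < K & forall v r, (forall i, rnorm (row_form A v i) <= r) -> forall j, rnorm (v ord0 j) <= K * r.
Proof.
have uA : A^T \in unitmx by rewrite unitmx_tr unitmxE unitfE.
pose B := invmx A^T.
pose K := 1 + \sum_i \sum_j rnorm (B i j).
have K0 : 0 < K by rewrite ltr_pwDl// sumr_ge0// => i _; rewrite sumr_ge0// => j _; exact: rnorm_ge0.
exists K => // v r vr j.
have n0 : 0 <= r by apply: le_trans (rnorm_ge0 _) (vr j).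
have -> : v ord0 j = \sum_i row_form A v i * B i j.
  rewrite -{1}(mulmxK uA v) mxE; apply: eq_bigr => i _; congr (_ * _).
  by rewrite mxE; apply: eq_bigr => k _; rewrite !mxE mulrC.
apply: le_trans (rnorm_sum _ _ _) _.
apply: (@le_trans _ _ (\sum_i r * rnorm (B i j))).
  by apply: ler_sum => i _; rewrite rnormM ler_wpM2r ?rnorm_ge0.
rewrite -mulr_sumr mulrC ler_wpM2r// /K.
have : \sum_i rnorm (B i j) <= \sum_i \sum_j rnorm (B i j).
  apply: ler_sum => i _; rewrite (bigD1 j)//= lerDl sumr_ge0// => k _; exact: rnorm_ge0.
lra.
Qed.

Lemma cell0_le v r i : cell0 A r v -> rnorm (row_form A v i) <= 2 * r.
Proof.
move=> /(_ i); rewrite subr0 => -[/andP[a b] /andP[c d]].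
apply: le_trans (rnorm_le_ReIm _) _; rewrite (ger0_norm a) (ger0_norm c); lra.
Qed.

Lemma cell0_fin r : (mu (cell0 A r) < +oo)%E.
Proof.
have [K K0 KP] := row_form_inj_bounded.
have M0 : 0 < K * (2 * `|r|) + 1 by rewrite ltr_wpDl// !mulr_ge0// ltW.
apply: le_lt_trans (lebesgueC_cboxC n M0).2; apply: le_measure; rewrite ?inE.
- exact: measurable_cell.
- exact: measurable_cboxC.
- move=> v vr j; have h : rnorm (v ord0 j) <= K * (2 * `|r|).
    apply: KP => i; apply: le_trans (cell0_le i vr) _.
    by rewrite ler_wpM2l// ler_norm.
  by split; [apply: le_trans (normr_Re _) _|apply: le_trans (normr_Im _) _]; lra.
Qed.

(** A box of positive measure is covered by finitely many translates of the cell. *)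
Lemma cell0_gt0 r : 0 < r -> (0 < mu (cell0 A r))%E.
Proof.
move=> r0; rewrite lt0e measure_ge0 andbT; apply/eqP => h0.
have [N NP] := row_form_bounded 2.
have [N' N'P] : exists N' : nat, N%:R <= N'%:R * r.
  (* If the cell had measure 0, so would the box. *)
  have := @archi_boundP R (N%:R / r); set N' := Num.bound _ => h; exists N'.
  by rewrite -ler_pdivrMr// ltW// h// divr_ge0// ltW.
have := @cover_measure N' r (cboxC 1) r0 (@measurable_cboxC R n 1).
rewrite h0 mule0 => h.
have [+ _] := lebesgueC_cboxC n (@ltr01 R); rewrite ltNge => /negP; apply; apply: h.
move=> z i z1; apply: lt_le_trans N'P; apply: NP.
have r3 : 0 < (2 : R) + 0 + 1 by lra.
apply/ler_addgt0Pr => e e0; apply/ltW/rnorm_lt_coord; first lra.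
move=> j; have [a b] := z1 j; apply: le_lt_trans (rnorm_le_ReIm _) _; lra.
Qed.

Definition polydisc (d : R) : set V := [set v | forall i, rnorm (row_form A v i) <= d].

Lemma measurable_polydisc d : measurable (polydisc d : set (borelC n)).
Proof.
apply: measurable_closed; apply: closed_forall => i; apply: closed_real_le => v.
by apply: (@continuous_comp _ _ _ (fun v => row_form A v i)); [exact: row_form_continuous|exact: continuous_rnorm].
Qed.

Lemma polydisc_upper d : d < 1 -> (mu (polydisc d) <= ((4 ^+ n)%:E * mu (cell0 A 1)))%E.
Proof.
move=> d1; have := @cover_measure 1 1 (polydisc d) ltr01 (measurable_polydisc d).
apply => z i zi; rewrite mulr1; exact: le_lt_trans (zi i) d1.
Qed.

(** Each factor is bounded by 1 where the form has real part at most 1, and the exponent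
makes its modulus squared integrable over that half-plane. *)
Definition test_fun (w z : V) : C := \prod_i (2 - row_form A (z - w) i) ^- 2.

Lemma test_fun_differentiable w z : (forall i, 2 - row_form A (z - w) i != 0) -> differentiable (test_fun w : V -> C) z.
Proof.
move=> nz.
suff h (s : seq 'I_n) : differentiable (fun z : V => \prod_(i <- s) (2 - row_form A (z - w) i) ^- 2 : C) z.
  by have := h (index_enum _).
have dsub : differentiable (fun z : V => z - w) z.
  by apply: differentiableB; [exact: ex_diff|exact: differentiable_cst].
elim: s => [|i s IH].
  by under eq_fun do rewrite big_nil; exact: differentiable_cst.
under eq_fun do rewrite big_cons.
have d1 : differentiable (fun z : V => 2 - row_form A (z - w) i : C) z.
  apply: differentiableB; first exact: differentiable_cst.
  by apply: (@differentiable_comp _ _ _ _ (fun z : V => z - w)); [exact: dsub|exact: pairing_differentiable].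
have d2 : differentiable (fun z : V => (2 - row_form A (z - w) i) ^+ 2 : C) z.
  exact: (differentiableM d1 d1).
have d3 : differentiable (fun z : V => (2 - row_form A (z - w) i) ^- 2 : C) z.
  by apply: (differentiableV d2); rewrite expf_neq0.
exact: (differentiableM d3 IH).
Qed.

Lemma rnormV (x : C) : rnorm x^-1 = (rnorm x)^-1.
Proof. by rewrite !rnorm_normc ComplexField.Normc.normcV. Qed.

Lemma rnorm_test_fun w z : rnorm (test_fun w z) = \prod_i (rnorm (2 - row_form A (z - w) i) ^+ 2)^-1.
Proof. by rewrite rnorm_prod; apply: eq_bigr => i _; rewrite rnormV !expr2 rnormM. Qed.

Lemma two_sub_bound (x : C) : complex.Re x <= 1 -> 1 <= rnorm (2 - x).
Proof.
move=> x1; apply: le_trans (normr_Re _); rewrite ler_normr.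
have -> : complex.Re (2 - x) = 2 - complex.Re x by case: (x).
by apply/orP; left; lra.
Qed.

Lemma test_fun_differentiable_half w z : (forall i, complex.Re (row_form A (z - w) i) <= 1) ->
  differentiable (test_fun w : V -> C) z.
Proof.
move=> h; apply: test_fun_differentiable => i.
by rewrite -rnorm_eq0 gt_eqF//; apply: lt_le_trans (two_sub_bound (h i)).
Qed.

Lemma test_fun_lower w z d : (forall i, rnorm (row_form A (z - w) i) <= d) -> d <= 1 -> (9 ^+ n)^-1 <= rnorm (test_fun w z).
Proof.
move=> h d1; rewrite rnorm_test_fun -exprVn -[n in leLHS]card_ord -prodr_const.
apply: ler_prod => i _; rewrite invr_ge0 ler0n/=.
have q : 1 <= rnorm (2 - row_form A (z - w) i).
  apply: two_sub_bound; apply: le_trans (ler_norm _) _; apply: le_trans (normr_Re _) _.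
  exact: le_trans (h i) d1.
rewrite lef_pV2 ?posrE ?exprn_gt0//; last exact: lt_le_trans q.
rewrite -[leRHS](_ : 3 ^+ 2 = 9); last by ring.
rewrite lerXn2r ?nnegrE ?rnorm_ge0//.
apply: le_trans (rnormD _ _) _; rewrite rnormN.
have -> : rnorm (2 : C) = 2 by have := rnorm_real (2 : R); rewrite ger0_norm// rmorph_nat.
by have := le_trans (h i) d1; lra.
Qed.

(** With X = 2 - Re and y = Im of a form, |2 - form|^(-4) is at most
X^(-2) (1 + y^2)^(-1), because X >= 1; this is a product of summable functions of the cell.
Each coordinate contributes a product of two sums of inverse squares, and so a factor that
does not depend on the size of Omega. *)
Lemma test_integral (Omega : set V) (M : R) (w : V) : open Omega ->
  (forall z, Omega z -> rnorm (z - w) <= M) ->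
  (forall z i, Omega z -> complex.Re (row_form A (z - w) i) <= 1) ->
  (\int[mu]_(z in Omega) (rnorm (test_fun w z) ^+ 2)%:E <= (128 ^+ n)%:E * mu (cell0 A 1))%E.
Proof.
move=> oO OM O1; have [N NP] := row_form_bounded M.
pose F (p : 'I_N * bool) : R := 4 / p.1.+1%:R ^+ 2.
pose G (p : 'I_N * bool) : R := 2 / p.1.+1%:R ^+ 2.
have F0 p : 0 <= F p by rewrite divr_ge0.
have G0 p : 0 <= G p by rewrite divr_ge0.
have mO := measurable_open oO.
apply: le_trans (@cover_cells R n A dA N 1 (- w) Omega _ (fun j => F j.1 * G j.2) ltr01 mO _ _ _ _ _) _.
- apply: (@open_cont_measurable _ (fun z => rnorm (test_fun w z) ^+ 2)) => // z Oz.
  have c1 : {for z, continuous (fun z => rnorm (test_fun w z) : R)}.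
    apply: (@continuous_comp _ _ _ (test_fun w)); last exact: continuous_rnorm.
    apply: differentiable_continuous; apply: test_fun_differentiable_half => i; exact: O1.
  exact: (@continuousM R _ _ _ z c1 c1).
- by move=> z _; rewrite exprn_ge0// rnorm_ge0.
- by move=> j; rewrite mulr_ge0.
- move=> z i Oz; rewrite mulr1; have h := NP _ i (OM z Oz).
  by split; apply: le_lt_trans h; [exact: normr_Re|exact: normr_Im].
- move=> z Oz m zm; rewrite rnorm_test_fun -prodrXl.
  apply: ler_prod => i _; rewrite exprn_ge0 ?invr_ge0 ?exprn_ge0 ?rnorm_ge0//=.
  have x1 := O1 z i Oz; have := zm i; set x := row_form A (z - w) i in x1 *.
  rewrite !raddfB/= !mul1r => -[/andP[a1 a2] /andP[b1 b2]].
  have q : 1 <= 2 - complex.Re x by lra.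
  have -> : rnorm (2 - x) ^+ 2 = (2 - complex.Re x) ^+ 2 + complex.Im x ^+ 2.
    rewrite rnorm_normc; case: (x) => u v /=.
    by rewrite sqr_sqrtr ?addr_ge0 ?sqr_ge0//; congr (_ + _); ring.
  set X := 2 - complex.Re x in q *; set y := complex.Im x in b1 b2 *.
  rewrite /F /G; move: a1 a2 b1 b2; case: (m i) => -[a sa] [b sb]; rewrite /unit_left/=.
  rewrite -(natr1 a) -(natr1 b); set ar : R := a%:R; set br : R := b%:R => a1 a2 b1 b2.
  have a0 : 0 <= ar by exact: ler0n.
  have b0 : 0 <= br by exact: ler0n.
  have hX : (ar + 1) / 2 <= X by move: a1 a2; rewrite /X; case: sa => a1 a2; lra.
  have hy : br ^+ 2 <= y ^+ 2.
    by case: sb b1 b2 => b1 b2; [|rewrite -[leRHS]sqrrN]; rewrite lerXn2r ?nnegrE//; lra.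
  have hX2 : (ar + 1) ^+ 2 / 4 <= X ^+ 2.
    have -> : (ar + 1) ^+ 2 / 4 = ((ar + 1) / 2) ^+ 2 by field.
    by rewrite lerXn2r ?nnegrE//; lra.
  have hy2 : (br + 1) ^+ 2 / 2 <= 1 + y ^+ 2 by have := sqr_ge0 (br - 1); lra.
  (* Since X >= 1, the left side is at most X^4 + X^2 y^2. *)
  have XX : X ^+ 2 * (1 + y ^+ 2) <= (X ^+ 2 + y ^+ 2) ^+ 2.
    have : 1 <= X ^+ 2 by rewrite exprn_ege1.
    have := sqr_ge0 y; nra.
  have p1 : 0 < (ar + 1) ^+ 2 by rewrite exprn_gt0//; lra.
  have p2 : 0 < (br + 1) ^+ 2 by rewrite exprn_gt0//; lra.
  rewrite exprVn (_ : 4 / _ * _ = ((ar + 1) ^+ 2 / 4 * ((br + 1) ^+ 2 / 2))^-1); last first.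
    by field; rewrite !gt_eqF//; lra.
  rewrite lef_pV2 ?posrE; last 2 first.
  - by rewrite exprn_gt0// ltr_pwDl ?sqr_ge0// exprn_gt0//; lra.
  - by rewrite mulr_gt0// divr_gt0.
  by apply: le_trans XX; apply: ler_pM => //; rewrite divr_ge0// ltW.
rewrite lee_wpmul2r ?measure_ge0// lee_fin lerXn2r ?nnegrE//.
  by apply: sumr_ge0 => j _; rewrite mulr_ge0.
have -> : \sum_j F j.1 * G j.2 = (\sum_p F p) * (\sum_p G p).
  by rewrite big_distrlr/= pair_bigA.
have sE (k : R) : \sum_(p : 'I_N * bool) k / p.1.+1%:R ^+ 2 = k * (2 * \sum_(a < N) (a.+1%:R ^+ 2)^-1).
  rewrite -(pair_bigA _ (fun (a : 'I_N) (_ : bool) => k / a.+1%:R ^+ 2))/=.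
  rewrite !mulr_sumr; apply: eq_bigr => a _.
  by rewrite big_bool/=; ring.
rewrite /F /G !sE.
have S0 : 0 <= \sum_(a < N) (a.+1%:R ^+ 2)^-1 :> R.
  by apply: sumr_ge0 => a _; rewrite invr_ge0 exprn_ge0.
have := sum_inv_sqr N; set S := \sum_(a < N) _ in S0 * => S2.
have : S * S <= 2 * 2 by rewrite ler_pM.
lra.
Qed.
End rows.
End test_functions.

(** * Integrals over translates *)

Section translates.
Local Open Scope ereal_scope.
Variables (R : realType) (n : nat).
Local Notation C := R[i].
Local Notation V := 'rV[C]_n.
Local Notation TR := (measurableTypeR R).
Local Notation mu := (@lebesgueC R n).
Local Notation leb := (@lebesgue_measure R).

(** Written through real coordinates, since the Borel sets of C^n are not given as a
product. *)
Lemma measurable_path_add (p : R -> V) : continuous p ->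
  measurable_fun setT (fun x : TR * @borelC R n => (p x.1 + x.2)%R : @borelC R n).
Proof.
move=> pc.
have mcoord (g : V -> R) : continuous g -> measurable_fun setT (g : @borelC R n -> TR).
  move=> gc; apply: (@open_cont_measurable R n setT g); first exact: openT.
  by move=> z _; exact: gc.
have cR j : continuous (fun z : V => complex.Re (z ord0 j) : R).
  by move=> z; apply: (@continuous_comp _ _ _ (fun z : V => z ord0 j)); [exact: coord_continuous|exact: continuous_Re].
have cI j : continuous (fun z : V => complex.Im (z ord0 j) : R).
  by move=> z; apply: (@continuous_comp _ _ _ (fun z : V => z ord0 j)); [exact: coord_continuous|exact: continuous_Im].
pose T (x : TR * @borelC R n) : n.-tuple (TR * TR) :=
  [tuple ((complex.Re (p x.1 ord0 j) + complex.Re (x.2 ord0 j))%R : TR,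
          (complex.Im (p x.1 ord0 j) + complex.Im (x.2 ord0 j))%R : TR) | j < n].
rewrite (_ : (fun x => _) = @of_reals R n \o T); last first.
  apply/funext => x /=; apply/rowP => j; rewrite !mxE tnth_mktuple/=.
  by case: (p _ _ _) => ? ?; case: (x.2 _ _).
apply: measurableT_comp; first exact: measurable_of_reals.
apply/measurable_fun_tnthP => j.
have mp (g : V -> R) : continuous g ->
   measurable_fun setT (fun x : TR * @borelC R n => g (p x.1) : TR).
  move=> gc; apply: (@measurableT_comp _ _ _ _ _ _ (fun s : TR => g (p s) : TR)); last exact: measurable_fst.
  apply: continuous_measurable_fun => s; apply: continuous_comp; [exact: pc|exact: gc].
have mv (g : V -> R) : continuous g ->
   measurable_fun setT (fun x : TR * @borelC R n => g x.2 : TR).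
  by move=> gc; apply: (@measurableT_comp _ _ _ _ _ _ (g : @borelC R n -> TR)); [exact: mcoord|exact: measurable_snd].
apply: (eq_measurable_fun (fun x : TR * @borelC R n =>
  ((complex.Re (p x.1 ord0 j) + complex.Re (x.2 ord0 j))%R : TR,
   (complex.Im (p x.1 ord0 j) + complex.Im (x.2 ord0 j))%R : TR))).
  by move=> x _ /=; rewrite tnth_mktuple.
exact: (measurable_fun_pair (measurable_funD (mp _ (cR j)) (mv _ (cR j)))
  (measurable_funD (mp _ (cI j)) (mv _ (cI j)))).
Qed.

Section avg.
Variable (E2 : @borelC R n -> \bar R).
Hypotheses (mE2 : measurable_fun setT E2) (E20 : forall z, 0 <= E2 z).

Lemma integral_translate (x : V) : \int[mu]_v E2 (x + v)%R = \int[mu]_z E2 z.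
Proof.
have := @integral_lebesgueC_shift R n x setT E2 measurableT mE2 (fun z _ => E20 z).
by rewrite preimage_setT => <-; apply: eq_integral => z _; rewrite addrC.
Qed.

Lemma measurable_translate (x : V) : measurable_fun setT (fun v : @borelC R n => E2 (x + v)%R).
Proof.
rewrite (_ : (fun v => _) = E2 \o (fun z : @borelC R n => (z + x)%R : @borelC R n)); last first.
  by apply/funext => v /=; rewrite addrC.
by apply: measurableT_comp => //; exact: measurable_shiftC.
Qed.

Variables (p : R -> V) (d : R).
Hypotheses (pc : continuous p) (d0 : (0 <= d)%R).

Let G (x : TR * @borelC R n) : \bar R := ((fun x : TR * @borelC R n => E2 (p x.1 + x.2)%R) \_ (`[0%R, d]%classic `*` setT)) x.

Let mG : measurable_fun setT G.
Proof.
apply/(measurable_restrictT _ _).1; first by apply: measurableX => //; exact: measurable_itv.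
exact: (measurable_funTS (measurableT_comp mE2 (measurable_path_add pc))).
Qed.

Let G0 x : 0 <= G x. Proof. exact: erestrict_ge0. Qed.

Let GE v : \int[leb]_s G (s, v) = \int[leb]_(s in `[0%R, d]) E2 (p s + v)%R.
Proof.
rewrite [RHS]integral_mkcond; apply: eq_integral => s _; rewrite /G !patchE.
by congr (if _ then _ else _); apply/idP/idP; rewrite !inE/= => // -[].
Qed.

Lemma measurable_path_integral :
  measurable_fun setT (fun v : @borelC R n => \int[leb]_(s in `[0%R, d]) E2 (p s + v)%R).
Proof.
rewrite (_ : (fun v => _) = fun v => \int[leb]_s G (s, v)); last first.
  by apply/funext => v; rewrite GE.
have := @measurable_fun_fubini_tonelli_G _ _ _ _ _ leb G mG G0; apply.
Qed.

(** Tonelli, and then translation invariance for each point of the path. *)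
Lemma integral_path_translate :
  \int[mu]_v \int[leb]_(s in `[0%R, d]) E2 (p s + v)%R = d%:E * \int[mu]_z E2 z.
Proof.
under eq_integral do rewrite -GE.
rewrite -(@fubini_tonelli _ _ _ _ _ leb mu G mG G0).
transitivity (\int[leb]_(s in `[0%R, d]) (cst (\int[mu]_z E2 z) s)).
  rewrite [RHS]integral_mkcond; apply: eq_integral => s _.
  rewrite patchE; case: ifPn => sI.
    rewrite /= -(integral_translate (p s)); apply: eq_integral => v _.
    by rewrite /G patchE mem_set//; split => //=; exact: set_mem.
  rewrite (eq_integral (cst 0)) ?integral0// => v _.
  by rewrite /G patchE memNset// => -[/= sId _]; move/negP: sI; apply; exact: mem_set.
rewrite integral_cst//= lebesgue_measure_itv/= lte_fin.
by case: ltgtP d0 => //= [_|<-] _; rewrite ?sube0 ?mul0e ?mule0// muleC.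
Qed.
End avg.
End translates.

(** * Square integrals and compactness of the Hankel operator *)

Section square_norms.
Variables (R : realType) (n : nat).
Local Notation C := R[i].
Local Notation V := 'rV[C]_n.
Local Notation TR := (measurableTypeR R).
Local Notation mu := (@lebesgueC R n).

(** The square of the L^2 norm, which is easier to estimate than the norm. *)
Definition sqr_integral (D : set V) (f : V -> C) : \bar R :=
  (\int[mu]_(z in (D : set (borelC n))) (rnorm (f z) ^+ 2)%:E)%E.

Lemma L2norm_sqr (D : set V) (f : V -> C) : (L2norm D f `^ 2 = sqr_integral D f)%E.
Proof.
rewrite /L2norm (_ : (fun z => _) = (fun z => (rnorm ((f \_ D) z))%:E)); last first.
  by apply/funext => z; rewrite rnorm_normc.
rewrite poweR_Lnorm// /sqr_integral [RHS]integral_mkcond; apply: eq_integral => z _.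
rewrite abse_EFin ger0_norm ?rnorm_ge0// poweR_EFin powR_mulrn ?rnorm_ge0// !patchE.
by case: ifPn => _ //; rewrite rnorm0 expr0n.
Qed.

Lemma L2norm_le (D : set V) (f : V -> C) (K : R) : 0 <= K -> (sqr_integral D f <= (K ^+ 2)%:E)%E -> (L2norm D f <= K%:E)%E.
Proof.
move=> K0; rewrite -L2norm_sqr; have := Lnorm_ge0 mu 2%:E (fun z => (ComplexField.Normc.normc ((f \_ D) z))%:E).
rewrite -/(L2norm D f); case: (L2norm D f) => [r| |//]; last by rewrite poweRyr.
rewrite poweR_EFin !lee_fin => r0; rewrite powR_mulrn// => h.
by rewrite -ler_sqr ?nnegrE.
Qed.

Lemma sqr_integral_lt (D : set V) (f : V -> C) (K : R) : 0 <= K -> (L2norm D f < K%:E)%E -> (sqr_integral D f <= (K ^+ 2)%:E)%E.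
Proof.
move=> K0; rewrite -L2norm_sqr; have := Lnorm_ge0 mu 2%:E (fun z => (ComplexField.Normc.normc ((f \_ D) z))%:E).
rewrite -/(L2norm D f); case: (L2norm D f) => [r| |//]; last by [].
rewrite poweR_EFin !lee_fin lte_fin => r0 rK; rewrite powR_mulrn//.
by rewrite lerXn2r ?nnegrE// ltW.
Qed.

Lemma sqr_integral_fin (D : set V) (f : V -> C) : (L2norm D f < +oo)%E -> (sqr_integral D f < +oo)%E.
Proof.
have := Lnorm_ge0 mu 2%:E (fun z => (ComplexField.Normc.normc ((f \_ D) z))%:E).
rewrite -/(L2norm D f); case E : (L2norm D f) => [r| |//] // r0 _.
apply: le_lt_trans (_ : ((r + 1) ^+ 2)%:E < +oo)%E; last exact: ltry.
by apply: sqr_integral_lt; [rewrite addr_ge0// -lee_fin|rewrite E lte_fin ltrDl].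
Qed.

Lemma rnorm_sqr (z : C) : rnorm z ^+ 2 = complex.Re z ^+ 2 + complex.Im z ^+ 2.
Proof. by rewrite rnorm_normc; case: z => a b /=; rewrite sqr_sqrtr// addr_ge0 ?sqr_ge0. Qed.

Lemma cmeasurable_rnorm_sqr (D : set V) (f : V -> C) : cmeasurable_fun D f ->
  measurable_fun (D : set (borelC n)) (fun z : borelC n => (rnorm (f z) ^+ 2)%:E).
Proof.
move=> [mR mI]; apply/measurable_EFinP.
rewrite (_ : (fun z => _) = (fun z => complex.Re (f z) ^+ 2) \+ (fun z => complex.Im (f z) ^+ 2)); last first.
  by apply/funext => z /=; rewrite rnorm_sqr.
by apply: measurable_funD; exact: measurable_funX.
Qed.

Lemma cmeasurableB (D : set V) (f g : V -> C) : cmeasurable_fun D f -> cmeasurable_fun D g ->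
  cmeasurable_fun D (f - g).
Proof.
move=> [fR fI] [gR gI]; split.
  rewrite (_ : (fun z => _) = (fun z => complex.Re (f z)) \- (fun z => complex.Re (g z))); last first.
    by apply/funext => z /=; rewrite raddfB.
  exact: measurable_funB.
rewrite (_ : (fun z => _) = (fun z => complex.Im (f z)) \- (fun z => complex.Im (g z))); last first.
  by apply/funext => z /=; rewrite raddfB.
exact: measurable_funB.
Qed.

Lemma open_cont_cmeasurable (D : set V) (f : V -> C) : open D ->
  (forall z, D z -> {for z, continuous f}) -> cmeasurable_fun D f.
Proof.
move=> oD fc; split; apply: open_cont_measurable => // z Dz; apply: (@continuous_comp _ _ _ f);
  by [exact: fc|exact: continuous_Re|exact: continuous_Im].
Qed.

Lemma cmeasurable_sub (D E : set V) (f : V -> C) : measurable (D : set (borelC n)) -> E `<=` D ->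
  cmeasurable_fun D f -> cmeasurable_fun E f.
Proof. by move=> mD ED [fR fI]; split; [exact: measurable_funS fR|exact: measurable_funS fI]. Qed.

(** Dominated convergence: h is fixed and the sets leave every point. *)
Lemma sqr_integral_tail (D : set V) (h : V -> C) (E : nat -> set V) : measurable (D : set (borelC n)) ->
  L2 D h -> (forall k, measurable (E k : set (borelC n))) -> (forall k, E k `<=` D) ->
  (forall z, D z -> \forall k \near \oo, ~ E k z) ->
  (sqr_integral (E k) h @[k --> \oo] --> 0)%E.
Proof.
move=> mD [mh hfin] mE ED Ez.
have mh2 := cmeasurable_rnorm_sqr mh.
pose f_ k (z : borelC n) := ((rnorm (h z) ^+ 2 * \1_(E k : set (borelC n)) z)%:E : \bar R).
have mf k : measurable_fun (D : set (borelC n)) (f_ k).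
  apply/measurable_EFinP; apply: measurable_funM; first by apply/measurable_EFinP.
  by apply: measurable_funTS; exact: measurable_indic.
have [] := @dominated_convergence _ _ _ mu D mD f_ (cst 0%E) (fun z => (rnorm (h z) ^+ 2)%:E) mf.
- exact: measurable_cst.
- apply: aeW => z Dz; apply: (@cvg_near_cst); have := Ez z Dz.
  apply: filterS => k nE; rewrite /f_ indicE memNset// mulr0//.
- apply/integrableP; split => //; have := sqr_integral_fin hfin; congr (_ < _)%E.
  by apply: eq_integral => z _; rewrite /= ger0_norm// exprn_ge0// rnorm_ge0.
- apply: aeW => z k Dz; rewrite /f_ abse_EFin lee_fin normrM ger0_norm ?exprn_ge0 ?rnorm_ge0//.
  rewrite ler_piMr ?exprn_ge0 ?rnorm_ge0// indicE; by case: (_ \in _); rewrite ?normr1 ?normr0.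
move=> _ _; rewrite integral0 => H; apply: cvg_trans H; apply: near_eq_cvg; apply: nearW => k.
have DE : E k = D `&` E k.
  by apply/seteqP; split => z; [move=> Ekz; split; [exact: (ED k z Ekz)|exact: Ekz]|case].
transitivity (\int[mu]_(z in D `&` E k) (rnorm (h z) ^+ 2)%:E)%E; last by rewrite -DE.
apply/esym.
rewrite integral_mkcondr; apply: eq_integral => z _.
by rewrite /f_ patchE indicE; case: ifP => _; rewrite ?mulr1 ?mulr0.
Qed.
End square_norms.

Section hankel_compactness.
Variables (R : realType) (n : nat).
Local Notation C := R[i].
Local Notation V := 'rV[C]_n.
Local Notation TR := (measurableTypeR R).
Local Notation mu := (@lebesgueC R n).

(** The default value of the projection is 0, so the statement holds whether or not
the projection exists. *)
Lemma bergman_proj_holomorphic (D : set V) (f : V -> C) : holomorphic_on D (bergman_proj D f).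
Proof.
rewrite /bergman_proj; case: xgetP => [g _ [[hg _] _]|_]; first exact: hg.
by move=> z _; exact: differentiable_cst.
Qed.

Lemma rnorm_sqrD (a b : C) : rnorm (a + b) ^+ 2 <= 2 * rnorm a ^+ 2 + 2 * rnorm b ^+ 2.
Proof.
have h := rnormD a b; have := sqr_ge0 (rnorm a - rnorm b).
have : rnorm (a + b) ^+ 2 <= (rnorm a + rnorm b) ^+ 2 by rewrite lerXn2r ?nnegrE ?addr_ge0 ?rnorm_ge0.
by lra.
Qed.

Lemma sqr_integral_le (D E : set V) (f a b : V -> C) : measurable (D : set (borelC n)) -> measurable (E : set (borelC n)) -> E `<=` D ->
  cmeasurable_fun D f -> cmeasurable_fun D a -> cmeasurable_fun D b ->
  (forall z, D z -> f z = a z + b z) -> (sqr_integral E f <= 2%:E * sqr_integral D a + 2%:E * sqr_integral E b)%E.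
Proof.
move=> mD mE ED mf ma mb fab.
have mfE := cmeasurable_rnorm_sqr (cmeasurable_sub mD ED mf).
have maD := cmeasurable_rnorm_sqr ma.
have maE := cmeasurable_rnorm_sqr (cmeasurable_sub mD ED ma).
have mbE := cmeasurable_rnorm_sqr (cmeasurable_sub mD ED mb).
have p0 (g : V -> C) (z : borelC n) : (0 <= (rnorm (g z) ^+ 2)%:E)%E by rewrite lee_fin exprn_ge0// rnorm_ge0.
apply: (@le_trans _ _ (2%:E * sqr_integral E a + 2%:E * sqr_integral E b)%E); last first.
  rewrite leeD2r// lee_pmul2l//; apply: ge0_subset_integral => //.
rewrite /sqr_integral -!ge0_integralZl_EFin// -ge0_integralD//; last 4 first.
- by move=> z _; rewrite mule_ge0.
- exact: measurable_funeM.
- by move=> z _; rewrite mule_ge0.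
- exact: measurable_funeM.
apply: ge0_le_integral => //.
- by apply: emeasurable_funD; exact: measurable_funeM.
- by move=> z Ez; rewrite -!EFinM -EFinD lee_fin fab ?rnorm_sqrD//; exact: ED.
Qed.

(** Along a subsequence phi g_k - P (phi g_k) converges in L^2 to a fixed h.  Since the sets
E_k leave every point, the square integral of h over E_k tends to 0, and with it that of
phi g_k - P (phi g_k). *)
Lemma hankel_small (Omega : set V) (phi : V -> C) (g : nat -> V -> C) (E : nat -> set V) (K : R) :
  open Omega -> (forall z, Omega z -> {for z, continuous phi}) ->
  compact_operator Omega (hankel Omega phi) ->
  (forall k, holomorphic_on Omega (g k)) -> 0 <= K -> (forall k, sqr_integral Omega (g k) <= (K ^+ 2)%:E)%E ->
  (forall k, measurable (E k : set (borelC n))) -> (forall k, E k `<=` Omega) ->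
  (forall z, Omega z -> \forall k \near \oo, ~ E k z) ->
  forall (e : R) (N : nat), 0 < e -> exists k (h : V -> C),
    [/\ (N <= k)%N, holomorphic_on Omega h & (sqr_integral (E k) (phi * g k - h)%R <= e%:E)%E].
Proof.
move=> oO phic comp gh K0 gK mE EO Enear e N e0.
have mO := measurable_open oO.
have hc (f : V -> C) : holomorphic_on Omega f -> forall z, Omega z -> {for z, continuous f}.
  by move=> fh z Oz; apply: differentiable_continuous; exact: fh.
have gA k : A2 Omega (g k).
  split; first exact: gh.
  split; first exact: (open_cont_cmeasurable oO (hc (g k) (gh k))).
  by apply: le_lt_trans (L2norm_le K0 (gK k)) _; rewrite ltry.
have [|s [h [sinc hL2 sh]]] := comp g gA.
  by exists K => k; apply: L2norm_le.
have sk k : (k <= s k)%N.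
  by elim: k => // k IH; apply: leq_ltn_trans IH _; apply: sinc.
have tail : (sqr_integral (E (s k)) h @[k --> \oo] --> 0)%E.
  apply: (@sqr_integral_tail R n Omega h (fun k => E (s k)) mO hL2 (fun k => mE _) (fun k => EO _)) => z Oz; have [M _ MP] := Enear z Oz.
  by exists M => // k Mk; apply: MP; rewrite /= (leq_trans Mk).
pose d := Num.sqrt (e / 4); have d0 : 0 < d by rewrite sqrtr_gt0 divr_gt0.
have dd : d ^+ 2 = e / 4 by rewrite sqr_sqrtr// divr_ge0// ltW.
have n1 : \forall k \near \oo, (L2norm Omega (hankel Omega phi (g (s k)) - h)%R < d%:E)%E.
  by apply: (sh [set y | (y < d%:E)%E]); apply: open_ereal_lt'; rewrite lte_fin.
have n2 : \forall k \near \oo, (sqr_integral (E (s k)) h < (e / 4)%:E)%E.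
  by apply: (tail [set y | (y < (e / 4)%:E)%E]); apply: open_ereal_lt'; rewrite lte_fin divr_gt0.
have [k [k1 k2 k3]] : exists k, [/\ (N <= k)%N, (L2norm Omega (hankel Omega phi (g (s k)) - h)%R < d%:E)%E & (sqr_integral (E (s k)) h < (e / 4)%:E)%E].
  have [k kP] := @filter_ex _ _ _ _ (filterI n1 (filterI n2 (nbhs_infty_ge N))).
  by exists k; case: kP => ? [? ?].
exists (s k), (bergman_proj Omega (phi * g (s k))); split.
- exact: leq_trans (sk k).
- exact: bergman_proj_holomorphic.
set T := hankel Omega phi (g (s k)) in k2.
have cT : cmeasurable_fun Omega T.
  apply: (open_cont_cmeasurable oO) => z Oz.
  apply: (@continuousB C C^o V (fun z => phi z * g (s k) z) (bergman_proj Omega (phi * g (s k)))).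
    by apply: (@continuousM C V); [exact: phic|exact: (hc _ (gh (s k)) z Oz)].
  exact: (hc _ (bergman_proj_holomorphic _) z Oz).
have [ch _] := hL2.
have H := @sqr_integral_le Omega (E (s k)) T (T - h) h mO (mE _) (EO _) cT (cmeasurableB cT ch) ch.
apply: le_trans (H _) _ => [z Oz|].
  exact: (esym (subrK (h z) (T z))).
have h1 := sqr_integral_lt (ltW d0) k2; rewrite dd in h1.
apply: (@le_trans _ _ (2%:E * (e / 4)%:E + 2%:E * (e / 4)%:E)%E).
  by apply: leeD; rewrite lee_pmul2l// ltW.
by rewrite -!EFinM -EFinD lee_fin; lra.
Qed.
End hankel_compactness.

(** * The Cauchy defect in the mean *)

Section square_edges_mean.
Variables (R : realType).
Local Notation C := R[i].
Local Notation leb := (@lebesgue_measure R).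

Definition edge_path (p : C) (d : R) (j : 'I_4) (s : R) : C :=
  match val j with
  | 0 => p + s%:C
  | 1 => p + 'i * d%:C + s%:C
  | 2 => p + d%:C + 'i * s%:C
  | _ => p + 'i * s%:C
  end.

Lemma edge_path_edge p d j s : 0 <= s <= d -> edge p d (edge_path p d j s).
Proof.
move=> /edgeP => /(_ p)[h1 h2 h3 h4].
by case: j => -[|[|[|[|//]]]] /= ?; rewrite /edge_path/=.
Qed.

Lemma edge_path_continuous p d j : continuous (edge_path p d j).
Proof.
have c1 (x : C) : continuous (fun s : R => x + s%:C : C).
  move=> s; have h : {for s, continuous (fun s : R => s%:C : C)} := @continuous_real_complex R s.
  exact: (@continuousD C C^o R (fun=> x) (fun s => s%:C) s (@cst_continuous R C x s) h).
have c2 (x : C) : continuous (fun s : R => x + 'i * s%:C : C).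
  move=> s; have h : {for s, continuous (fun s : R => s%:C : C)} := @continuous_real_complex R s.
  have h' := @continuousM C R (fun=> 'i) (fun s : R => s%:C) s (@cst_continuous R C 'i s) h.
  exact: (@continuousD C C^o R (fun=> x) (fun s => 'i * s%:C) s (@cst_continuous R C x s) h').
by case: j => -[|[|[|[|//]]]] /= ? s; rewrite /edge_path/=; [exact: c1|exact: c1|exact: c2|exact: c2].
Qed.

Lemma rnorm_side_sum (G : C -> C) p d s : rnorm (side_sum G p d s) <= \sum_(j < 4) rnorm (G (edge_path p d j s)).
Proof.
rewrite !big_ord_recl big_ord0 addr0 /edge_path/= /side_sum.
apply: le_trans (rnormD _ _) _; rewrite rnormN rnormM rnormi mul1r !addrA lerD2r.
apply: le_trans (rnormD _ _) _; rewrite rnormM rnormi mul1r lerD2r.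
by apply: le_trans (rnormD _ _) _; rewrite rnormN.
Qed.

Lemma le_add_sqr_div (x t : R) : 0 < t -> x <= t + x ^+ 2 / t.
Proof.
move=> t0; rewrite -(ler_pM2r t0) mulrDl divfK ?gt_eqF//.
have := sqr_ge0 (x - t / 2); have := sqr_ge0 t; nra.
Qed.

(** The integrand is at most 2 / r times |D|, and |D| <= t + |D|^2 / t: a bound by the mean
of |D|^2, which can be averaged, at the cost of a small constant. *)
Lemma cauchy_integral_young (D : C -> C) (r t : R) (w : C) : 0 < r -> 0 < t ->
  cont_on (edge (corner r) (r + r)) D -> rnorm w <= r / 2 ->
  ((rnorm (cauchy_integral D r w))%:E <= (32 * t)%:E + (4 / (r * t))%:E *
    \sum_(j < 4) \int[leb]_(s in `[0%R, (r + r)%R]) (rnorm (D (edge_path (corner r) (r + r)%R j s)) ^+ 2)%:E)%E.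
Proof.
move=> r0 t0 Dc wr.
have Gc : cont_on (edge (corner r) (r + r)) (fun z => D z / (z - w)).
  move=> z zE; apply: cont_div; first exact: Dc.
    by apply: differentiable_continuous; exact: differentiable_subr.
  have h := edge_far r0 wr zE; rewrite -rnorm_eq0 gt_eqF//; apply: lt_le_trans h; exact: divr_gt0.
have bc := ccont_side_sum Gc.
have mI : measurable (`[0%R, (r + r)%R]%classic : set (measurableTypeR R)) by exact: measurable_itv.
have qc j : rcont (r + r) (fun s => rnorm (D (edge_path (corner r) (r + r) j s)) ^+ 2).
  move=> s sr.
  have c1 : {for s, continuous (fun s => rnorm (D (edge_path (corner r) (r + r) j s)) : R)}.
    apply: (@continuous_comp _ _ _ (fun s => D (edge_path (corner r) (r + r) j s))); last exact: continuous_rnorm.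
    apply: (@continuous_comp _ _ _ (edge_path (corner r) (r + r) j)); first exact: edge_path_continuous.
    by apply: Dc; exact: edge_path_edge.
  exact: (@continuousM R _ _ _ s c1 c1).
have mq j : measurable_fun (`[0%R, (r + r)%R]%classic : set (measurableTypeR R))
    (fun s => (rnorm (D (edge_path (corner r) (r + r) j s)) ^+ 2)%:E).
  by have /integrableP[] := rcont_integrable (qc j).
apply: (@le_trans _ _ (2%:E * \int[leb]_(s in `[0%R, (r + r)%R]) (rnorm (side_sum (fun z => D z / (z - w)) (corner r) (r + r)%R s))%:E)%E).
  have iN := rcont_integrable (ccont_rnorm bc).
  rewrite -[X in (2%:E * X)%E]fineK; last exact: integrable_fin_num.
  by rewrite -EFinM lee_fin; exact: rnorm_cint.
apply: (@le_trans _ _ (2%:E * \int[leb]_(s in `[0%R, (r + r)%R])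
   ((8 * t / r)%:E + (2 / (r * t))%:E * \sum_(j < 4) (rnorm (D (edge_path (corner r) (r + r)%R j s)) ^+ 2)%:E))%E).
  rewrite lee_pmul2l//; apply: ge0_le_integral => //.
  - by move=> s _; rewrite lee_fin rnorm_ge0.
  - by have /integrableP[] := rcont_integrable (ccont_rnorm bc).
  - by apply: emeasurable_funD => //; apply: measurable_funeM; apply: emeasurable_sum.
  - move=> s /=; rewrite in_itv/= => sr; rewrite sumEFin -EFinM -EFinD lee_fin.
    apply: le_trans (rnorm_side_sum _ _ _ _) _.
    have -> : 8 * t / r + 2 / (r * t) * \sum_(j < 4) rnorm (D (edge_path (corner r) (r + r) j s)) ^+ 2 =
      \sum_(j < 4) (2 * t / r + 2 / (r * t) * rnorm (D (edge_path (corner r) (r + r) j s)) ^+ 2).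
      rewrite big_split/= mulr_sumr; congr (_ + _).
      by rewrite sumr_const card_ord -mulr_natl; field; rewrite gt_eqF.
        apply: ler_sum => j _; have zE := edge_path_edge (corner r) j sr.
    set z := edge_path _ _ _ _ in zE *; set x := rnorm (D z).
    have far := edge_far r0 wr zE.
    have far0 : 0 < rnorm (z - w) by apply: lt_le_trans far; exact: divr_gt0.
    have -> : rnorm (D z / (z - w)) = x / rnorm (z - w) by rewrite rnormM rnormV.
    rewrite ler_pdivrMr//.
    apply: (@le_trans _ _ ((2 * t / r + 2 / (r * t) * x ^+ 2) * (r / 2))).
      have -> : (2 * t / r + 2 / (r * t) * x ^+ 2) * (r / 2) = t + x ^+ 2 / t.
        by field; rewrite !gt_eqF.
      exact: le_add_sqr_div.
    apply: ler_wpM2l => //; apply: addr_ge0.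
      exact: divr_ge0 (mulr_ge0 (ler0n _ 2) (ltW t0)) (ltW r0).
    apply: mulr_ge0; first exact: divr_ge0 (ler0n _ 2) (mulr_ge0 (ltW r0) (ltW t0)).
    by rewrite exprn_ge0// rnorm_ge0.
have t8 : 0 <= 8 * t / r := divr_ge0 (mulr_ge0 (ler0n _ 8) (ltW t0)) (ltW r0).
have t2 : 0 <= 2 / (r * t) := divr_ge0 (ler0n _ 2) (mulr_ge0 (ltW r0) (ltW t0)).
have q0 j s : (0 <= (rnorm (D (edge_path (corner r) (r + r)%R j s)) ^+ 2)%:E)%E by rewrite lee_fin exprn_ge0// rnorm_ge0.
rewrite ge0_integralD//; last 2 first.
- by move=> s _; rewrite mule_ge0 ?lee_fin// sume_ge0.
- by apply: measurable_funeM; apply: emeasurable_sum.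
rewrite ge0_integralZl_EFin//; last 2 first.
- by move=> s _; rewrite sume_ge0.
- by apply: emeasurable_sum.
rewrite ge0_integral_sum// integral_cst//= lebesgue_measure_itv/= lte_fin addr_gt0// oppr0 adde0.
set S := (\sum_(j < 4) _)%E.
have S0 : (0 <= S)%E by apply: sume_ge0 => j _; apply: integral_ge0 => s _.
rewrite ge0_muleDr; last 2 first.
- by rewrite mule_ge0 ?lee_fin// addr_ge0// ltW.
- by rewrite mule_ge0 ?lee_fin.
rewrite (_ : (2%:E * ((8 * t / r)%:E * (r + r)%:E))%E = (32 * t)%:E); last first.
  by rewrite -!EFinM; congr EFin; field; rewrite gt_eqF.
rewrite (_ : (2%:E * ((2 / (r * t))%:E * S))%E = ((4 / (r * t))%:E * S)%E)//.
rewrite muleA -EFinM; congr (EFin _ * _)%E; field.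
by rewrite !gt_eqF.
Qed.
End square_edges_mean.

Section mean_bound.
Variables (R : realType) (n : nat).
Local Notation C := R[i].
Local Notation V := 'rV[C]_n.
Local Notation mu := (@lebesgueC R n).
Local Notation leb := (@lebesgue_measure R).

(** A pointwise bound for all v in S, integrated over S; the right-hand side only grows when
the integral is extended to all v. *)
Lemma averaging (E2 : @borelC R n -> \bar R) (S : set V) (x0 : V) (p : 'I_4 -> R -> V) (d c L : R) :
  measurable_fun setT E2 -> (forall z, 0 <= E2 z)%E -> measurable (S : set (@borelC R n)) ->
  (forall j, continuous (p j)) -> 0 <= d -> 0 <= c -> 0 <= L ->
  (forall v, S v -> c%:E <= L%:E * (E2 (x0 + v)%R + \sum_(j < 4) \int[leb]_(s in `[0%R, d]) E2 (p j s + v)%R))%E ->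
  (c%:E * mu S <= L%:E * ((1 + 4 * d)%:E * \int[mu]_z E2 z))%E.
Proof.
move=> mE2 E20 mS pc d0 c0 L0 H.
have mX : measurable_fun setT (fun v : @borelC R n => E2 (x0 + v)%R) := measurable_translate mE2 x0.
have mP j : measurable_fun setT (fun v : @borelC R n => \int[leb]_(s in `[0%R, d]) E2 (p j s + v)%R)%E.
  exact: measurable_path_integral.
have P0 j v : (0 <= \int[leb]_(s in `[0%R, d]) E2 (p j s + v)%R)%E by exact: integral_ge0.
have mQ : measurable_fun setT (fun v : @borelC R n => \sum_(j < 4) \int[leb]_(s in `[0%R, d]) E2 (p j s + v)%R)%E.
  by apply: emeasurable_sum => j; exact: mP.
have mT : measurable_fun setT (fun v : @borelC R n =>
   E2 (x0 + v)%R + \sum_(j < 4) \int[leb]_(s in `[0%R, d]) E2 (p j s + v)%R)%E by exact: emeasurable_funD.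
have Q0 v : (0 <= \sum_(j < 4) \int[leb]_(s in `[0%R, d]) E2 (p j s + v)%R)%E by apply: sume_ge0.
have T0 v : (0 <= E2 (x0 + v)%R + \sum_(j < 4) \int[leb]_(s in `[0%R, d]) E2 (p j s + v)%R)%E by exact: adde_ge0.
rewrite -integral_cst//.
apply: (@le_trans _ _ (\int[mu]_(v in (S : set (@borelC R n))) (L%:E * (E2 (x0 + v)%R + \sum_(j < 4) \int[leb]_(s in `[0%R, d]) E2 (p j s + v)%R)))%E).
  apply: ge0_le_integral => //.
  by apply: measurable_funTS; exact: measurable_funeM.
apply: (@le_trans _ _ (\int[mu]_v (L%:E * (E2 (x0 + v)%R + \sum_(j < 4) \int[leb]_(s in `[0%R, d]) E2 (p j s + v)%R)))%E).
  apply: ge0_subset_integral => //; first exact: measurable_funeM.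
  by move=> v _; rewrite mule_ge0 ?lee_fin.
rewrite ge0_integralZl_EFin//; apply: lee_wpmul2l; first by rewrite lee_fin.
rewrite ge0_integralD// ge0_integral_sum//.
rewrite (integral_translate mE2 E20).
rewrite (eq_bigr (fun=> (d%:E * \int[mu]_z E2 z)%E)); last first.
  by move=> j _; exact: integral_path_translate.
have I0 : (0 <= \int[mu]_z E2 z)%E by exact: integral_ge0.
rewrite -{1}[(\int[mu]_z E2 z)%E]mul1e.
rewrite !big_ord_recl big_ord0 adde0 -!ge0_muleDl ?lee_fin// ?addr_ge0//.
by rewrite -!EFinD (_ : 1 + (d + (d + (d + d))) = 1 + 4 * d)//; ring.
Qed.

End mean_bound.

Section pointwise_defect.
Variables (R : realType).
Local Notation C := R[i].
Local Notation leb := (@lebesgue_measure R).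

Lemma cauchy_integralD (F G : C -> C) (r : R) (w : C) : 0 < r -> rnorm w <= r / 2 ->
  cont_on (edge (corner r) (r + r)) F -> cont_on (edge (corner r) (r + r)) G ->
  cauchy_integral (fun z => F z + G z) r w = cauchy_integral F r w + cauchy_integral G r w.
Proof.
move=> r0 wr Fc Gc.
have kc H : cont_on (edge (corner r) (r + r)) H -> cont_on (edge (corner r) (r + r)) (fun z => H z / (z - w)).
  move=> Hc z zE; apply: cont_div; first exact: Hc.
    by apply: differentiable_continuous; exact: differentiable_subr.
  have h := edge_far r0 wr zE; rewrite -rnorm_eq0 gt_eqF//; apply: lt_le_trans h; exact: divr_gt0.
rewrite /cauchy_integral -contourD; [|exact: kc|exact: kc].
by apply: eq_contour => z _; rewrite mulrDl.
Qed.

(** Split psi = (psi - Psi) + (Psi - U) + U.  The holomorphic part U has no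
defect, the first part is bounded by b, and the second one is estimated in the mean by
[cauchy_integral_young]. *)
Lemma defect_pointwise (psi Psi U : C -> C) (r t b : R) (w : C) :
  0 < r -> 0 < t -> rnorm w <= r / 2 ->
  cont_on (square (corner r) (r + r)) psi -> cont_on (square (corner r) (r + r)) Psi ->
  (forall z, rnorm z <= 2 * r -> differentiable U z) ->
  (forall z, square (corner r) (r + r) z -> rnorm (psi z - Psi z) <= b) ->
  ((rnorm (psi w * cauchy_integral (fun=> 1) r w - cauchy_integral psi r w) - 64 * b - 64 * t)%:E <=
   (32 / t * rnorm (Psi w - U w) ^+ 2)%:E + (4 / (r * t))%:E *
     \sum_(j < 4) \int[leb]_(s in `[0%R, (r + r)%R])
       (rnorm (Psi (edge_path (corner r) (r + r)%R j s) - U (edge_path (corner r) (r + r)%R j s)) ^+ 2)%:E)%E.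
Proof.
move=> r0 t0 wr psic Psic Ud psib.
set k := cauchy_integral (fun=> 1) r w.
have Uc : cont_on (edge (corner r) (r + r)) U.
  by move=> z /edge_square/square_sub_disc zr; apply: differentiable_continuous; exact: Ud.
have Dc : cont_on (edge (corner r) (r + r)) (fun z => Psi z - U z).
  by move=> z zE; apply: (@continuousB C C^o C Psi U); [exact: Psic (edge_square zE)|exact: Uc].
have Bc : cont_on (edge (corner r) (r + r)) (fun z => psi z - Psi z).
  by move=> z zE; apply: (@continuousB C C^o C psi Psi); [exact: psic (edge_square zE)|exact: Psic (edge_square zE)].
have DUc : cont_on (edge (corner r) (r + r)) (fun z => (Psi z - U z) + U z).
  by move=> z zE; apply: (@continuousD C C^o C (fun z => Psi z - U z) U); [exact: Dc|exact: Uc].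
have e1 : cauchy_integral psi r w = cauchy_integral (fun z => psi z - Psi z) r w + cauchy_integral (fun z => Psi z - U z) r w + U w * k.
  rewrite -(cauchy_formula r0 Ud wr) -addrA -(cauchy_integralD r0 wr Dc Uc) -(cauchy_integralD r0 wr Bc DUc).
  by apply: eq_contour => z _; rewrite !subrK.
have k32 : rnorm k <= 32.
  have := @cauchy_integral_bound R (fun=> 1) r 1 r0 _ _ w wr; rewrite mulr1; apply.
    by move=> z _; exact: cst_continuous.
  by move=> z _; rewrite -[1]/((1 : R)%:C) rnorm_real ?normr1.
have wS : square (corner r) (r + r) w by apply: disc_sub_square; lra.
have B32 : rnorm (cauchy_integral (fun z => psi z - Psi z) r w) <= 32 * b.
  by apply: cauchy_integral_bound => // z /edge_square; exact: psib.
have y := cauchy_integral_young r0 t0 Dc wr.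
set S := (\sum_(j < 4) _)%E in y *.
have S0 : (0 <= S)%E.
  by apply: sume_ge0 => j _; apply: integral_ge0 => s _; rewrite lee_fin exprn_ge0// rnorm_ge0.
set x := rnorm (Psi w - U w); have x0 : 0 <= x by exact: rnorm_ge0.
have main : rnorm (psi w * k - cauchy_integral psi r w) - 64 * b - 64 * t <=
   32 / t * x ^+ 2 + (rnorm (cauchy_integral (fun z => Psi z - U z) r w) - 32 * t).
  have -> : psi w * k - cauchy_integral psi r w = (psi w - Psi w) * k + (Psi w - U w) * k
      - cauchy_integral (fun z => psi z - Psi z) r w - cauchy_integral (fun z => Psi z - U z) r w.
    by rewrite e1; ring.
  set cB := cauchy_integral _ r w in B32 *; set cD := cauchy_integral _ r w.
  have n1 := rnormD ((psi w - Psi w) * k + (Psi w - U w) * k - cB) (- cD).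
  have n2 := rnormD ((psi w - Psi w) * k + (Psi w - U w) * k) (- cB).
  have n3 := rnormD ((psi w - Psi w) * k) ((Psi w - U w) * k).
  rewrite !rnormN !rnormM -/x in n1 n2 n3.
  have m1 : rnorm (psi w - Psi w) * rnorm k <= b * 32 by apply: ler_pM; rewrite ?rnorm_ge0// psib.
  have m2 : x * rnorm k <= x * 32 by rewrite ler_wpM2l.
  have m3 : x <= t + x ^+ 2 / t := le_add_sqr_div x t0.
  have -> : 32 / t * x ^+ 2 = 32 * (x ^+ 2 / t) by ring.
  lra.
apply: (@le_trans _ _ ((32 / t * x ^+ 2)%:E + (rnorm (cauchy_integral (fun z => Psi z - U z) r w) - 32 * t)%:E)%E).
  by rewrite -EFinD lee_fin.
by rewrite leeD2l// EFinB leeBlDl.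
Qed.
End pointwise_defect.

Section mean_defect.
Variables (R : realType) (n : nat).
Local Notation C := R[i].
Local Notation V := 'rV[C]_n.
Local Notation mu := (@lebesgueC R n).
Local Notation leb := (@lebesgue_measure R).

(** The pointwise bound for Psi = phi (F + v) and U = (h / g)(F + v), averaged over v
in S. *)
Lemma cauchy_defect (Omega E S : set V) (phi h g : V -> C) (F : C -> V) (psi : C -> C) (r t b c : R) (w : C) :
  open Omega -> (forall z, Omega z -> {for z, continuous phi}) ->
  holomorphic_on Omega h -> holomorphic_on Omega g -> (forall z, Omega z -> g z != 0) ->
  measurable (E : set (@borelC R n)) -> E `<=` Omega -> measurable (S : set (@borelC R n)) ->
  (forall z, rnorm z < 1 -> differentiable F z) -> 0 < r -> 2 * r < 1 ->
  (forall z v, rnorm z <= 2 * r -> S v -> E (F z + v)) ->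
  cont_on (square (corner r) (r + r)) psi ->
  (forall z v, square (corner r) (r + r) z -> S v -> rnorm (psi z - phi (F z + v)) <= b) ->
  rnorm w <= r / 2 -> 0 < t -> 0 <= c ->
  c = rnorm (psi w * cauchy_integral (fun=> 1) r w - cauchy_integral psi r w) - 64 * b - 64 * t ->
  (c%:E * mu S <= ((32 + 4 / r) / t)%:E * ((1 + 4 * (r + r))%:E * sqr_integral E (fun z => phi z - h z / g z)%R))%E.
Proof.
move=> oO phic hh hg g0 mE EO mS Fd r0 r1 FE psic psib wr t0 c0 cE.
have r20 : 0 <= r + r by rewrite addr_ge0// ltW.
pose u z := h z / g z.
have ud z : Omega z -> differentiable u z.
  by move=> Oz; apply: differentiable_div; [exact: hh|exact: hg|exact: g0].
pose E2 : @borelC R n -> \bar R := (fun z => (rnorm (phi z - u z) ^+ 2)%:E) \_ E.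
have mO := measurable_open oO.
have cm : cmeasurable_fun Omega (fun z => phi z - u z).
  apply: (open_cont_cmeasurable oO) => z Oz.
  apply: (@continuousB C C^o V phi u); first exact: phic.
  exact: (differentiable_continuous (ud _ Oz)).
have mE2 : measurable_fun setT E2.
  have qE : measurable_fun (E : set (@borelC R n)) (fun z => (rnorm (phi z - u z) ^+ 2)%:E).
    exact: (measurable_funS mO EO (cmeasurable_rnorm_sqr cm)).
  exact: ((measurable_restrictT _ mE).1 qE).
have E20 z : (0 <= E2 z)%E by apply: erestrict_ge0 => y _; rewrite lee_fin exprn_ge0// rnorm_ge0.
have E2int : (\int[mu]_z E2 z = sqr_integral E (fun z => phi z - h z / g z)%R)%E.
  by rewrite /sqr_integral [RHS]integral_mkcond.
have E2in z : E z -> E2 z = (rnorm (phi z - u z) ^+ 2)%:E by move=> Ez; rewrite /E2 patchE mem_set.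
(* Paths defined for all real s, so that they are continuous on the whole line; they agree
   with the edges for s between 0 and r + r. *)
pose clamp (s : R) : R := Num.max 0 (Num.min s (r + r)).
have clampP s : 0 <= clamp s <= r + r.
  by rewrite /clamp le_max lexx/= ge_max r20 ge_min lexx orbT.
have clampE s : 0 <= s <= r + r -> clamp s = s.
  by move=> /andP[s0 sr]; rewrite /clamp (min_idPl sr) (max_idPr s0).
have clampc : continuous clamp.
  move=> s; have hm : {for s, continuous (fun s : R => Num.min s (r + r))}.
    exact: (@continuous_min R R (fun s => s) (fun=> r + r) s (@cvg_id _ _) (@cst_continuous _ _ _ _)).
  exact: (@continuous_max R R (fun=> 0) (fun s => Num.min s (r + r)) s (@cst_continuous _ _ _ _) hm).
have sq2 z : square (corner r) (r + r) z -> rnorm z <= 2 * r by exact: square_sub_disc.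
have w2 : rnorm w <= 2 * r by lra.
pose p (j : 'I_4) s := F (edge_path (corner r) (r + r) j (clamp s)).
have pc j : continuous (p j).
  move=> s; apply: (@continuous_comp _ _ _ (fun s => edge_path (corner r) (r + r) j (clamp s))).
    by apply: (@continuous_comp _ _ _ clamp); [exact: clampc|exact: edge_path_continuous].
  apply: differentiable_continuous; apply: Fd; apply: le_lt_trans r1; apply: sq2.
  by apply: edge_square; exact: edge_path_edge.
rewrite -E2int; apply: (@averaging R n E2 S (F w) p (r + r) c _ mE2 E20 mS pc r20 c0).
  by rewrite divr_ge0// ?addr_ge0 ?divr_ge0// ltW.
move=> v Sv.
pose U z := u (F z + v); pose Psi z := phi (F z + v).
have Ud z : rnorm z <= 2 * r -> differentiable U z.
  move=> zr; apply: (@differentiable_comp _ _ _ _ (fun z => F z + v)).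
    by apply: differentiableD; [apply: Fd; exact: le_lt_trans r1|exact: differentiable_cst].
  by apply: ud; apply: EO; exact: FE.
have Psic : cont_on (square (corner r) (r + r)) Psi.
  move=> z /sq2 zr; apply: (@continuous_comp _ _ _ (fun z => F z + v)).
    apply: continuousD; last exact: cst_continuous.
    by apply: differentiable_continuous; apply: Fd; exact: le_lt_trans r1.
  by apply: phic; apply: EO; exact: FE.
have EE z : rnorm z <= 2 * r -> E2 (F z + v) = (rnorm (Psi z - U z) ^+ 2)%:E.
  by move=> zr; rewrite E2in//; exact: FE.
have := defect_pointwise r0 t0 wr psic Psic Ud (fun z zS => psib z v zS Sv).
rewrite -cE => /le_trans; apply.
have -> : (\sum_(j < 4) \int[leb]_(s in `[0%R, (r + r)%R]) E2 (p j s + v)%R)%E =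
    (\sum_(j < 4) \int[leb]_(s in `[0%R, (r + r)%R])
    (rnorm (Psi (edge_path (corner r) (r + r)%R j s) - U (edge_path (corner r) (r + r)%R j s)) ^+ 2)%:E)%E.
  apply: eq_bigr => j _; apply: eq_integral => s /set_mem /=; rewrite in_itv/= => sr.
  have -> : p j s = F (edge_path (corner r) (r + r)%R j s) by rewrite /p (clampE _ sr).
  by rewrite EE//; apply: sq2; apply: edge_square; exact: edge_path_edge.
rewrite EE//.
set T := (\sum_(j < 4) _)%E.
have T0 : (0 <= T)%E.
  by apply: sume_ge0 => j _; apply: integral_ge0 => s _; rewrite lee_fin exprn_ge0// rnorm_ge0.
have a0 : 0 <= 32 / t := divr_ge0 (ler0n _ 32) (ltW t0).
have b0 : 0 <= 4 / (r * t) := divr_ge0 (ler0n _ 4) (mulr_ge0 (ltW r0) (ltW t0)).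
have -> : (32 + 4 / r) / t = 32 / t + 4 / (r * t) by field; rewrite !gt_eqF.
rewrite ge0_muleDr ?lee_fin ?exprn_ge0 ?rnorm_ge0//; apply: leeD.
  by rewrite -EFinM lee_fin ler_wpM2r ?exprn_ge0 ?rnorm_ge0// lerDl.
by apply: lee_wpmul2r => //; rewrite lee_fin lerDr.
Qed.
End mean_defect.

(** * Continuity up to the boundary *)

Section moduli.
Variables (R : realType).
Local Notation C := R[i].

Lemma within_modulus (V W : normedModType C) (K : set V) (phi : V -> W) (x : V) (e : R) :
  {within K, continuous phi} -> K x -> 0 < e ->
  exists2 t : R, 0 < t & forall y, K y -> rnorm (y - x) < t -> rnorm (phi y - phi x) < e.
Proof.
move=> /subspace_continuousP/(_ x) phic Kx e0.
have [t t0 tP] : exists2 t : R, 0 < t & forall y, rnorm (y - x) < t -> K y -> rnorm (phi y - phi x) < e.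
  apply/nbhs_rnorm; apply: (phic Kx [set y | rnorm (y - phi x) < e]); apply/nbhs_rnorm.
  by exists e.
by exists t => // y Ky yx; exact: tP.
Qed.

Lemma continuous_rnormP (V W : normedModType C) (f : V -> W) (x : V) : {for x, continuous f} ->
  forall e : R, 0 < e -> exists2 t : R, 0 < t & forall y, rnorm (y - x) < t -> rnorm (f y - f x) < e.
Proof.
move=> fc e e0; apply/nbhs_rnorm; apply: (fc [set y | rnorm (y - f x) < e]); apply/nbhs_rnorm.
by exists e.
Qed.

Lemma continuous_comp_within (V W : normedModType C) (K : set V) (f : C -> V) (phi : V -> W) (z : C) (s : R) :
  {within K, continuous phi} -> 0 < s -> (forall y, rnorm (y - z) < s -> K (f y)) ->
  {for z, continuous f} -> {for z, continuous (phi \o f)}.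
Proof.
move=> phic s0 fK fc P /nbhs_rnorm[e e0 eP].
have Kz : K (f z) by apply: fK; rewrite subrr rnorm0.
have [t t0 tP] := within_modulus phic Kz e0.
have [u u0 uP] := continuous_rnormP fc t0.
apply/nbhs_rnorm; exists (Num.min s u); first by rewrite lt_min s0.
by move=> y; rewrite lt_min => /andP[ys yu]; apply: eP; apply: tP; [exact: fK|exact: uP].
Qed.

Lemma square_cover (p z : C) (d : R) : square p (d + d) z ->
  [\/ square p d z, square (p + d%:C) d z, square (p + 'i * d%:C) d z | square (p + d%:C + 'i * d%:C) d z].
Proof.
rewrite /square; case: p => a b; case: z => x v /= [/andP[x0 x1] /andP[v0 v1]].
rewrite !(mul0r, mul1r, subr0, addr0, add0r, mulr0).
have [hx|hx] := leP (x - a) d; have [hv|hv] := leP (v - b) d.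
- by constructor 1; split; apply/andP; split.
- constructor 3; split; apply/andP; split=> //; lra.
- constructor 2; split; apply/andP; split=> //; lra.
- by constructor 4; split; apply/andP; split; lra.
Qed.

(** Uniformity over the square of the continuity of phi at the points f z, by
[square_ind]. *)
Lemma modulus_along (V W : normedModType C) (K : set V) (phi : V -> W) (f : C -> V) (p0 : C) (d0 e : R) :
  0 < d0 -> {within K, continuous phi} ->
  (forall z, square p0 d0 z -> K (f z)) -> (forall z, square p0 d0 z -> {for z, continuous f}) ->
  0 < e ->
  exists2 t : R, 0 < t & forall z y, square p0 d0 z -> K y -> rnorm (y - f z) < t ->
    rnorm (phi y - phi (f z)) < e.
Proof.
move=> d00 phic fK fc e0.
pose P (p : C) (d : R) := exists2 t : R, 0 < t & forall z y, square p d z -> K y -> rnorm (y - f z) < t ->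
    rnorm (phi y - phi (f z)) < e.
have e2 : 0 < e / 2 by exact: divr_gt0.
apply: (@square_ind R P p0 d0 d00) => [z0 z0S|p d dp sub].
  have [t t0 tP] := within_modulus phic (fK _ z0S) e2.
  have t2 : 0 < t / 2 by exact: divr_gt0.
  have [u u0 uP] := continuous_rnormP (fc _ z0S) t2.
  exists (u / 2); first exact: divr_gt0.
  move=> p d /andP[d0' du] sub z0p; exists (t / 2) => // z y zp Ky yz.
  have zz0 : rnorm (z - z0) < u by have := square_diam z0p zp; lra.
  have fz := uP _ zz0.
  have h1 : rnorm (phi y - phi (f z0)) < e / 2.
    apply: tP => //; have := rnormD (y - f z) (f z - f z0); rewrite addrA subrK; lra.
  have h2 : rnorm (phi (f z) - phi (f z0)) < e / 2.
    by apply: tP; [exact/fK/sub|lra].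
  have := rnormD (phi y - phi (f z0)) (- (phi (f z) - phi (f z0))).
  rewrite rnormN opprB addrA subrK; lra.
move=> [t1 a1 b1] [t2 a2 b2] [t3 a3 b3] [t4 a4 b4].
exists (Num.min (Num.min t1 t2) (Num.min t3 t4)); first by rewrite !lt_min a1 a2 a3 a4.
move=> z y zS Ky; rewrite !lt_min => /andP[/andP[h1 h2] /andP[h3 h4]].
have := square_cover zS.
by case=> zp; [exact: b1 h1|exact: b2 h2|exact: b3 h3|exact: b4 h4].
Qed.

(** If z and its reflection 2 w - z were both in Omega for w close to x, then x would be
the midpoint of the reflection and of a point close to z, and hence in Omega. *)
Lemma reflection_leaves n (Omega : set 'rV[C]_n) (x z : 'rV[C]_n) : open Omega -> convex_set Omega ->
  ~ Omega x -> Omega z ->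
  exists2 e : R, 0 < e & forall w, rnorm (w - x) < e -> ~ Omega (w - (z - w)).
Proof.
move=> oO cO Ox Oz; have [s s0 sP] := open_rnorm oO Oz.
exists (s / 2); first exact: divr_gt0.
move=> w wx Ow; apply: Ox.
have Oy : Omega (z + 2 *: (x - w)).
  apply: sP; rewrite addrAC subrr add0r rnormZ -(rnormN (x - w)) opprB.
  by rewrite -[2]/((2%:R : C)) -(rmorph_nat (@real_complex R)) rnorm_real ger0_norm//; lra.
have half01 : 0 <= (2^-1 : R) <= 1 by apply/andP; split; lra.
have := (convex_setCP Omega).1 cO _ _ _ Ow Oy half01.
have -> : 1 - 2^-1 = 2^-1 :> R by lra.
rewrite -scalerDr (_ : w - (z - w) + (z + 2 *: (x - w)) = 2 *: x); last first.
  by apply/rowP => j; rewrite !mxE; ring.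
by rewrite scalerA fmorphV/= rmorph_nat mulVf ?scale1r// pnatr_eq0.
Qed.
End moduli.

(** * Holomorphy along a boundary disc *)

Section normalized_tests.
Variables (R : realType) (n : nat).
Local Notation C := R[i].
Local Notation V := 'rV[C]_n.
Local Notation mu := (@lebesgueC R n).

(** The constant does not depend on A. *)
Lemma polydisc_lower (d : R) : 0 < d -> exists2 K : R, 0 < K &
  forall A : 'M[C]_n, \det A != 0 -> (mu (cell0 A 1) <= K%:E * mu (polydisc A d))%E.
Proof.
move=> d0; have d2 : 0 < d / 2 by exact: divr_gt0.
pose N := (Num.truncn (2 / (d / 2))).+1.
exists ((N * 2 * (N * 2))%:R ^+ n); first by rewrite exprn_gt0// ltr0n !muln_gt0.
move=> A dA; apply: (@le_trans _ _ (((N * 2 * (N * 2))%:R ^+ n)%:E * mu (cell0 A (d / 2)))%E).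
  apply: cover_measure => //; first exact: measurable_cell.
  move=> z i /(cell0_le i) h; apply: le_lt_trans h _; rewrite mulr1 -ltr_pdivrMr//.
  by rewrite truncnS_gt// divr_ge0// ltW.
apply: lee_wpmul2l; first by rewrite lee_fin exprn_ge0.
apply: le_measure; rewrite ?inE; [exact: measurable_cell|exact: measurable_polydisc|].
by move=> v /= vc i; have := cell0_le i vc; rewrite mulrC divfK// pnatr_eq0.
Qed.

Lemma polydisc_fin (A : 'M[C]_n) (d : R) : \det A != 0 -> d < 1 -> (mu (polydisc A d) < +oo)%E.
Proof.
move=> dA d1; apply: le_lt_trans (polydisc_upper dA d1) _.
by rewrite lte_mul_pinfty ?lee_fin ?exprn_ge0// cell0_fin.
Qed.

(** Translated to w, the polydisc of radius rho lies in Omega, so its size is at most that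
of Omega; the smaller polydisc is proportional to it. *)
Lemma polydisc_diam (Omega : set V) (M : R) (w v : V) (A : 'M[C]_n) (rho d : R) :
  (forall z, Omega z -> rnorm z <= M) -> Omega w ->
  (forall v, polydisc A rho v -> Omega (w + v)) -> 0 < rho -> 0 < d ->
  polydisc A d v -> rnorm v <= d / rho * (2 * M).
Proof.
move=> OM Ow PO r0 d0 Pv.
have s0 : 0 < rho / d by exact: divr_gt0.
have Pz : polydisc A rho ((rho / d)%:C *: v).
  move=> i; rewrite /row_form pairingZr rnormM rnorm_real gtr0_norm//.
  by have := Pv i; rewrite -(ler_pM2l s0) divfK ?gt_eqF.
have := OM _ (PO _ Pz); have := OM _ Ow => h1 h2.
have := rnormD (w + (rho / d)%:C *: v) (- w).
rewrite addrAC subrr add0r rnormN rnormZ rnorm_real gtr0_norm// => h3.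
have h4 : rho / d * rnorm v <= 2 * M by lra.
have e : d / rho * (rho / d * rnorm v) = rnorm v by field; rewrite !gt_eqF.
by rewrite -e ler_pM2l// divr_gt0.
Qed.

(** Normalization of [test_fun] by the volume of the unit cell: the square integral over
Omega is then bounded by a constant depending on n alone, and the modulus squared on the
polydisc is at least of the order of the inverse volume. *)
Lemma test_function (Omega : set V) (M : R) (w : V) (A : 'M[C]_n) :
  open Omega -> (forall z, Omega z -> rnorm z <= M) -> Omega w -> \det A != 0 ->
  (forall i, polar Omega w (row i A)) ->
  exists (nu : R) (g : V -> C), [/\ 0 < nu /\ mu (cell0 A 1) = nu%:E, holomorphic_on Omega g,
    forall z, Omega z -> g z != 0, (sqr_integral Omega g <= (128 ^+ n)%:E)%E &
    forall z, polydisc A 1 (z - w) -> 1 <= 81 ^+ n * nu * rnorm (g z) ^+ 2].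
Proof.
move=> oO OM Ow dA polA.
have fin : mu (cell0 A 1) \is a fin_num by rewrite ge0_fin_numE// cell0_fin.
pose nu := fine (mu (cell0 A 1)).
have nuE : mu (cell0 A 1) = nu%:E by rewrite fineK.
have nu0 : 0 < nu by rewrite -lte_fin -nuE cell0_gt0.
have Re1 z i : Omega z -> complex.Re (row_form A (z - w) i) <= 1 by move=> Oz; exact: polA.
pose s : C := (Num.sqrt nu)^-1%:C.
have s2 : rnorm s ^+ 2 = nu^-1.
  by rewrite rnorm_real real_normK ?num_real// exprVn sqr_sqrtr// ltW.
have s0 : s != 0 by rewrite -rnorm_eq0 -sqrf_eq0 s2 invr_eq0 gt_eqF.
exists nu, (fun z => s * test_fun A w z); split; first by split.
- move=> z Oz; apply: (@differentiableM C V (fun=> s) (test_fun A w)); first exact: differentiable_cst.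
  by apply: test_fun_differentiable_half => i; exact: Re1.
- move=> z Oz; rewrite mulf_neq0//; apply/prodf_neq0 => i _; rewrite invr_eq0 expf_neq0//.
  apply/eqP => e; have /(congr1 (@complex.Re R)) := e; have := Re1 z i Oz.
  rewrite raddfB/=; lra.
- have mt : measurable_fun (Omega : set (@borelC R n)) (fun z => (rnorm (test_fun A w z) ^+ 2)%:E).
    apply: cmeasurable_rnorm_sqr; apply: (open_cont_cmeasurable oO) => z Oz.
    by apply: differentiable_continuous; apply: test_fun_differentiable_half => i; exact: Re1.
  rewrite /sqr_integral; under eq_integral do rewrite rnormM exprMn s2 EFinM.
  rewrite ge0_integralZl_EFin//; last 3 first.
  - exact: measurable_open.
  - by move=> z _; rewrite lee_fin exprn_ge0// rnorm_ge0.
  - by rewrite invr_ge0 ltW.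
  have OM2 z : Omega z -> rnorm (z - w) <= 2 * M.
    move=> Oz; have := rnormD z (- w); rewrite rnormN; have := OM _ Oz; have := OM _ Ow; lra.
  rewrite muleC -lee_pdivlMr ?invr_gt0// invrK -nuE.
  exact: (test_integral dA oO OM2).
- move=> z Pz; have := test_fun_lower Pz (lexx _).
  rewrite rnormM exprMn s2 => h.
  have h2 : (9 ^- n) ^+ 2 <= rnorm (test_fun A w z) ^+ 2 by rewrite lerXn2r ?nnegrE ?rnorm_ge0 ?invr_ge0 ?exprn_ge0.
  have -> : 81 ^+ n * nu * (nu^-1 * rnorm (test_fun A w z) ^+ 2) = 81 ^+ n * rnorm (test_fun A w z) ^+ 2.
    by field; rewrite gt_eqF.
  have e1 : 1 = 81 ^+ n * (9 ^- n) ^+ 2 :> R.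
    by rewrite exprVn -exprM mulnC exprM (_ : 9 ^+ 2 = 81)// -?natrX ?divff// expf_neq0.
  by rewrite [leLHS]e1 ler_pM2l// exprn_gt0.
Qed.

Lemma sqr_integral_quotient (Omega E : set V) (phi g h : V -> C) (K : R) :
  open Omega -> (forall z, Omega z -> {for z, continuous phi}) ->
  holomorphic_on Omega h -> holomorphic_on Omega g ->
  (forall z, Omega z -> g z != 0) ->
  measurable (E : set (@borelC R n)) -> E `<=` Omega -> 0 <= K ->
  (forall z, E z -> 1 <= K * rnorm (g z) ^+ 2) ->
  (sqr_integral E (fun z => phi z - h z / g z)%R <= K%:E * sqr_integral E (phi * g - h)%R)%E.
Proof.
move=> oO phic hh hg g0 mE EO K0 EK.
have hc f z : holomorphic_on Omega f -> Omega z -> {for z, continuous f}.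
  by move=> hf Oz; exact: (differentiable_continuous (hf _ Oz)).
have qc : forall z, Omega z -> {for z, continuous (fun z => phi z - h z / g z)}.
  move=> z Oz; apply: (@continuousB C C^o V phi (fun z => h z / g z)); first exact: phic.
  apply: (@continuousM C V h (fun z => (g z)^-1)); first exact: hc.
  by apply: (@continuousV C V g); [exact: g0|exact: hc].
have pc : forall z, Omega z -> {for z, continuous (phi * g - h)}.
  move=> z Oz; apply: (@continuousB C C^o V (phi * g) h); last exact: hc.
  by apply: (@continuousM C V phi g); [exact: phic|exact: hc].
have mO := measurable_open oO.
have m1 : measurable_fun (E : set (@borelC R n)) (fun z => (rnorm (phi z - h z / g z) ^+ 2)%:E).
  exact: (measurable_funS mO EO (cmeasurable_rnorm_sqr (open_cont_cmeasurable oO qc))).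
have m2 : measurable_fun (E : set (@borelC R n)) (fun z => (rnorm ((phi * g - h) z) ^+ 2)%:E).
  exact: (measurable_funS mO EO (cmeasurable_rnorm_sqr (open_cont_cmeasurable oO pc))).
have p0 (f : V -> C) z : (0 <= (rnorm (f z) ^+ 2)%:E)%E by rewrite lee_fin exprn_ge0// rnorm_ge0.
rewrite /sqr_integral -ge0_integralZl_EFin//.
apply: ge0_le_integral => //.
- by move=> z _; rewrite lee_fin exprn_ge0// rnorm_ge0.
- by apply: measurable_funeM; exact: m2.
move=> z Ez; have gz := g0 _ (EO _ Ez); rewrite -EFinM lee_fin.
have -> : (phi * g - h) z = (phi z - h z / g z) * g z.
  by rewrite mulrBl divfK.
rewrite rnormM exprMn mulrCA; apply: ler_peMr; [by rewrite exprn_ge0// rnorm_ge0|exact: EK].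
Qed.
End normalized_tests.

Section boundary_disc.
Variables (R : realType).
Local Notation C := R[i].

Lemma square_bounded (F : C -> C) (p0 : C) (d0 : R) : 0 < d0 -> cont_on (square p0 d0) F ->
  exists M, forall z, square p0 d0 z -> rnorm (F z) <= M.
Proof.
move=> d00 Fc; pose P (p : C) (d : R) := exists M, forall z, square p d z -> rnorm (F z) <= M.
apply: (@square_ind R P p0 d0 d00) => [z0 z0S|p d dp sub [M1 h1] [M2 h2] [M3 h3] [M4 h4]].
  have [u u0 uP] := continuous_rnormP (Fc _ z0S) ltr01.
  exists (u / 2); first exact: divr_gt0.
  move=> p d /andP[d0' du] sub z0p; exists (rnorm (F z0) + 1) => z zp.
  have zz0 : rnorm (z - z0) < u by have := square_diam z0p zp; lra.
  have := uP _ zz0; have := rnormD (F z - F z0) (F z0); rewrite subrK; lra.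
exists (Num.max (Num.max M1 M2) (Num.max M3 M4)) => z /square_cover zS; rewrite !le_max.
by case: zS => zp; [rewrite (h1 _ zp)|rewrite (h2 _ zp)|rewrite (h3 _ zp)|rewrite (h4 _ zp)]; rewrite ?orbT.
Qed.

Lemma defect_const_gt0 (r e : R) : 0 < r -> 0 < e -> 0 < (32 + 4 / r) / e * (1 + 4 * (r + r)).
Proof. by move=> r0 e0; rewrite mulr_gt0 ?divr_gt0 ?addr_gt0 ?divr_gt0 ?mulr_gt0 ?addr_gt0. Qed.

(** Of the two conditions the first keeps the smaller polydisc within half of the polydisc
of radius rho; the second makes its diameter, as bounded in [polydisc_diam], less than
tau / 2. *)
Lemma small_radius (rho tau M : R) : 0 < rho -> 0 < tau -> 0 <= M ->
  exists2 d, 0 < d & d <= rho / 2 /\ d / rho * (2 * M) < tau / 2.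
Proof.
move=> rho0 tau0 M0; exists (Num.min (rho / 2) (tau * rho / (4 * M + 4))).
  by rewrite lt_min !divr_gt0// ?mulr_gt0//; lra.
split; first by rewrite ge_min lexx.
set d := Num.min _ _.
have h : d <= tau * rho / (4 * M + 4) by rewrite ge_min lexx orbT.
have : d / rho <= tau / (4 * M + 4).
  by rewrite ler_pdivrMr//; apply: le_trans h _; rewrite mulrAC.
move=> h2; apply: (@le_lt_trans _ _ (tau / (4 * M + 4) * (2 * M))).
  by rewrite ler_wpM2r// mulr_ge0.
rewrite mulrAC ltr_pdivrMr; last lra.
by rewrite mulrAC mulrA; nra.
Qed.

Variable n : nat.
Local Notation V := 'rV[C]_n.
Local Notation mu := (@lebesgueC R n).

(** The argument at the centre of the disc.  The radii r and d are chosen before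
the accuracy eta, and the polydisc radius del after it; then the compactness of the Hankel
operator is used with an accuracy eps depending on all of them, and it provides an index k
beyond any given bound. *)
Lemma boundary_differentiable (Omega : set V) (phi : V -> C) (M : R) (q0 : V) (f : C -> V) :
  (0 < n)%N -> open Omega -> convex_set Omega -> (forall z, closure Omega z -> rnorm z <= M) -> Omega q0 ->
  {within closure Omega, continuous phi} -> compact_operator Omega (hankel Omega phi) ->
  (forall z, rnorm z < 1 -> differentiable f z) -> (forall z, rnorm z < 1 -> closure Omega (f z)) ->
  ~ Omega (f 0) -> differentiable (phi \o f) 0.
Proof.
move=> n0 oO cO cM Oq phic hank fd fcl f0.
have OM z : Omega z -> rnorm z <= M by move=> Oz; apply: cM; exact: subset_closure.
have M0 : 0 <= M by apply: le_trans (OM _ Oq); exact: rnorm_ge0.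
have phiO z : Omega z -> {for z, continuous phi}.
  move=> Oz P /nbhs_rnorm[e e0 eP].
  have [s s0 sP] := open_rnorm oO Oz.
  have [t t0 tP] := within_modulus phic (subset_closure Oz) e0.
  apply/nbhs_rnorm; exists (Num.min s t); first by rewrite lt_min s0.
  by move=> y; rewrite lt_min => /andP[ys yt]; apply: eP; apply: tP => //; apply: subset_closure; exact: sP.
have z01 : rnorm (0 : C) < 1 by rewrite rnorm0 ltr01.
pose t k : R := (k.+2)%:R^-1.
have tP k : 0 < t k <= 1 by rewrite invr_gt0 ltr0n/= invf_le1// ler1n.
have tN e : 0 < e -> exists N, forall k, (N <= k)%N -> t k * (2 * M) < e.
  move=> e0; exists (Num.truncn (2 * M / e)) => k Nk.
  rewrite mulrC ltr_pdivrMr// -ltr_pdivrMl// mulrC.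
  by apply: (lt_le_trans (truncnS_gt _)); rewrite ler_nat ltnS leqW.
(* The discs inside Omega. *)
pose F k z := (1 - t k)%:C *: f z + (t k)%:C *: q0.
have FO k z : rnorm z < 1 -> Omega (F k z) by move=> z1; exact: (convex_cone oO cO (fcl _ z1) Oq (tP k)).
have Fd k z : rnorm z < 1 -> differentiable (F k) z.
  move=> z1; apply: differentiableD; last exact: differentiable_cst.
  by apply: differentiableZ; exact: fd.
have Ff k z : rnorm z < 1 -> rnorm (F k z - f z) <= t k * (2 * M).
  move=> z1; have -> : F k z - f z = (t k)%:C *: (q0 - f z).
    by rewrite /F; apply/rowP => j; rewrite !mxE rmorphB/=; ring.
  have /andP[tk _] := tP k; rewrite rnormZ rnorm_real gtr0_norm// ler_pM2l//.
  by have := rnormD q0 (- f z); rewrite rnormN; have := OM _ Oq; have := cM _ (fcl _ z1); lra.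
pose w k := F k 0; have Ow k : Omega (w k) by exact: FO.
have /choice[A AP] : forall k, exists A : 'M[C]_n, [/\ \det A != 0, forall i, polar Omega (w k) (row i A)
    & forall v, polydisc A (4 * n%:R)^-1 v -> Omega (w k + v)].
  by move=> k; exact: (polar_frame oO cO OM (Ow k) n0).
pose rho : R := (4 * n%:R)^-1.
have n1 : 1 <= n%:R :> R by rewrite ler1n.
have rho0 : 0 < rho by rewrite invr_gt0; lra.
have rho1 : rho < 1 by rewrite invf_lt1; lra.
have dA k : \det (A k) != 0 by have [] := AP k.
have polA k i : polar Omega (w k) (row i (A k)) by have [_ + _] := AP k; apply.
have PO k v : polydisc (A k) rho v -> Omega (w k + v) by have [_ _ +] := AP k; apply.
have /choice[g gP] : forall k, exists p : R * (V -> C), [/\ 0 < p.1 /\ mu (cell0 (A k) 1) = p.1%:E,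
    holomorphic_on Omega p.2, forall z, Omega z -> p.2 z != 0, (sqr_integral Omega p.2 <= (128 ^+ n)%:E)%E &
    forall z, polydisc (A k) 1 (z - w k) -> 1 <= 81 ^+ n * p.1 * rnorm (p.2 z) ^+ 2].
  move=> k; have [nu [g h]] := test_function oO OM (Ow k) (dA k) (polA k).
  by exists (nu, g).
pose E k : set V := [set z | polydisc (A k) rho (z - w k)].
have mE k : measurable (E k : set (@borelC R n)).
  have := @measurable_shiftC R n (- w k) measurableT (polydisc (A k) rho) (measurable_polydisc (A k) rho).
  by rewrite setTI.
have EO k : E k `<=` Omega by move=> z /PO; rewrite addrC subrK.
have excl z : Omega z -> \forall k \near \oo, ~ E k z.
  move=> Oz; have [e e0 eP] := reflection_leaves oO cO f0 Oz.
  have [N NP] := tN _ e0.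
  exists N => // k Nk Ek; apply: (eP (w k)).
    exact: le_lt_trans (Ff k 0 z01) (NP _ Nk).
  apply: PO => i; have := Ek i.
  have -> : - (z - w k) = (-1 : C) *: (z - w k) by rewrite scaleN1r.
  by rewrite /row_form pairingZr rnormM rnormN -[1]/((1 : R)%:C) rnorm_real normr1 mul1r.
have [d d0 dP] := borel_caratheodory (divr_gt0 rho0 (ltr0n _ 2)).
pose r : R := Num.min d (2^-1) / 2.
have r0 : 0 < r by rewrite divr_gt0// lt_min d0 invr_gt0 ltr0n.
have r2 : 2 * r = Num.min d (2^-1) by rewrite mulrC divfK// pnatr_eq0.
have rd : 2 * r <= d by rewrite r2 ge_min lexx.
have rh : 2 * r <= 2^-1 by rewrite r2 ge_min lexx orbT.
have r1 : 2 * r < 1 by lra.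
have z1 (z : C) : rnorm z <= 2 * r -> rnorm z < 1 by move=> h; exact: le_lt_trans r1.
(* The discs stay in the half-size polydiscs, on a disc that does not depend on k. *)
have bc k z i : rnorm z <= 2 * r -> rnorm (row_form (A k) (F k z - w k) i) <= rho / 2.
  move=> zr; apply: (dP (fun z => row_form (A k) (F k z - w k) i)); last exact: le_trans rd.
  - move=> y y1; apply: (@differentiable_comp _ _ _ _ (fun z => F k z - w k) (fun v => pairing (row i (A k)) v)); last exact: pairing_differentiable.
    by apply: differentiableB; [exact: Fd|exact: differentiable_cst].
  - by move=> y y1; apply: polA; exact: FO.
  - by rewrite /w subrr /row_form -(scale0r (0 : V)) pairingZr mul0r.
have rr0 : 0 < r + r by rewrite addr_gt0.
have sq2 z : square (corner r) (r + r) z -> rnorm z <= 2 * r by exact: square_sub_disc.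
have fc z : rnorm z < 1 -> {for z, continuous f} by move=> ?; apply: differentiable_continuous; exact: fd.
pose psi := phi \o f.
have psic : cont_on (square (corner r) (r + r)) psi.
  move=> z /sq2 zr; apply: (@continuous_comp_within _ _ _ _ f phi z (2^-1) phic).
  - by rewrite invr_gt0 ltr0n.
  - by move=> y yz; apply: fcl; have := rnormD (y - z) z; rewrite subrK; lra.
  - by apply: fc; exact: z1.
have [Mp MpP] := square_bounded rr0 psic.
have r20 : 0 < r / 2 := divr_gt0 r0 (ltr0n _ 2).
apply: (@cauchy_differentiable R psi r (r / 2) Mp r0 r20).
- by move=> z /edge_square; exact: psic.
- by move=> z /edge_square; exact: MpP.
move=> w0 /ltW w0r.
set x := rnorm (psi w0 * cauchy_integral (fun=> 1) r w0 - cauchy_integral psi r w0).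
have [x0|x0] := leP x 0.
  apply/esym/eqP; rewrite -subr_eq0 -rnorm_eq0 -/x eq_le x0; exact: rnorm_ge0.
(* The two errors of size 64 eta add up to x / 2. *)
exfalso; pose eta := x / 256.
have eta0 : 0 < eta := divr_gt0 x0 (ltr0n _ 256).
have [tau tau0 tauP] : exists2 tau : R, 0 < tau & forall z y, square (corner r) (r + r) z -> closure Omega y ->
    rnorm (y - f z) < tau -> rnorm (phi y - phi (f z)) < eta.
  apply: modulus_along => // z /sq2/z1; [exact: fcl|exact: fc].
have [del del0 [delr delt]] := small_radius rho0 tau0 M0.
have [N NP] := tN _ (divr_gt0 tau0 (ltr0n _ 2)).
have [K K0 KP] := polydisc_lower n del0.
(* L is the constant of [cauchy_defect]; B adds the losses from the test functions and from
   the smaller polydisc. *)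
pose L := (32 + 4 / r) / eta * (1 + 4 * (r + r)).
have L0 : 0 < L := defect_const_gt0 r0 eta0.
pose B := L * (81 ^+ n * K).
have B0 : 0 < B := mulr_gt0 L0 (mulr_gt0 (exprn_gt0 n (ltr0n _ 81)) K0).
pose c := x / 2.
have c0 : 0 < c := divr_gt0 x0 (ltr0n _ 2).
pose eps := c / (2 * B).
have eps0 : 0 < eps := divr_gt0 c0 (mulr_gt0 (ltr0n _ 2) B0).
have [k [h [Nk hh hE]]] : exists k (h : V -> C), [/\ (N <= k)%N, holomorphic_on Omega h
    & (sqr_integral (E k) (phi * (g k).2 - h)%R <= eps%:E)%E].
  have gh k : holomorphic_on Omega (g k).2 by have [] := gP k.
  have gI k : (sqr_integral Omega (g k).2 <= (Num.sqrt (128 ^+ n) ^+ 2)%:E)%E.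
    by rewrite sqr_sqrtr ?exprn_ge0//; have [] := gP k.
  exact: (hankel_small oO phiO hank gh (sqrtr_ge0 _) gI mE EO excl N eps0).
have [[nu0 nuE] hg g0 _ g1] := gP k.
(* The translations over which the defect is averaged. *)
pose S := polydisc (A k) del.
have mS : measurable (S : set (@borelC R n)) by exact: measurable_polydisc.
have FE z v : rnorm z <= 2 * r -> S v -> E k (F k z + v).
  move=> zr Sv i; rewrite addrAC row_formD; apply: le_trans (rnormD _ _) _.
  apply: le_trans (lerD (bc k z i zr) (le_trans (Sv i) delr)) _.
  by rewrite -splitr.
have psib z v : square (corner r) (r + r) z -> S v -> rnorm (psi z - phi (F k z + v)) <= eta.
  move=> zS Sv; rewrite -rnormN opprB; apply: ltW; apply: tauP => //.
    by apply: subset_closure; apply: (EO k); apply: FE => //; exact: sq2.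
  have vs := le_lt_trans (polydisc_diam OM (Ow k) (PO k) rho0 del0 Sv) delt.
  have Fs := le_lt_trans (Ff k z (z1 _ (sq2 _ zS))) (NP _ Nk).
  by rewrite addrAC; apply: le_lt_trans (rnormD _ _) _; rewrite [ltRHS]splitr ltrD.
have cE : c = x - 64 * eta - 64 * eta by rewrite /c /eta; field.
have := @cauchy_defect R n Omega (E k) S phi h (g k).2 (F k) psi r eta eta c w0 oO phiO hh hg g0 (mE k) (EO k)
   mS (Fd k) r0 r1 FE psic psib w0r eta0 (ltW c0) cE.
have I0 : (sqr_integral (E k) (fun z => phi z - h z / (g k).2 z)%R <= (81 ^+ n * (g k).1)%:E * eps%:E)%E.
  apply: (@le_trans _ _ ((81 ^+ n * (g k).1)%:E * sqr_integral (E k) (phi * (g k).2 - h)%R)%E).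
    apply: (sqr_integral_quotient oO phiO hh hg g0 (mE k) (EO k)).
      by rewrite mulr_ge0 ?exprn_ge0// ltW.
    by move=> z Ez; apply: g1 => i; apply: le_trans (Ez i) (ltW rho1).
  by apply: lee_wpmul2l => //; rewrite lee_fin mulr_ge0 ?exprn_ge0// ltW.
have del1 : del < 1.
  apply: le_lt_trans delr _; apply: le_lt_trans rho1.
  by rewrite ler_pdivrMr// ler_peMr ?(ltW rho0)// ler1n.
have fS : mu S \is a fin_num.
  by rewrite ge0_fin_numE//; apply: polydisc_fin => //; exact: del1.
have := KP _ (dA k); rewrite nuE -/S -[mu S]fineK//; set m := fine (mu S) => nuK.
have m0 : (g k).1 <= K * m by rewrite -lee_fin EFinM.
rewrite -EFinM => H.
have : ((c * m)%:E <= (L * (81 ^+ n * (g k).1 * eps))%:E)%E.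
  apply: le_trans H _; rewrite muleA -EFinM -/L.
  have L0e : (0 <= L%:E)%E by rewrite lee_fin ltW.
  by apply: le_trans (lee_wpmul2l L0e I0) _; rewrite -!EFinM.
rewrite lee_fin => H2.
have e1 : L * (81 ^+ n * (K * m) * eps) = c * m / 2.
  rewrite /eps /B; field; rewrite !gt_eqF//= ?exprn_gt0//.
have H3 : c * m <= c * m / 2.
  apply: le_trans H2 _; rewrite -e1; apply: ler_wpM2l; first exact: ltW.
  by apply: ler_wpM2r; [exact: ltW|apply: ler_wpM2l; [exact: exprn_ge0|]].
have m00 : 0 < m.
  by rewrite -(pmulr_rgt0 _ K0); exact: lt_le_trans m0.
by move: H3; rewrite leNgt ltr_pdivrMr// ltr_pMr ?(mulr_gt0 c0 m00)// ltr1n.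
Qed.
End boundary_disc.

Section unit_disc_facts.
Variable R : realType.
Local Notation C := R[i].

Lemma unit_discE (z : C) : unit_disc z <-> rnorm z < 1.
Proof. by rewrite /unit_disc/= -ltcR -rnormE. Qed.

Lemma bounded_closure (V : normedModType C) (D : set V) : bounded_set D ->
  exists M : R, forall z, closure D z -> rnorm z <= M.
Proof.
move=> [M [Mr MD]].
have [m Mm] : exists m : R, M = m%:C.
  by exists (complex.Re M); case: (M) Mr => a b; rewrite complex_real/= => /eqP->.
exists (m + 1 + 1) => z Dz.
have [y [Dy yz]] : D `&` [set y | rnorm (y - z) < 1] !=set0.
  by apply: Dz; apply/nbhs_rnorm; exists 1.
have : rnorm y <= m + 1.
  have := MD (m + 1)%:C; rewrite Mm ltcR ltrDl ltr01 => /(_ isT y Dy).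
  by rewrite /= rnormE lecR.
move: yz; rewrite /= -rnormN opprB; have := rnormD (z - y) y; rewrite subrK; lra.
Qed.
End unit_disc_facts.

Theorem theorem2 (R : realType) (n : nat) (n_gt0 : (0 < n)%N)
    (Omega : set 'rV[R[i]]_n) (phi : 'rV[R[i]]_n -> R[i]) :
  is_domain Omega -> bounded_set Omega -> convex_set Omega ->
  {within closure Omega, continuous phi} ->
  compact_operator Omega (hankel Omega phi) ->
  forall f : R[i] -> 'rV[R[i]]_n,
    holomorphic_on unit_disc f ->
    f @` unit_disc `<=` boundary Omega ->
    holomorphic_on unit_disc (phi \o f).
Proof.
move=> [oO _ [q0 Oq]] bO cO phic hank f hf fb z0 /unit_discE z0D.
have [M cM] := bounded_closure bO.
pose s : R := (1 - rnorm z0) / 2.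
have s0 : 0 < s by rewrite divr_gt0// subr_gt0.
have sC0 : s%:C != 0 :> R[i] by rewrite -rnorm_eq0 rnorm_real normr_eq0 gt_eqF.
have sD z : rnorm z < 1 -> unit_disc (z0 + s%:C * z).
  move=> z1; apply/unit_discE; apply: le_lt_trans (rnormD _ _) _.
  rewrite rnormM rnorm_real gtr0_norm//.
  have : s * rnorm z < s by rewrite gtr_pMr.
  rewrite /s; lra.
have fbd z : rnorm z < 1 -> boundary Omega (f (z0 + s%:C * z)).
  by move=> z1; apply: fb; exists (z0 + s%:C * z) => //; exact: sD.
have affd (a b z : R[i]) : differentiable (fun z => a + b * z : R[i]) z.
  apply: (@differentiableD _ _ _ (fun=> a) (fun z => b * z)); first exact: differentiable_cst.
  by apply: (@differentiableM R[i] R[i] (fun=> b) id); [exact: differentiable_cst|exact: ex_diff].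
have gd z : rnorm z < 1 -> differentiable (fun z => f (z0 + s%:C * z)) z.
  move=> z1; apply: (@differentiable_comp _ _ _ _ (fun z => z0 + s%:C * z) f); first exact: affd.
  by apply: hf; exact: sD.
have gcl z : rnorm z < 1 -> closure Omega (f (z0 + s%:C * z)) by move=> /fbd[].
have g0 : ~ Omega (f (z0 + s%:C * 0)).
  have h01 : rnorm (0 : R[i]) < 1 by rewrite rnorm0 ltr01.
  by have [_ h] := fbd _ h01; move=> Of; apply: h; move/interior_id: oO => ->.
have main := boundary_differentiable n_gt0 oO cO cM Oq phic hank gd gcl g0.
have -> : phi \o f = (phi \o (fun z => f (z0 + s%:C * z))) \o (fun z => - (s%:C^-1 * z0) + s%:C^-1 * z).
  apply/funext => z /=; congr (phi (f _)).
  by rewrite mulrDr mulrN !mulrA divff// !mul1r addrA subrr add0r.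
apply: differentiable_comp; first exact: affd.
by rewrite (_ : _ + _ = 0)// addrC subrr.
Qed.
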